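(* Let $(r,s)\in\mathbb{R}^2\setminus\frac12\mathbb{Z}^2$. Then for every $\tau_0\in\mathbb{H}$ with $t(\tau_0)\in\mathbb{R}\setminus\{0,1\}$, the value $\wp(p_{r,s}(\tau_0)|\tau_0)$ is finite. Equivalently, every branch of the solution $\lambda_{r,s}(t)$ of PVI$(\frac98,-\frac18,\frac18,\frac38)$ is holomorphic (has no poles) on $\mathbb{R}\setminus\{0,1\}$. In other words, every unitary solution of PVI$(\frac98,-\frac18,\frac18,\frac38)$ has no poles in $\mathbb{R}\setminus\{0,1\}$.
   Context: PVI$(\alpha,\beta,\gamma,\delta)$ is the Painlevé VI equation $\lambda''=\frac12\big(\frac1\lambda+\frac1{\lambda-1}+\frac1{\lambda-t}\big)(\lambda')^2-\big(\frac1t+\frac1{t-1}+\frac1{\lambda-t}\big)\lambda'+\frac{\lambda(\lambda-1)(\lambda-t)}{t^2(t-1)^2}\big[\alpha+\beta\frac{t}{\lambda^2}+\gamma\frac{t-1}{(\lambda-1)^2}+\delta\frac{t(t-1)}{(\lambda-t)^2}\big]$; its solutions are multivalued meromorphic functions on $\mathbb{C}\setminus\{0,1\}$. Notation: $\mathbb{H}$ is the upper half plane; for $\tau\in\mathbb{H}$, $\Lambda_\tau=\mathbb{Z}+\mathbb{Z}\tau$, $\wp(z|\tau)$ is the Weierstrass $\wp$-function with periods $1,\tau$, $\zeta(z|\tau)$ the Weierstrass zeta function ($\zeta'=-\wp$), with quasi-periods $\eta_1(\tau),\eta_2(\tau)$ defined by $\zeta(z+1)=\zeta(z)+\eta_1$,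 $\zeta(z+\tau)=\zeta(z)+\eta_2$; $e_1=\wp(\frac12|\tau)$, $e_2=\wp(\frac\tau2|\tau)$, $e_3=\wp(\frac{1+\tau}2|\tau)$; $g_2,g_3$ are defined by $\wp'^2=4\wp^3-g_2\wp-g_3$. Set $t(\tau)=\frac{e_3(\tau)-e_1(\tau)}{e_2(\tau)-e_1(\tau)}$. For $(r,s)\in\mathbb{C}^2\setminus\frac12\mathbb{Z}^2$, put $\alpha=\alpha(\tau)=r+s\tau$, $Z_{r,s}(\tau)=\zeta(r+s\tau|\tau)-r\eta_1(\tau)-s\eta_2(\tau)$, and define the meromorphic function $\wp(p_{r,s}(\tau)|\tau)$ on $\mathbb{H}$ by $\wp(p_{r,s}(\tau)|\tau)=\wp(\alpha)+\frac{3\wp'(\alpha)Z_{r,s}^2+(12\wp(\alpha)^2-g_2)Z_{r,s}+3\wp(\alpha)\wp'(\alpha)}{2(Z_{r,s}^3-3\wp(\alpha)Z_{r,s}-\wp'(\alpha))}$ (all $\wp$'s with period lattice $\Lambda_\tau$). The function $\lambda_{r,s}$ defined by $\lambda_{r,s}(t(\tau))=\frac{\wp(p_{r,s}(\tau)|\tau)-e_1(\tau)}{e_2(\tau)-e_1(\tau)}$ is a (multivalued) solution of PVI$(\frac98,-\frac18,\frac18,\frac38)$; its poles in $\mathbb{C}\setminus\{0,1\}$ are the values $t(\tau_0)$ at $\tau_0$ where $\wp(p_{r,s}(\tau_0)|\tau_0)=\infty$. It is known (from the literature) that the solutions of PVI$(\frac98,-\frac18,\frac18,\frac38)$ whose associated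 generalized Lamé equation has monodromy group conjugate into $SU(2)$ (''unitary solutions'') are exactly the $\lambda_{r,s}$ with $(r,s)\in\mathbb{R}^2\setminus\frac12\mathbb{Z}^2$. *)

(* Defs.v *)
From Stdlib Require Import Reals Lra ZArith List ClassicalEpsilon.
Import ListNotations.
Open Scope R_scope.

Definition Cpx : Type := (R * R)%type.
Definition Cre (z : Cpx) : R := fst z.
Definition Cim (z : Cpx) : R := snd z.
Definition RtoC (x : R) : Cpx := (x, 0).
Definition Czero : Cpx := (0, 0).
Definition Cone : Cpx := (1, 0).
Definition Cadd (z w : Cpx) : Cpx := (fst z + fst w, snd z + snd w).
Definition Copp (z : Cpx) : Cpx := (- fst z, - snd z).
Definition Csub (z w : Cpx) : Cpx := Cadd z (Copp w).
Definition Cmul (z w : Cpx) : Cpx :=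
  (fst z * fst w - snd z * snd w, fst z * snd w + snd z * fst w).
Definition Cinv (z : Cpx) : Cpx :=
  (fst z / (fst z ^ 2 + snd z ^ 2), - snd z / (fst z ^ 2 + snd z ^ 2)).
Definition Cdiv (z w : Cpx) : Cpx := Cmul z (Cinv w).
Definition Cpow (z : Cpx) (n : nat) : Cpx := Nat.iter n (Cmul z) Cone.
Definition Cnorm (z : Cpx) : R := sqrt (fst z ^ 2 + snd z ^ 2).
Definition Cscal (x : R) (z : Cpx) : Cpx := Cmul (RtoC x) z.

Definition Ccv (u : nat -> Cpx) (l : Cpx) : Prop :=
  Un_cv (fun n => fst (u n)) (fst l) /\ Un_cv (fun n => snd (u n)) (snd l).
Definition Clim (u : nat -> Cpx) : Cpx :=
  epsilon (inhabits Czero) (fun l => Ccv u l).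

Definition lat_pt (tau : Cpx) (p : Z * Z) : Cpx :=
  Cadd (RtoC (IZR (fst p))) (Cscal (IZR (snd p)) tau).

Fixpoint Csum_list (l : list Cpx) : Cpx :=
  match l with [] => Czero | x :: t => Cadd x (Csum_list t) end.

Definition zrange (N : nat) : list Z :=
  map (fun k => (Z.of_nat k - Z.of_nat N)%Z) (seq 0 (2 * N + 1)).

Definition lat_psum (tau : Cpx) (f : Cpx -> Cpx) (N : nat) : Cpx :=
  Csum_list (map (fun p => if (Z.eqb (fst p) 0 && Z.eqb (snd p) 0)%bool
                           then Czero else f (lat_pt tau p))
                 (list_prod (zrange N) (zrange N))).

(* sum over Lambda_tau \ {0} (all series used below converge absolutely) *)
Definition lat_sum (tau : Cpx) (f : Cpx -> Cpx) : Cpx := Clim (lat_psum tau f).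

Definition wp (z tau : Cpx) : Cpx :=
  Cadd (Cinv (Cpow z 2))
       (lat_sum tau (fun w => Csub (Cinv (Cpow (Csub z w) 2)) (Cinv (Cpow w 2)))).

Definition wp' (z tau : Cpx) : Cpx :=
  Cscal (-2) (Cadd (Cinv (Cpow z 3))
                   (lat_sum tau (fun w => Cinv (Cpow (Csub z w) 3)))).

Definition wzeta (z tau : Cpx) : Cpx :=
  Cadd (Cinv z)
       (lat_sum tau (fun w => Cadd (Cadd (Cinv (Csub z w)) (Cinv w))
                                   (Cdiv z (Cpow w 2)))).

Definition g2 (tau : Cpx) : Cpx := Cscal 60 (lat_sum tau (fun w => Cinv (Cpow w 4))).
Definition g3 (tau : Cpx) : Cpx := Cscal 140 (lat_sum tau (fun w => Cinv (Cpow w 6))).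

(* quasi-periods: zeta(z+1)=zeta(z)+eta1, zeta(z+tau)=zeta(z)+eta2;
   since zeta is odd, eta1 = 2 zeta(1/2), eta2 = 2 zeta(tau/2). *)
Definition eta1 (tau : Cpx) : Cpx := Cscal 2 (wzeta (RtoC (1/2)) tau).
Definition eta2 (tau : Cpx) : Cpx := Cscal 2 (wzeta (Cscal (1/2) tau) tau).

Definition e1 (tau : Cpx) : Cpx := wp (RtoC (1/2)) tau.
Definition e2 (tau : Cpx) : Cpx := wp (Cscal (1/2) tau) tau.
Definition e3 (tau : Cpx) : Cpx := wp (Cscal (1/2) (Cadd Cone tau)) tau.

Definition t_of (tau : Cpx) : Cpx :=
  Cdiv (Csub (e3 tau) (e1 tau)) (Csub (e2 tau) (e1 tau)).

Definition alpha_rs (r s : R) (tau : Cpx) : Cpx := Cadd (RtoC r) (Cscal s tau).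

Definition Z_rs (r s : R) (tau : Cpx) : Cpx :=
  Csub (Csub (wzeta (alpha_rs r s tau) tau) (Cscal r (eta1 tau)))
       (Cscal s (eta2 tau)).

Definition num_rs (r s : R) (tau : Cpx) : Cpx :=
  let a := alpha_rs r s tau in
  let P := wp a tau in let P' := wp' a tau in let Z := Z_rs r s tau in
  Cadd (Cadd (Cscal 3 (Cmul P' (Cpow Z 2)))
             (Cmul (Csub (Cscal 12 (Cpow P 2)) (g2 tau)) Z))
       (Cscal 3 (Cmul P P')).

Definition den_rs (r s : R) (tau : Cpx) : Cpx :=
  let a := alpha_rs r s tau in
  let P := wp a tau in let P' := wp' a tau in let Z := Z_rs r s tau in
  Cscal 2 (Csub (Csub (Cpow Z 3) (Cscal 3 (Cmul P Z))) P').

Definition wp_p (r s : R) (tau : Cpx) : Cpx :=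
  Cadd (wp (alpha_rs r s tau) tau) (Cdiv (num_rs r s tau) (den_rs r s tau)).

(* The meromorphic function tau |-> wp_p r s tau (on the upper half plane)
   is finite at tau0: it has a finite limit at tau0 (taken over the points
   of H near tau0 where its defining formula makes sense). *)
Definition wp_p_finite_at (r s : R) (tau0 : Cpx) : Prop :=
  exists L : Cpx, forall eps : R, eps > 0 ->
    exists delta : R, delta > 0 /\
      forall tau : Cpx, Cim tau > 0 -> tau <> tau0 ->
        Cnorm (Csub tau tau0) < delta -> den_rs r s tau <> Czero ->
        Cnorm (Csub (wp_p r s tau) L) < eps.

(* Main.v *)
(** The denominator of the formula for [wp(p_{r,s})] is [2 * E3] with
    [E3 = Z^3 - 3 wp(alpha) Z - wp'(alpha)], so it suffices that [E3] does not vanish at [tau0]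
    (continuity in [tau] then gives finiteness).

    A real [t(tau0)] means that the half-period values [e1, e2, e3] lie on a real line [R c]. Comparing
    [conj wp(z)] with [mu^2 wp(mu conj z)], [mu = conj c / |c|], through the differential equation
    [wp'' = 6 wp^2 - g2 / 2], one finds that the lattice is stable under [z |-> mu conj z] and that this
    reflection fixes all half periods, hence that the lattice has an orthogonal basis.

    For an orthogonal basis [w1, w2] with [w2 / w1 = i b], [q = exp(-2 pi b)], the function [E3] is a
    constant multiple of the suitably regularised sum [sum_k (k + s)^2 g(z + k i b)], up to an
    additive real constant, where [g = e^(2 pi i z) / (1 - e^(2 pi i z))]. (Write [E3] as a cubic
    polynomial in [s] with coefficients functions of [z] and identify the coefficients one by one with
    Liouville's theorem.)
    The imaginary part of this series is [sin (2 pi r)] times a positive number. So [E3 = 0]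
    forces [2 r] to be an integer and, exchanging the two basis vectors, also [2 s]. *)

Require Import Defs.
From Stdlib Require Import Reals ZArith.
From Stdlib Require Import Lra Lia List Psatz Classical ClassicalEpsilon FunctionalExtensionality.
From Coquelicot Require Import Coquelicot.
Import ListNotations.
Open Scope R_scope.

(** * Families of functions with uniform quadratic remainders *)

(** One calculus carries all the analysis: derivatives with a quadratic remainder, uniform over an
    index set. Such bounds survive products, inverses and summation, so the same lemmas serve the
    series over [nat], the lattice sums in [z], and the lattice sums in [tau]. Poles are handled by
    explicit splittings into a principal part and a series regular at 0; their cancellation is then
    a [field] identity, and Liouville's theorem comes from a real energy integral. Matching the
    coefficients of the cubic in [s] also produces Legendre's relation, as the only quasi-period
    compatible with the series. The comparison of [wp] with its mirror image starts at a double
    pole, where the differential equation is singular. Uniqueness there requires agreement through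
    order t^4, which is what the conjugation rules for g2 and g3 give; the equality is then
    continued along a segment until it reaches a pole, and this is how lattice points are detected.
    Fixing the half periods separates rectangular from rhombic lattices: it makes half of (identity
    + reflection) an integral projection, whose image and kernel supply the orthogonal basis. *)

Lemma Cmod_triangle3 (a b c : C) : Cmod (a + b + c) <= Cmod a + Cmod b + Cmod c.
Proof.
  eapply Rle_trans; [apply Cmod_triangle|].
  pose proof (Cmod_triangle a b); lra.
Qed.

Lemma Cmod_rev_triangle (a b : C) : Cmod a - Cmod b <= Cmod (a + b).
Proof.
  pose proof (Cmod_triangle (a + b) (- b)) as H.
  rewrite Cmod_opp in H.
  replace (a + b + - b)%C with a in H by ring; lra.
Qed.

Lemma Rabs_fst_le (z : C) : Rabs (fst z) <= Cmod z.
Proof. eapply Rle_trans; [apply Rmax_l|apply Rmax_Cmod]. Qed.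

Lemma Rabs_snd_le (z : C) : Rabs (snd z) <= Cmod z.
Proof. eapply Rle_trans; [apply Rmax_r|apply Rmax_Cmod]. Qed.

Lemma Cmod_le_parts (z : C) : Cmod z <= Rabs (fst z) + Rabs (snd z).
Proof.
  replace z with (RtoC (fst z) + RtoC (snd z) * Ci)%C at 1
    by (destruct z; apply injective_projections; simpl; ring).
  eapply Rle_trans; [apply Cmod_triangle|].
  rewrite Cmod_mult, !Cmod_R, Cmod_Ci; lra.
Qed.

Section Families.

Context {I : Type} (wt : I -> R).
Hypothesis wt01 : forall p, 0 <= wt p <= 1.

(** Decay of order [wt^k] in the index. With the weights used later, exponent 3 is what guarantees
    summability over the lattice. *)
Definition fbound (k : nat) (F : I -> C) : Prop :=
  exists M, 0 <= M /\ forall p, Cmod (F p) <= M * wt p ^ k.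

(** The remainder is O(h^2) rather than o(h), with a constant that is uniform in the index and
    carries the same weight: this is the form that can be summed term by term. *)
Definition fder (k : nat) (F : I -> C -> C) (z : C) (G : I -> C) : Prop :=
  exists d M, 0 < d /\ 0 <= M /\ forall h, Cmod h < d -> forall p,
    Cmod (F p (z + h)%C - F p z - h * G p)%C <= M * Cmod h ^ 2 * wt p ^ k.

(** Differentiability to order [n] of a whole family at once. Bounds are uniform in the index but
    only pointwise in [z]; the derivative families are existential witnesses with the same weight
    exponent. *)
Fixpoint FD (D : C -> Prop) (k n : nat) (F : I -> C -> C) : Prop :=
  (forall z, D z -> fbound k (fun p => F p z)) /\
  match n with
  | O => True
  | S n' => exists G, (forall z, D z -> fder k F z (fun p => G p z)) /\ FD D k n' G
  end.

Lemma wt_pow_ge0 p k : 0 <= wt p ^ k.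
Proof. apply pow_le, wt01. Qed.

Lemma wt_pow_le p k k' : (k' <= k)%nat -> wt p ^ k <= wt p ^ k'.
Proof.
  intros H; replace k with (k' + (k - k'))%nat by lia.
  rewrite pow_add.
  pose proof (wt_pow_ge0 p k').
  assert (wt p ^ (k - k') <= 1).
  { rewrite <- (pow1 (k - k')); apply pow_incr, wt01. }
  nra.
Qed.

Lemma FD_bound D k n F z : FD D k n F -> D z -> fbound k (fun p => F p z).
Proof. destruct n; intros [H _]; auto. Qed.

Lemma fbound_weaken k k' F : (k' <= k)%nat -> fbound k F -> fbound k' F.
Proof.
  intros H [M [M0 HM]]; exists M; split; auto; intros p.
  eapply Rle_trans; [apply HM|]; apply Rmult_le_compat_l; auto using wt_pow_le.
Qed.

Lemma fder_weaken k k' F z G : (k' <= k)%nat -> fder k F z G -> fder k' F z G.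
Proof.
  intros H (d & M & d0 & M0 & HM); exists d, M; repeat split; auto; intros h Hh p.
  eapply Rle_trans; [apply HM; auto|]; apply Rmult_le_compat_l; auto using wt_pow_le.
  apply Rmult_le_pos; auto; apply pow2_ge_0.
Qed.

Lemma FD_weaken D k k' n F : (k' <= k)%nat -> FD D k n F -> FD D k' n F.
Proof.
  intros Hk; revert F; induction n; intros F [H1 H2]; split; auto.
  - intros; eapply fbound_weaken; eauto.
  - intros; eapply fbound_weaken; eauto.
  - destruct H2 as [G [H2 H3]]; exists G; split; auto.
    intros; eapply fder_weaken; eauto.
Qed.

Lemma FD_pred D k n F : FD D k (S n) F -> FD D k n F.
Proof.
  revert F; induction n; intros F [H1 H2]; split; auto.
  destruct H2 as [G [H2 H3]]; exists G; split; auto.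
Qed.

Lemma FD_sub (D D' : C -> Prop) k n F :
  (forall z, D' z -> D z) -> FD D k n F -> FD D' k n F.
Proof.
  intros HD; revert F; induction n; intros F [H1 H2]; split; auto.
  destruct H2 as [G [H2 H3]]; exists G; split; auto.
Qed.

Lemma fbound_add k F G : fbound k F -> fbound k G -> fbound k (fun p => F p + G p)%C.
Proof.
  intros [M [M0 HM]] [N [N0 HN]]; exists (M + N); split; [lra|]; intros p.
  eapply Rle_trans; [apply Cmod_triangle|]; specialize (HM p); specialize (HN p); lra.
Qed.

Lemma fbound_mul k l F G :
  fbound k F -> fbound l G -> fbound (k + l) (fun p => F p * G p)%C.
Proof.
  intros [M [M0 HM]] [N [N0 HN]]; exists (M * N); split; [nra|]; intros p.
  rewrite Cmod_mult, pow_add.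
  replace (M * N * (wt p ^ k * wt p ^ l)) with ((M * wt p ^ k) * (N * wt p ^ l)) by ring.
  apply Rmult_le_compat; auto using Cmod_ge_0.
Qed.

Lemma fder_add k F G z F' G' :
  fder k F z F' -> fder k G z G' ->
  fder k (fun p z => F p z + G p z)%C z (fun p => F' p + G' p)%C.
Proof.
  intros (d & M & d0 & M0 & HM) (e & N & e0 & N0 & HN).
  exists (Rmin d e), (M + N); repeat split; [now apply Rmin_pos|lra|]; intros h Hh p.
  replace (F p (z + h) + G p (z + h) - (F p z + G p z) - h * (F' p + G' p))%C
    with ((F p (z + h) - F p z - h * F' p) + (G p (z + h) - G p z - h * G' p))%C by ring.
  eapply Rle_trans; [apply Cmod_triangle|].
  assert (Cmod h < d) by (eapply Rlt_le_trans; [apply Hh|apply Rmin_l]).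
  assert (Cmod h < e) by (eapply Rlt_le_trans; [apply Hh|apply Rmin_r]).
  specialize (HM h H p); specialize (HN h H0 p); lra.
Qed.

Lemma fder_mul k l F G z F' G' :
  fbound k (fun p => F p z) -> fbound l (fun p => G p z) ->
  fbound k F' -> fbound l G' ->
  fder k F z F' -> fder l G z G' ->
  fder (k + l) (fun p z => F p z * G p z)%C z (fun p => F' p * G p z + F p z * G' p)%C.
Proof.
  intros [A [A0 HA]] [B [B0 HB]] [A' [A'0 HA']] [B' [B'0 HB']]
    (d & M & d0 & M0 & HM) (e & N & e0 & N0 & HN).
  exists (Rmin 1 (Rmin d e)), (A' * B' + M * (B + B' + N) + (A + A') * N).
  split; [apply Rmin_pos; [lra|now apply Rmin_pos]|].
  split.
  { pose proof (Rmult_le_pos A' B'); pose proof (Rmult_le_pos M (B + B' + N));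
    pose proof (Rmult_le_pos (A + A') N); lra. }
  intros h Hh p.
  assert (h1 : Cmod h < 1) by (eapply Rlt_le_trans; [apply Hh|apply Rmin_l]).
  assert (Hm : Cmod h < Rmin d e) by (eapply Rlt_le_trans; [apply Hh|apply Rmin_r]).
  assert (hd : Cmod h < d) by (eapply Rlt_le_trans; [apply Hm|apply Rmin_l]).
  assert (he : Cmod h < e) by (eapply Rlt_le_trans; [apply Hm|apply Rmin_r]).
  specialize (HM h hd p); specialize (HN h he p).
  specialize (HA p); specialize (HB p); specialize (HA' p); specialize (HB' p).
  simpl in HA, HB.
  set (r1 := (F p (z + h) - F p z - h * F' p)%C) in *.
  set (r2 := (G p (z + h) - G p z - h * G' p)%C) in *.
  (* The increment is split into the cross term of order h^2, the remainder of [F] times [G] at the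
     shifted point, and the linearised [F] times the remainder of [G]; [E1], [E2], [E3] bound these
     three pieces. *)
  replace (F p (z + h) * G p (z + h) - F p z * G p z - h * (F' p * G p z + F p z * G' p))%C
    with (h * h * (F' p * G' p) + r1 * (G p z + h * G' p + r2) + (F p z + h * F' p) * r2)%C
    by (unfold r1, r2; ring).
  pose proof (wt_pow_ge0 p k) as wk; pose proof (wt_pow_ge0 p l) as wl.
  pose proof (Cmod_ge_0 h) as h0.
  assert (hh : 0 <= Cmod h ^ 2 <= 1) by (split; [apply pow2_ge_0|nra]).
  set (u := wt p ^ k) in *; set (v := wt p ^ l) in *; set (t := Cmod h ^ 2) in *.
  assert (E1 : Cmod (h * h * (F' p * G' p))%C <= t * (A' * u) * (B' * v)).
  { rewrite !Cmod_mult. unfold t.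
    replace (Cmod h * Cmod h * (Cmod (F' p) * Cmod (G' p)))
      with (Cmod h ^ 2 * (Cmod (F' p) * Cmod (G' p))) by ring.
    rewrite Rmult_assoc; apply Rmult_le_compat_l; [apply pow2_ge_0|].
    apply Rmult_le_compat; auto using Cmod_ge_0. }
  assert (E2 : Cmod (r1 * (G p z + h * G' p + r2))%C <= (M * t * u) * ((B + B' + N) * v)).
  { rewrite Cmod_mult; apply Rmult_le_compat; auto using Cmod_ge_0.
    eapply Rle_trans; [apply Cmod_triangle3|].
    rewrite Cmod_mult.
    assert (Cmod h * Cmod (G' p) <= B' * v).
    { pose proof (Cmod_ge_0 (G' p)); nra. }
    assert (N * t * v <= N * v) by (pose proof (Rmult_le_pos N v N0 wl); nra).
    lra. }
  assert (E3 : Cmod ((F p z + h * F' p) * r2)%C <= ((A + A') * u) * (N * t * v)).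
  { rewrite Cmod_mult; apply Rmult_le_compat; auto using Cmod_ge_0.
    eapply Rle_trans; [apply Cmod_triangle|].
    rewrite Cmod_mult.
    assert (Cmod h * Cmod (F' p) <= A' * u).
    { pose proof (Cmod_ge_0 (F' p)); nra. }
    lra. }
  eapply Rle_trans; [apply Cmod_triangle3|].
  rewrite pow_add; fold u v.
  replace ((A' * B' + M * (B + B' + N) + (A + A') * N) * t * (u * v))
    with (t * (A' * u) * (B' * v) + (M * t * u) * ((B + B' + N) * v)
          + ((A + A') * u) * (N * t * v)) by ring.
  lra.
Qed.

Lemma FD_add D k n F G : FD D k n F -> FD D k n G -> FD D k n (fun p z => F p z + G p z)%C.
Proof.
  revert F G; induction n; intros F G [H1 H2] [H3 H4]; split; auto.
  - intros; apply fbound_add; auto.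
  - intros; apply fbound_add; auto.
  - destruct H2 as [F' [H2 H2']], H4 as [G' [H4 H4']].
    exists (fun p z => F' p z + G' p z)%C; split; auto.
    intros; apply fder_add; auto.
Qed.

Lemma FD_mul D k l n F G :
  FD D k n F -> FD D l n G -> FD D (k + l) n (fun p z => F p z * G p z)%C.
Proof.
  revert F G; induction n; intros F G HF HG.
  - destruct HF as [H1 H2], HG as [H3 H4]; split; auto.
    intros; apply (fbound_mul k l (fun p => F p z) (fun p => G p z)); auto.
  - pose proof HF as [H1 [F' [H2 H2']]]; pose proof HG as [H3 [G' [H4 H4']]]; split.
    + intros; apply (fbound_mul k l (fun p => F p z) (fun p => G p z)); auto.
    + exists (fun p z => F' p z * G p z + F p z * G' p z)%C; split.
      * intros z Hz.
        apply (fder_mul k l F G z (fun p => F' p z) (fun p => G' p z)); auto;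
          eapply FD_bound; eauto.
      * apply FD_add; apply IHn; auto; apply FD_pred; auto.
Qed.

Lemma fder_0 k F z : (forall p y, F p y = F p z) -> fder k F z (fun _ => 0%C).
Proof.
  intros H; exists 1, 0; repeat split; try lra; intros h Hh p.
  rewrite H; replace (F p z - F p z - h * 0)%C with (RtoC 0) by ring.
  rewrite Cmod_0; lra.
Qed.

Lemma FD_const D k n c : fbound k c -> FD D k n (fun p _ => c p).
Proof.
  revert c; induction n; intros c Hc; split; auto.
  exists (fun _ _ => 0%C); split.
  - intros; apply (fder_0 k (fun p _ => c p)); auto.
  - apply IHn; exists 0; split; [lra|]; intros; rewrite Cmod_0; lra.
Qed.

Lemma fbound_0 c M : (forall p, Cmod (c p) <= M) -> fbound 0 c.
Proof.
  intros H; exists (Rmax M 0); split; [apply Rmax_r|]; intros p; simpl; rewrite Rmult_1_r.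
  eapply Rle_trans; [apply H|apply Rmax_l].
Qed.

Lemma FD_scalar D n (c : C) : FD D 0 n (fun _ _ => c).
Proof. apply FD_const with (c := fun _ => c), fbound_0 with (Cmod c); intros; lra. Qed.

Lemma FD_id D n : FD D 0 n (fun _ z => z).
Proof.
  destruct n; split; auto.
  1,2: intros z _; apply fbound_0 with (Cmod z); intros; lra.
  exists (fun _ _ => 1%C); split; [|apply FD_scalar].
  intros z _; exists 1, 0; repeat split; try lra; intros h Hh p.
  replace (z + h - z - h * 1)%C with (RtoC 0) by ring; rewrite Cmod_0; lra.
Qed.

Lemma FD_ext (D : C -> Prop) k n F G :
  (forall z, D z -> exists d, 0 < d /\ forall h, Cmod h < d -> D (z + h)%C) ->
  (forall p z, D z -> F p z = G p z) -> FD D k n F -> FD D k n G.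
Proof.
  intros Dopen E; destruct n; intros [H1 H2]; split; auto.
  1,2: intros z Hz; destruct (H1 z Hz) as [M [M0 HM]]; exists M; split; auto;
       intros; rewrite <- E; auto.
  destruct H2 as [F' [H2 H3]]; exists F'; split; auto.
  intros z Hz; destruct (H2 z Hz) as (d & M & d0 & M0 & HM).
  destruct (Dopen z Hz) as (e & e0 & He).
  exists (Rmin d e), M; repeat split; auto; [now apply Rmin_pos|]; intros h Hh p.
  assert (Cmod h < d) by (eapply Rlt_le_trans; [apply Hh|apply Rmin_l]).
  assert (Cmod h < e) by (eapply Rlt_le_trans; [apply Hh|apply Rmin_r]).
  rewrite <- !E; auto.
Qed.

Lemma FD_scal D k n c F : FD D k n F -> FD D k n (fun p z => c * F p z)%C.
Proof. apply (FD_mul D 0 k n (fun _ _ => c) F), FD_scalar. Qed.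

Lemma FD_opp D k n F : FD D k n F -> FD D k n (fun p z => - F p z)%C.
Proof.
  intros H; replace (fun p z => - F p z)%C with (fun p z => RtoC (-1) * F p z)%C.
  - apply FD_scal; auto.
  - do 2 (apply functional_extensionality; intros); ring.
Qed.

Lemma FD_minus D k n F G : FD D k n F -> FD D k n G -> FD D k n (fun p z => F p z - G p z)%C.
Proof. intros; apply FD_add, FD_opp; auto. Qed.

Lemma fder_inv F z F' c :
  0 < c -> (forall p, c <= Cmod (F p z)) -> fbound 0 (fun p => F p z) -> fbound 0 F' ->
  fder 0 F z F' -> fder 0 (fun p z => / F p z)%C z (fun p => - (F' p * (/ F p z * / F p z)))%C.
Proof.
  intros c0 Hc [A [A0 HA]] [A' [A'0 HA']] (d & M & d0 & M0 & HM).
  (* For |h| < 1 the increment of [F] is at most [K] |h|, so |h| < c / (2K) keeps the values of [F]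
     at distance at least c / 2 from 0. *)
  set (K := A' + M + 1).
  assert (K0 : 0 < K) by (unfold K; lra).
  exists (Rmin d (Rmin 1 (c / (2 * K)))), ((A * M + A' * A' + A' * M) * (/ c * / c * (2 * / c))).
  split; [repeat apply Rmin_pos; try lra; apply Rdiv_lt_0_compat; lra|].
  assert (ic : 0 < / c) by (now apply Rinv_0_lt_compat).
  split.
  { repeat apply Rmult_le_pos; try lra.
    pose proof (Rmult_le_pos A M); pose proof (Rmult_le_pos A' A'); pose proof (Rmult_le_pos A' M); lra. }
  intros h Hh p.
  assert (hd : Cmod h < d) by (eapply Rlt_le_trans; [apply Hh|apply Rmin_l]).
  assert (Hm : Cmod h < Rmin 1 (c / (2 * K))) by (eapply Rlt_le_trans; [apply Hh|apply Rmin_r]).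
  assert (h1 : Cmod h < 1) by (eapply Rlt_le_trans; [apply Hm|apply Rmin_l]).
  assert (hc : Cmod h < c / (2 * K)) by (eapply Rlt_le_trans; [apply Hm|apply Rmin_r]).
  specialize (HM h hd p); specialize (HA p); specialize (HA' p); specialize (Hc p).
  simpl in HA, HA', HM; rewrite Rmult_1_r in HA, HA', HM.
  set (e := (F p (z + h) - F p z - h * F' p)%C) in *.
  pose proof (Cmod_ge_0 h) as h0.
  assert (he : Cmod e <= M * Cmod h ^ 2) by (eapply Rle_trans; [apply HM|]; apply Req_le; ring).
  assert (hh : Cmod h ^ 2 <= Cmod h) by nra.
  assert (he' : Cmod e <= M * Cmod h) by nra.
  assert (hK : K * Cmod h < c / 2).
  { apply Rmult_lt_compat_l with (r := K) in hc; auto.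
    replace (K * (c / (2 * K))) with (c / 2) in hc by (field; lra); auto. }
  assert (hY : c / 2 <= Cmod (F p (z + h)%C)).
  { replace (F p (z + h)%C) with (F p z + (h * F' p + e))%C by (unfold e; ring).
    eapply Rle_trans; [|apply Cmod_rev_triangle].
    assert (Cmod (h * F' p + e) <= K * Cmod h).
    { eapply Rle_trans; [apply Cmod_triangle|]; rewrite Cmod_mult.
      pose proof (Cmod_ge_0 (F' p)); unfold K; nra. }
    lra. }
  assert (X0 : F p z <> 0%C).
  { intros E; rewrite E, Cmod_0 in Hc; lra. }
  assert (Y0 : F p (z + h)%C <> 0%C).
  { intros E; rewrite E, Cmod_0 in hY; lra. }
  replace (/ F p (z + h) - / F p z - h * - (F' p * (/ F p z * / F p z)))%C
    with ((- (F p z * e) + h * h * (F' p * F' p) + h * (F' p * e))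
          * (/ F p z * / F p z * / F p (z + h)))%C.
  2:{ replace e with (F p (z + h) - F p z - h * F' p)%C by auto. field; auto. }
  rewrite Cmod_mult.
  replace ((A * M + A' * A' + A' * M) * (/ c * / c * (2 * / c)) * Cmod h ^ 2 * wt p ^ 0)
    with (((A * M + A' * A' + A' * M) * Cmod h ^ 2) * (/ c * / c * (2 * / c))) by (simpl; ring).
  apply Rmult_le_compat; auto using Cmod_ge_0.
  - eapply Rle_trans; [apply Cmod_triangle3|].
    rewrite Cmod_opp, !Cmod_mult.
    pose proof (Cmod_ge_0 (F p z)); pose proof (Cmod_ge_0 (F' p)); pose proof (Cmod_ge_0 e).
    assert (Cmod (F p z) * Cmod e <= A * (M * Cmod h ^ 2)) by (apply Rmult_le_compat; auto).
    assert (Cmod (F' p) * Cmod (F' p) <= A' * A') by (apply Rmult_le_compat; auto).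
    assert (Cmod (F' p) * Cmod e <= A' * (M * Cmod h)) by (apply Rmult_le_compat; auto).
    assert (Cmod h * (Cmod (F' p) * Cmod e) <= Cmod h * (A' * (M * Cmod h)))
      by (apply Rmult_le_compat_l; auto).
    assert (Cmod h * Cmod h * (Cmod (F' p) * Cmod (F' p)) <= Cmod h * Cmod h * (A' * A'))
      by (apply Rmult_le_compat_l; nra).
    lra.
  - rewrite !Cmod_mult, !Cmod_inv; auto.
    assert (/ Cmod (F p z) <= / c) by (apply Rinv_le_contravar; auto).
    assert (/ Cmod (F p (z + h)%C) <= 2 * / c).
    { replace (2 * / c) with (/ (c / 2)) by (field; lra).
      apply Rinv_le_contravar; auto; lra. }
    assert (0 < / Cmod (F p z)) by (apply Rinv_0_lt_compat; lra).
    assert (0 < / Cmod (F p (z + h)%C)) by (apply Rinv_0_lt_compat; lra).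
    apply Rmult_le_compat; try lra; [apply Rmult_le_pos; lra|].
    apply Rmult_le_compat; lra.
Qed.

Lemma FD_inv D n F :
  (forall z, D z -> exists c, 0 < c /\ forall p, c <= Cmod (F p z)) ->
  FD D 0 n F -> FD D 0 n (fun p z => / F p z)%C.
Proof.
  intros Hc; revert F Hc; induction n; intros F Hc HF.
  - split; auto; intros z Hz; destruct (Hc z Hz) as [c [c0 H]].
    apply fbound_0 with (/ c); intros p; rewrite Cmod_inv.
    + apply Rinv_le_contravar; auto.
    + intros E; specialize (H p); rewrite E, Cmod_0 in H; lra.
  - pose proof (IHn F Hc (FD_pred _ _ _ _ HF)) as IH.
    destruct HF as [H1 [F' [H2 H3]]]; split.
    + intros z Hz; apply (FD_bound D 0 n (fun p z => / F p z)%C z); auto.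
    + exists (fun p z => - (F' p z * (/ F p z * / F p z)))%C; split.
      * intros z Hz; destruct (Hc z Hz) as [c [c0 H]].
        apply (fder_inv F z (fun p => F' p z) c); auto.
        eapply FD_bound; eauto.
      * apply FD_opp, (FD_mul D 0 0 n F'); auto.
        apply (FD_mul D 0 0 n); auto.
Qed.

Lemma FD_affine (D : C -> Prop) k n (a b : C) F :
  FD D k n F -> FD (fun z => D (a * z + b)%C) k n (fun p z => F p (a * z + b)%C).
Proof.
  revert F; induction n; intros F [H1 H2]; split; auto.
  destruct H2 as [G [H2 H3]].
  exists (fun p z => a * G p (a * z + b))%C; split.
  - intros z Hz; destruct (H2 _ Hz) as (d & M & d0 & M0 & HM).
    pose proof (Cmod_ge_0 a) as a0.
    exists (d / (Cmod a + 1)), (M * Cmod a ^ 2); repeat split.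
    + apply Rdiv_lt_0_compat; lra.
    + apply Rmult_le_pos; auto; apply pow2_ge_0.
    + intros h Hh p.
      assert (Hah : Cmod (a * h) < d).
      { rewrite Cmod_mult.
        apply Rmult_lt_compat_l with (r := Cmod a + 1) in Hh; [|lra].
        replace ((Cmod a + 1) * (d / (Cmod a + 1))) with d in Hh by (field; lra).
        pose proof (Cmod_ge_0 h); lra. }
      specialize (HM _ Hah p).
      replace (a * (z + h) + b)%C with (a * z + b + a * h)%C by ring.
      replace (h * (a * G p (a * z + b)))%C with (a * h * G p (a * z + b))%C by ring.
      eapply Rle_trans; [apply HM|]; rewrite Cmod_mult; apply Req_le; ring.
  - apply FD_scal, IHn; auto.
Qed.

End Families.

(** * Complex derivatives *)

(** The case of a single function. On an open set this is ordinary holomorphy, stated with the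
    second-order remainder that series require. *)
Definition cder (f : C -> C) (z l : C) : Prop :=
  exists d M, 0 < d /\ 0 <= M /\ forall h, Cmod h < d ->
    Cmod (f (z + h)%C - f z - h * l)%C <= M * Cmod h ^ 2.

(** A one-element index set of weight 1 turns a single function into a family, so that [Diff]
    inherits its rules from [FD]. *)
Definition unit_wt (_ : unit) : R := 1.

Definition Diff (D : C -> Prop) (n : nat) (f : C -> C) : Prop :=
  FD unit_wt D 0 n (fun _ => f).

Definition Copen (D : C -> Prop) : Prop :=
  forall z, D z -> exists d, 0 < d /\ forall h, Cmod h < d -> D (z + h)%C.

Lemma unit_wt01 p : 0 <= unit_wt p <= 1.
Proof. unfold unit_wt; lra. Qed.

Lemma fder_cder {I} (wt : I -> R) k F z G p :
  (forall p, 0 <= wt p <= 1) -> fder wt k F z G -> cder (F p) z (G p).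
Proof.
  intros H (d & M & d0 & M0 & HM); exists d, (M * wt p ^ k); repeat split; auto.
  - apply Rmult_le_pos; auto; apply pow_le, H.
  - intros h Hh; eapply Rle_trans; [apply HM; auto|]; apply Req_le; ring.
Qed.

Lemma cder_fder f z l k : cder f z l <-> fder unit_wt k (fun _ => f) z (fun _ => l).
Proof.
  split.
  - intros (d & M & d0 & M0 & HM); exists d, M; repeat split; auto.
    intros h Hh p; unfold unit_wt; rewrite pow1, Rmult_1_r; auto.
  - intros H; apply (fder_cder unit_wt k (fun _ => f) z (fun _ => l) tt); auto using unit_wt01.
Qed.

Lemma fbound_unit k (c : C) : fbound unit_wt k (fun _ => c).
Proof.
  exists (Cmod c); split; [apply Cmod_ge_0|]; intros; unfold unit_wt; rewrite pow1; lra.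
Qed.

Lemma cder_add f g z l m : cder f z l -> cder g z m -> cder (fun z => f z + g z)%C z (l + m)%C.
Proof.
  intros H1 H2; apply (cder_fder _ _ _ 0) in H1; apply (cder_fder _ _ _ 0) in H2.
  apply (cder_fder _ _ _ 0), (fder_add unit_wt 0 (fun _ => f) (fun _ => g)); auto.
Qed.

Lemma cder_mul f g z l m :
  cder f z l -> cder g z m -> cder (fun z => f z * g z)%C z (l * g z + f z * m)%C.
Proof.
  intros H1 H2; apply (cder_fder _ _ _ 0) in H1; apply (cder_fder _ _ _ 0) in H2.
  apply (cder_fder _ _ _ 0).
  apply (fder_mul unit_wt unit_wt01 0 0 (fun _ => f) (fun _ => g) z (fun _ => l) (fun _ => m));
    auto; apply (fbound_unit 0).
Qed.

Lemma cder_inv (f : C -> C) z l : f z <> 0%C -> cder f z l -> cder (fun z => / f z)%C z (- (l * (/ f z * / f z)))%C.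
Proof.
  intros H0 H1; apply (cder_fder _ _ _ 0) in H1; apply (cder_fder _ _ _ 0).
  apply (fder_inv unit_wt (fun _ => f) z (fun _ => l) (Cmod (f z))); auto.
  - now apply Cmod_gt_0.
  - intros; lra.
  - apply (fbound_unit 0).
  - apply (fbound_unit 0).
Qed.

Lemma cder_const c z : cder (fun _ => c) z 0%C.
Proof.
  exists 1, 0; repeat split; try lra; intros.
  replace (c - c - h * 0)%C with (RtoC 0) by ring; rewrite Cmod_0; lra.
Qed.

Lemma cder_id z : cder (fun z => z) z 1%C.
Proof.
  exists 1, 0; repeat split; try lra; intros.
  replace (z + h - z - h * 1)%C with (RtoC 0) by ring; rewrite Cmod_0; lra.
Qed.

Lemma cder_eq f z l l' : l = l' -> cder f z l -> cder f z l'.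
Proof. intros ->; auto. Qed.

Lemma cder_scal c f z l : cder f z l -> cder (fun z => c * f z)%C z (c * l)%C.
Proof.
  intros H; eapply cder_eq; [|apply cder_mul; [apply (cder_const c)|apply H]]; simpl; ring.
Qed.

Lemma cder_opp f z l : cder f z l -> cder (fun z => - f z)%C z (- l)%C.
Proof.
  intros (d & M & d0 & M0 & HM); exists d, M; repeat split; auto; intros h Hh.
  replace (- f (z + h)%C - - f z - h * - l)%C with (- (f (z + h)%C - f z - h * l))%C by ring.
  rewrite Cmod_opp; auto.
Qed.

Lemma cder_minus f g z l m : cder f z l -> cder g z m -> cder (fun z => f z - g z)%C z (l - m)%C.
Proof. intros; apply cder_add; auto using cder_opp. Qed.

Lemma cder_affine a b f z l :
  cder f (a * z + b)%C l -> cder (fun z => f (a * z + b)%C) z (a * l)%C.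
Proof.
  intros (d & M & d0 & M0 & HM).
  pose proof (Cmod_ge_0 a) as a0.
  exists (d / (Cmod a + 1)), (M * Cmod a ^ 2); repeat split.
  - apply Rdiv_lt_0_compat; lra.
  - apply Rmult_le_pos; auto; apply pow2_ge_0.
  - intros h Hh.
    assert (Hah : Cmod (a * h) < d).
    { rewrite Cmod_mult.
      apply Rmult_lt_compat_l with (r := Cmod a + 1) in Hh; [|lra].
      replace ((Cmod a + 1) * (d / (Cmod a + 1))) with d in Hh by (field; lra).
      pose proof (Cmod_ge_0 h); lra. }
    specialize (HM _ Hah).
    replace (a * (z + h) + b)%C with (a * z + b + a * h)%C by ring.
    replace (h * (a * l))%C with (a * h * l)%C by ring.
    eapply Rle_trans; [apply HM|]; rewrite Cmod_mult; apply Req_le; ring.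
Qed.

Lemma cder_ext_loc f g z l d :
  0 < d -> (forall h, Cmod h < d -> f (z + h)%C = g (z + h)%C) -> cder f z l -> cder g z l.
Proof.
  intros d0 E (e & M & e0 & M0 & HM).
  exists (Rmin d e), M; repeat split; auto; [now apply Rmin_pos|]; intros h Hh.
  assert (Cmod h < d) by (eapply Rlt_le_trans; [apply Hh|apply Rmin_l]).
  assert (Cmod h < e) by (eapply Rlt_le_trans; [apply Hh|apply Rmin_r]).
  replace (g z) with (f z).
  - rewrite <- E; auto.
  - replace z with (z + 0)%C by ring; rewrite E; auto; rewrite Cmod_0; auto.
Qed.

Lemma cder_unique f z l m : cder f z l -> cder f z m -> l = m.
Proof.
  intros (d & M & d0 & M0 & HM) (e & N & e0 & N0 & HN).
  destruct (Ceq_dec l m) as [|Hne]; auto; exfalso.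
  assert (Hp : 0 < Cmod (l - m)).
  { apply Cmod_gt_0; intros E; apply Hne.
    replace l with (l - m + m)%C by ring; rewrite E; ring. }
  set (t := Rmin (Rmin d e / 2) (Cmod (l - m) / (2 * (M + N + 1)))).
  assert (t0 : 0 < t).
  { unfold t; repeat apply Rmin_pos; try apply Rdiv_lt_0_compat; try lra.
    now apply Rmin_pos. }
  assert (td : t < d /\ t < e).
  { assert (t <= Rmin d e / 2) by apply Rmin_l.
    assert (0 < Rmin d e) by (now apply Rmin_pos).
    pose proof (Rmin_l d e); pose proof (Rmin_r d e); lra. }
  assert (tm : t * (M + N) < Cmod (l - m)).
  { assert (t <= Cmod (l - m) / (2 * (M + N + 1))) by apply Rmin_r.
    apply Rmult_le_compat_r with (r := M + N + 1) in H; [|lra].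
    replace (Cmod (l - m) / (2 * (M + N + 1)) * (M + N + 1)) with (Cmod (l - m) / 2) in H
      by (field; lra).
    lra. }
  assert (ht : Cmod t = t) by (rewrite Cmod_R, Rabs_pos_eq; lra).
  destruct td as [td te].
  specialize (HM t); specialize (HN t); rewrite ht in HM, HN.
  specialize (HM td); specialize (HN te).
  assert (Cmod (t * (l - m)) <= (M + N) * t ^ 2).
  { replace (t * (l - m))%C with ((f (z + t) - f z - t * m) + - (f (z + t) - f z - t * l))%C by ring.
    eapply Rle_trans; [apply Cmod_triangle|]; rewrite Cmod_opp; lra. }
  rewrite Cmod_mult, ht in H.
  nra.
Qed.

Lemma Diff_S D n f : Diff D (S n) f <-> exists g, (forall z, D z -> cder f z (g z)) /\ Diff D n g.
Proof.
  split.
  - intros [_ [G [H1 H2]]]; exists (G tt); split.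
    + intros z Hz; apply (fder_cder unit_wt 0 (fun _ => f) z (fun p => G p z) tt); auto using unit_wt01.
    + unfold Diff; replace (fun _ : unit => G tt) with G; auto.
      apply functional_extensionality; intros []; auto.
  - intros [g [H1 H2]]; split; [intros; apply (fbound_unit 0)|].
    exists (fun _ => g); split; auto; intros; apply (cder_fder _ _ _ 0); auto.
Qed.

Lemma Diff_0 D f : Diff D 0 f.
Proof. split; auto; intros; apply (fbound_unit 0). Qed.

Lemma Diff_sub (D D' : C -> Prop) n f : (forall z, D' z -> D z) -> Diff D n f -> Diff D' n f.
Proof. intros; eapply FD_sub; eauto. Qed.

Lemma Diff_ext D n f g : Copen D -> (forall z, D z -> f z = g z) -> Diff D n f -> Diff D n g.
Proof. intros H E; apply FD_ext; auto. Qed.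

Lemma Diff_add D n f g : Diff D n f -> Diff D n g -> Diff D n (fun z => f z + g z)%C.
Proof. apply FD_add. Qed.

Lemma Diff_mul D n f g : Diff D n f -> Diff D n g -> Diff D n (fun z => f z * g z)%C.
Proof. apply (FD_mul unit_wt unit_wt01 D 0 0 n (fun _ => f) (fun _ => g)). Qed.

Lemma Diff_const D n c : Diff D n (fun _ => c).
Proof. apply (FD_scalar unit_wt). Qed.

Lemma Diff_id D n : Diff D n (fun z => z).
Proof. apply FD_id. Qed.

Lemma Diff_opp D n f : Diff D n f -> Diff D n (fun z => - f z)%C.
Proof. apply (FD_opp unit_wt unit_wt01). Qed.

Lemma Diff_minus D n f g : Diff D n f -> Diff D n g -> Diff D n (fun z => f z - g z)%C.
Proof. apply (FD_minus unit_wt unit_wt01). Qed.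

Lemma Diff_inv (D : C -> Prop) n (f : C -> C) :
  (forall z, D z -> f z <> 0%C) -> Diff D n f -> Diff D n (fun z => / f z)%C.
Proof.
  intros H; apply (FD_inv unit_wt unit_wt01 D n (fun _ => f)).
  intros z Hz; exists (Cmod (f z)); split; [apply Cmod_gt_0; auto|intros; lra].
Qed.

Lemma Diff_affine (D : C -> Prop) n a b f :
  Diff D n f -> Diff (fun z => D (a * z + b)%C) n (fun z => f (a * z + b)%C).
Proof. apply (FD_affine unit_wt unit_wt01). Qed.

(** The derivative is selected pointwise by [epsilon]; by uniqueness it agrees with every local
    derivative, so the local witnesses glue and the induction on the order proceeds. *)
Lemma Diff_local (D : C -> Prop) n f :
  (forall z, D z -> exists d, 0 < d /\ Diff (fun y => Cmod (y - z) < d) n f) -> Diff D n f.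
Proof.
  revert f; induction n; intros f H; [apply Diff_0|].
  set (g := fun z => epsilon (inhabits (RtoC 0)) (fun l : C => cder f z l)).
  assert (Hg : forall z l, cder f z l -> g z = l).
  { intros z l Hl; apply (cder_unique f z); auto.
    apply (epsilon_spec (inhabits (RtoC 0)) (fun l : C => cder f z l)); eauto. }
  apply Diff_S; exists g; split.
  - intros z Hz; destruct (H z Hz) as [d [d0 Hd]]; apply Diff_S in Hd.
    destruct Hd as [k [Hk _]].
    assert (cder f z (k z)).
    { apply Hk; replace (z - z)%C with (RtoC 0) by ring; rewrite Cmod_0; auto. }
    rewrite (Hg z (k z)); auto.
  - apply IHn; intros z Hz; destruct (H z Hz) as [d [d0 Hd]]; exists d; split; auto.
    apply Diff_S in Hd; destruct Hd as [k [Hk Hk']].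
    apply Diff_ext with k; auto.
    + intros y Hy; exists (d - Cmod (y - z)); split; [lra|]; intros h Hh.
      replace (y + h - z)%C with ((y - z) + h)%C by ring.
      eapply Rle_lt_trans; [apply Cmod_triangle|]; lra.
    + intros y Hy; symmetry; apply Hg; auto.
Qed.

Lemma cder_lipschitz f z l : cder f z l ->
  exists d M, 0 < d /\ 0 <= M /\ forall h, Cmod h < d -> Cmod (f (z + h)%C - f z) <= M * Cmod h.
Proof.
  intros (d & M & d0 & M0 & HM); exists (Rmin d 1), (Cmod l + M).
  pose proof (Cmod_ge_0 l).
  split; [apply Rmin_pos; lra|split; [lra|]]; intros h Hh.
  assert (Cmod h < d) by (eapply Rlt_le_trans; [apply Hh|apply Rmin_l]).
  assert (Cmod h < 1) by (eapply Rlt_le_trans; [apply Hh|apply Rmin_r]).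
  replace (f (z + h) - f z)%C with ((f (z + h) - f z - h * l) + h * l)%C by ring.
  eapply Rle_trans; [apply Cmod_triangle|]; rewrite Cmod_mult.
  specialize (HM h H0); pose proof (Cmod_ge_0 h).
  assert (M * Cmod h ^ 2 <= M * Cmod h) by (apply Rmult_le_compat_l; auto; nra).
  lra.
Qed.

Lemma is_derive_quadratic (f : R -> R) (x l d M : R) : 0 < d -> 0 <= M ->
  (forall h, Rabs h < d -> Rabs (f (x + h) - f x - h * l) <= M * h ^ 2) ->
  is_derive f x l.
Proof.
  intros d0 M0 H; apply is_derive_Reals; intros eps He.
  assert (dd : 0 < Rmin d (eps / (M + 1))).
  { apply Rmin_pos; auto; apply Rdiv_lt_0_compat; lra. }
  exists (mkposreal _ dd); simpl; intros h h0 Hh.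
  assert (h1 : Rabs h < d) by (eapply Rlt_le_trans; [apply Hh|apply Rmin_l]).
  assert (h2 : Rabs h < eps / (M + 1)) by (eapply Rlt_le_trans; [apply Hh|apply Rmin_r]).
  replace ((f (x + h) - f x) / h - l) with ((f (x + h) - f x - h * l) / h) by (field; auto).
  unfold Rdiv; rewrite Rabs_mult, Rabs_inv.
  pose proof (Rabs_pos_lt h h0).
  apply Rmult_lt_reg_r with (Rabs h); auto.
  rewrite Rmult_assoc, Rinv_l, Rmult_1_r; [|lra].
  eapply Rle_lt_trans; [apply H; auto|].
  rewrite <- (pow2_abs h).
  apply Rmult_lt_compat_r with (r := M + 1) in h2; [|lra].
  replace (eps / (M + 1) * (M + 1)) with eps in h2 by (field; lra).
  nra.
Qed.

Lemma cder_line_fst f (a v : C) (x : R) l : cder f (a + RtoC x * v)%C l ->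
  is_derive (fun t : R => fst (f (a + RtoC t * v)%C)) x (fst (v * l)%C).
Proof.
  intros (d & M & d0 & M0 & HM); pose proof (Cmod_ge_0 v).
  apply (is_derive_quadratic _ _ _ (d / (Cmod v + 1)) (M * Cmod v ^ 2)).
  - apply Rdiv_lt_0_compat; lra.
  - apply Rmult_le_pos; auto; apply pow2_ge_0.
  - intros h Hh.
    assert (Hv : Cmod (h * v) < d).
    { rewrite Cmod_mult, Cmod_R.
      apply Rmult_lt_compat_r with (r := Cmod v + 1) in Hh; [|lra].
      replace (d / (Cmod v + 1) * (Cmod v + 1)) with d in Hh by (field; lra).
      pose proof (Rabs_pos h); lra. }
    specialize (HM _ Hv).
    replace (a + RtoC x * v + h * v)%C with (a + RtoC (x + h) * v)%C in HM
      by (rewrite RtoC_plus; ring).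
    replace (fst (f (a + RtoC (x + h) * v)%C) - fst (f (a + RtoC x * v)%C) - h * fst (v * l)%C)
      with (fst (f (a + RtoC (x + h) * v) - f (a + RtoC x * v) - h * v * l)%C)
      by (simpl; ring).
    eapply Rle_trans; [apply Rabs_fst_le|]; eapply Rle_trans; [apply HM|].
    rewrite Cmod_mult, Cmod_R, <- (pow2_abs h); apply Req_le; ring.
Qed.


(** The imaginary part of [f] is the real part of -i [f]. *)
Lemma cder_line_snd f (a v : C) (x : R) l : cder f (a + RtoC x * v)%C l ->
  is_derive (fun t : R => snd (f (a + RtoC t * v)%C)) x (snd (v * l)%C).
Proof.
  intros H; apply (cder_scal (- Ci)%C), cder_line_fst in H.
  replace (snd (v * l)%C) with (fst (v * (- Ci * l))%C) by (simpl; ring).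
  eapply is_derive_ext; [|apply H]; intros t; simpl; ring.
Qed.

(** * Summation over nat and Z * Z *)

Lemma Ccv_unique u l m : Ccv u l -> Ccv u m -> l = m.
Proof.
  intros [H1 H2] [H3 H4]; apply injective_projections.
  - apply (UL_sequence _ _ _ H1 H3).
  - apply (UL_sequence _ _ _ H2 H4).
Qed.

Lemma Clim_unique u l : Ccv u l -> Clim u = l.
Proof.
  intros H; apply (Ccv_unique u); auto.
  apply (epsilon_spec (inhabits Czero) (fun l => Ccv u l)); eauto.
Qed.

Lemma Ccv_ext (u v : nat -> C) l : (forall n, u n = v n) -> Ccv u l -> Ccv v l.
Proof.
  intros E; replace v with u; auto; apply functional_extensionality; auto.
Qed.

Lemma Ccv_add (u v : nat -> C) l m : Ccv u l -> Ccv v m -> Ccv (fun n => u n + v n)%C (l + m)%C.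
Proof. intros [H1 H2] [H3 H4]; split; apply CV_plus; auto. Qed.

Lemma Un_cv_const c : Un_cv (fun _ => c) c.
Proof. intros e He; exists 0%nat; intros; rewrite Rdist_eq; auto. Qed.

Lemma Ccv_const c : Ccv (fun _ => c) c.
Proof. split; apply Un_cv_const. Qed.

Lemma Ccv_scal c (u : nat -> C) l : Ccv u l -> Ccv (fun n => c * u n)%C (c * l)%C.
Proof.
  intros [H1 H2]; split; simpl.
  - apply CV_minus; apply CV_mult; auto using Un_cv_const.
  - apply CV_plus; apply CV_mult; auto using Un_cv_const.
Qed.

Lemma Ccv_subseq_S (u : nat -> C) l : Ccv u l -> Ccv (fun n => u (S n)) l.
Proof.
  intros [H1 H2]; split; intros e He.
  - destruct (H1 e He) as [N HN]; exists N; intros; apply HN; lia.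
  - destruct (H2 e He) as [N HN]; exists N; intros; apply HN; lia.
Qed.

Definition rsum {I} (F : I -> R) (l : list I) : R := fold_right Rplus 0 (map F l).

Definition csum {I} (F : I -> C) (l : list I) : C := Csum_list (map F l).

Lemma csum_nil {I} (F : I -> C) : csum F [] = 0%C.
Proof. reflexivity. Qed.

Lemma csum_cons {I} (F : I -> C) a l : csum F (a :: l) = (F a + csum F l)%C.
Proof. reflexivity. Qed.

Lemma csum_app {I} (F : I -> C) l m : csum F (l ++ m) = (csum F l + csum F m)%C.
Proof.
  induction l; simpl app; [rewrite csum_nil; ring|]; rewrite !csum_cons, IHl; ring.
Qed.

Lemma csum_add {I} (F G : I -> C) l :
  csum (fun p => F p + G p)%C l = (csum F l + csum G l)%C.
Proof. induction l; [rewrite !csum_nil; ring|]; rewrite !csum_cons, IHl; ring. Qed.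

Lemma csum_scal {I} c (F : I -> C) l : csum (fun p => c * F p)%C l = (c * csum F l)%C.
Proof. induction l; [rewrite !csum_nil; ring|]; rewrite !csum_cons, IHl; ring. Qed.

Lemma csum_ext {I} (F G : I -> C) l : (forall p, F p = G p) -> csum F l = csum G l.
Proof. intros E; induction l; auto; rewrite !csum_cons, IHl, E; auto. Qed.

Lemma csum_map {I J} (g : J -> I) (F : I -> C) l : csum F (map g l) = csum (fun j => F (g j)) l.
Proof. unfold csum; rewrite map_map; auto. Qed.

Lemma rsum_cons {I} (F : I -> R) a l : rsum F (a :: l) = F a + rsum F l.
Proof. reflexivity. Qed.

Lemma rsum_app {I} (F : I -> R) l m : rsum F (l ++ m) = rsum F l + rsum F m.
Proof. induction l; simpl app; [unfold rsum; simpl; ring|]; rewrite !rsum_cons, IHl; ring. Qed.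

Lemma rsum_add {I} (F G : I -> R) l : rsum (fun p => F p + G p) l = rsum F l + rsum G l.
Proof. induction l; [unfold rsum; simpl; ring|]; rewrite !rsum_cons, IHl; ring. Qed.

Lemma rsum_scal {I} c (F : I -> R) l : rsum (fun p => c * F p) l = c * rsum F l.
Proof. induction l; [unfold rsum; simpl; ring|]; rewrite !rsum_cons, IHl; ring. Qed.

Lemma rsum_le {I} (F G : I -> R) l : (forall p, F p <= G p) -> rsum F l <= rsum G l.
Proof. intros H; induction l; [unfold rsum; simpl; lra|]; rewrite !rsum_cons; specialize (H a); lra. Qed.

Lemma rsum_ge0 {I} (F : I -> R) l : (forall p, 0 <= F p) -> 0 <= rsum F l.
Proof. intros H; induction l; [unfold rsum; simpl; lra|]; rewrite !rsum_cons; specialize (H a); lra. Qed.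

Lemma csum_fst {I} (F : I -> C) l : fst (csum F l) = rsum (fun p => fst (F p)) l.
Proof. induction l; auto; rewrite csum_cons, rsum_cons, <- IHl; auto. Qed.

Lemma csum_snd {I} (F : I -> C) l : snd (csum F l) = rsum (fun p => snd (F p)) l.
Proof. induction l; auto; rewrite csum_cons, rsum_cons, <- IHl; auto. Qed.

Lemma csum_bound {I} (F : I -> C) (G : I -> R) l :
  (forall p, Cmod (F p) <= G p) -> Cmod (csum F l) <= rsum G l.
Proof.
  intros H; induction l.
  - rewrite csum_nil, Cmod_0; unfold rsum; simpl; lra.
  - rewrite csum_cons, rsum_cons; eapply Rle_trans; [apply Cmod_triangle|]; specialize (H a); lra.
Qed.

(** An interface for summation along growing finite lists. Monotonicity on nonnegative functions
    expresses that the lists are nested; [K] bounds all partial sums of the cubed weights. *)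
Definition exhausting {I} (L : nat -> list I) (wt : I -> R) (K : R) : Prop :=
  (forall p, 0 <= wt p <= 1) /\
  (forall (F : I -> R), (forall p, 0 <= F p) -> forall N, rsum F (L N) <= rsum F (L (S N))) /\
  (forall N, rsum (fun p => wt p ^ 3) (L N) <= K).

Definition fsum {I} (L : nat -> list I) (F : I -> C) : C := Clim (fun N => csum F (L N)).

Section Summation.

Context {I : Type} (L : nat -> list I) (wt : I -> R) (K : R).
Hypothesis EX : exhausting L wt K.

Lemma exhausting_K0 : 0 <= K.
Proof.
  destruct EX as (H1 & _ & H3); eapply Rle_trans; [|apply (H3 0%nat)].
  apply rsum_ge0; intros; apply pow_le, H1.
Qed.

Lemma rsum_cv (F : I -> R) M :
  0 <= M -> (forall p, Rabs (F p) <= M * wt p ^ 3) ->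
  exists l, Un_cv (fun N => rsum F (L N)) l.
Proof.
  intros M0 HF; destruct EX as (H1 & H2 & H3).
  (* Nonnegative families have increasing bounded partial sums. The signed family is the difference
     of F + M wt^3 and M wt^3, both lying between 0 and 2 M wt^3. *)
  assert (H4 : forall G : I -> R, (forall p, 0 <= G p <= 2 * M * wt p ^ 3) ->
    exists l, Un_cv (fun N => rsum G (L N)) l).
  { intros G HG.
    destruct (growing_cv (fun N => rsum G (L N))) as [l Hl]; [| |exists l; auto].
    - intros n; apply H2; intros; apply HG.
    - exists (2 * M * K); intros x [n ->].
      eapply Rle_trans; [apply rsum_le; intros; apply HG|].
      rewrite rsum_scal; apply Rmult_le_compat_l; auto; lra. }
  destruct (H4 (fun p => F p + M * wt p ^ 3)) as [l Hl].
  { intros p; specialize (HF p); apply Rabs_le_between in HF; lra. }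
  destruct (H4 (fun p => M * wt p ^ 3)) as [m Hm].
  { intros p; specialize (H1 p); pose proof (pow_le (wt p) 3 (proj1 H1)).
    pose proof (Rmult_le_pos _ _ M0 H); lra. }
  exists (l - m); eapply Un_cv_ext; [|apply (CV_minus _ _ _ _ Hl Hm)].
  intros n; simpl; rewrite rsum_add; ring.
Qed.

Lemma fsum_cv (F : I -> C) : fbound wt 3 F -> Ccv (fun N => csum F (L N)) (fsum L F).
Proof.
  intros [M [M0 HM]].
  destruct (rsum_cv (fun p => fst (F p)) M) as [l1 H1]; auto.
  { intros; eapply Rle_trans; [apply Rabs_fst_le|auto]. }
  destruct (rsum_cv (fun p => snd (F p)) M) as [l2 H2]; auto.
  { intros; eapply Rle_trans; [apply Rabs_snd_le|auto]. }
  assert (H : Ccv (fun N => csum F (L N)) (l1, l2)).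
  { split; simpl; [eapply Un_cv_ext; [|apply H1]|eapply Un_cv_ext; [|apply H2]];
      intros n; simpl; rewrite ?csum_fst, ?csum_snd; auto. }
  unfold fsum; rewrite (Clim_unique _ _ H); auto.
Qed.

Lemma Un_cv_bounded u l B : (forall n, Rabs (u n) <= B) -> Un_cv u l -> Rabs l <= B.
Proof.
  intros H Hu; apply Rnot_lt_le; intros Hl.
  destruct (Hu (Rabs l - B)) as [N HN]; [lra|].
  specialize (HN N (Nat.le_refl N)); unfold Rdist in HN; specialize (H N).
  pose proof (Rabs_triang_inv l (u N)); rewrite Rabs_minus_sym in HN; lra.
Qed.

(** The limit is taken in each coordinate separately, which costs the factor 2. *)
Lemma fsum_bound (F : I -> C) M : 0 <= M -> (forall p, Cmod (F p) <= M * wt p ^ 3) ->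
  Cmod (fsum L F) <= 2 * M * K.
Proof.
  intros M0 HM.
  assert (HF : fbound wt 3 F) by (exists M; auto).
  assert (H : forall n, Cmod (csum F (L n)) <= M * K).
  { intros n; eapply Rle_trans; [apply csum_bound, HM|]; rewrite rsum_scal.
    apply Rmult_le_compat_l; auto; apply EX. }
  destruct (fsum_cv F HF) as [H1 H2].
  apply (Un_cv_bounded _ _ (M * K)) in H1; [|intros; eapply Rle_trans; [apply Rabs_fst_le|auto]].
  apply (Un_cv_bounded _ _ (M * K)) in H2; [|intros; eapply Rle_trans; [apply Rabs_snd_le|auto]].
  eapply Rle_trans; [apply Cmod_le_parts|]; lra.
Qed.

Lemma fsum_add (F G : I -> C) : fbound wt 3 F -> fbound wt 3 G ->
  fsum L (fun p => F p + G p)%C = (fsum L F + fsum L G)%C.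
Proof.
  intros HF HG; apply Clim_unique.
  apply Ccv_ext with (fun N => csum F (L N) + csum G (L N))%C.
  - intros; rewrite csum_add; auto.
  - apply Ccv_add; apply fsum_cv; auto.
Qed.

Lemma fsum_scal c (F : I -> C) : fbound wt 3 F ->
  fsum L (fun p => c * F p)%C = (c * fsum L F)%C.
Proof.
  intros HF; apply Clim_unique.
  apply Ccv_ext with (fun N => c * csum F (L N))%C.
  - intros; rewrite csum_scal; auto.
  - apply Ccv_scal, fsum_cv; auto.
Qed.

Lemma fsum_ext (F G : I -> C) : (forall p, F p = G p) -> fsum L F = fsum L G.
Proof. intros H; f_equal; apply functional_extensionality; auto. Qed.

(** The remainder of the sum is the sum of the remainders, and these are bounded by [fsum_bound]
    with a factor |h|^2. *)
Lemma cder_fsum (F : I -> C -> C) G z :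
  fbound wt 3 (fun p => F p z) -> fbound wt 3 G -> fder wt 3 F z G ->
  cder (fun y => fsum L (fun p => F p y)) z (fsum L G).
Proof.
  intros HF HG (d & M & d0 & M0 & HM).
  exists d, (2 * M * K); repeat split; auto.
  { repeat apply Rmult_le_pos; try lra; apply exhausting_K0. }
  intros h Hh; specialize (HM h Hh).
  assert (E : fbound wt 3 (fun p => F p (z + h) - F p z - h * G p)%C).
  { exists (M * Cmod h ^ 2); split; [apply Rmult_le_pos; auto; apply pow2_ge_0|auto]. }
  assert (HhG : fbound wt 3 (fun p => h * G p)%C).
  { apply (fbound_mul wt 0 3 (fun _ => h) G); auto.
    apply fbound_0 with (Cmod h); intros; lra. }
  replace (fsum L (fun p => F p (z + h))%C - fsum L (fun p => F p z) - h * fsum L G)%C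
    with (fsum L (fun p => F p (z + h) - F p z - h * G p)%C).
  - replace (2 * M * K * Cmod h ^ 2) with (2 * (M * Cmod h ^ 2) * K) by ring.
    apply fsum_bound; auto; apply Rmult_le_pos; auto; apply pow2_ge_0.
  - rewrite (fsum_ext (fun p => F p (z + h)%C)
      (fun p => (F p (z + h) - F p z - h * G p) + (F p z + h * G p))%C) by (intros; ring).
    rewrite fsum_add, fsum_add, fsum_scal; auto; [ring|].
    apply fbound_add; auto.
Qed.

Lemma Diff_fsum D n (F : I -> C -> C) :
  FD wt D 3 n F -> Diff D n (fun z => fsum L (fun p => F p z)).
Proof.
  revert F; induction n; intros F HF; [apply Diff_0|].
  destruct HF as [H1 [G [H2 H3]]]; apply Diff_S.
  exists (fun z => fsum L (fun p => G p z)); split; auto.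
  intros z Hz; apply cder_fsum; auto; eapply FD_bound; eauto.
Qed.

(** [FD] gives some derivative family without naming it; uniqueness of derivatives identifies it
    with the explicit termwise derivatives [G]. *)
Lemma cder_fsum_termwise D n (F G : I -> C -> C) z :
  FD wt D 3 (S n) F -> D z -> (forall p, cder (F p) z (G p z)) ->
  cder (fun y => fsum L (fun p => F p y)) z (fsum L (fun p => G p z)).
Proof.
  intros [H1 [G' [H2 H3]]] Hz HG.
  replace (fun p => G p z) with (fun p => G' p z).
  - apply cder_fsum; auto; eapply FD_bound; eauto.
  - apply functional_extensionality; intros p.
    apply (cder_unique (F p) z); auto.
    apply (fder_cder wt 3 F z (fun p => G' p z) p); auto; apply EX.
Qed.

End Summation.

Definition nat_wt (k : nat) : R := / INR (S k).

Lemma nat_wt01 k : 0 <= nat_wt k <= 1.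
Proof.
  unfold nat_wt; rewrite S_INR; pose proof (pos_INR k).
  split; [left; apply Rinv_0_lt_compat; lra|].
  rewrite <- Rinv_1; apply Rinv_le_contravar; lra.
Qed.

Lemma rsum_seq_telescope (F : nat -> R) (g : nat -> R) N :
  (forall k, F k <= g k - g (S k)) -> rsum F (seq 0 N) <= g 0%nat - g N.
Proof.
  intros H; induction N.
  - unfold rsum; simpl; lra.
  - rewrite seq_S, rsum_app, rsum_cons; unfold rsum at 2; simpl map; simpl fold_right.
    rewrite Nat.add_0_l; specialize (H N); lra.
Qed.

(** Telescoping: x^(-3) <= 2/x - 2/(x+1) for x >= 1. *)
Lemma exhausting_nat : exhausting (seq 0) nat_wt 2.
Proof.
  split; [apply nat_wt01|split].
  - intros F HF N; rewrite seq_S, rsum_app, rsum_cons; unfold rsum at 3; simpl.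
    specialize (HF N); lra.
  - intros N; eapply Rle_trans.
    + apply rsum_seq_telescope with (g := fun k => 2 * / INR (S k)); intros k.
      unfold nat_wt; rewrite (S_INR (S k)).
      assert (Hx : 1 <= INR (S k)) by (rewrite S_INR; pose proof (pos_INR k); lra).
      set (x := INR (S k)) in *.
      replace (2 * / x - 2 * / (x + 1)) with (/ x ^ 3 * (2 * x ^ 2 * / (x + 1))) by (field; lra).
      rewrite pow_inv.
      rewrite <- (Rmult_1_r (/ x ^ 3)) at 1.
      apply Rmult_le_compat_l; [left; apply Rinv_0_lt_compat, pow_lt; lra|].
      apply Rmult_le_reg_r with (x + 1); [lra|].
      rewrite Rmult_assoc, Rinv_l by lra; nra.
    + pose proof (nat_wt01 N); unfold nat_wt in H; simpl INR at 1; lra.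
Qed.

Definition ZZ_wt (p : Z * Z) : R := / (1 + Rabs (IZR (fst p)) + Rabs (IZR (snd p))).

Definition ZZ_sq (N : nat) : list (Z * Z) := list_prod (zrange N) (zrange N).

Lemma zrange_S N : zrange (S N) = (- Z.of_nat (S N))%Z :: zrange N ++ [Z.of_nat (S N)].
Proof.
  unfold zrange.
  replace (2 * S N + 1)%nat with (1 + (2 * N + 1) + 1)%nat by lia.
  set (M := (2 * N + 1)%nat).
  rewrite !seq_app, !map_app.
  cbn [seq map app]; f_equal; f_equal.
  - rewrite Nat.add_0_l, <- seq_shift, map_map; apply map_ext; intros; lia.
  - f_equal; unfold M; lia.
Qed.

Lemma rsum_list_prod {A B} (F : A * B -> R) l m :
  rsum F (list_prod l m) = rsum (fun a => rsum (fun b => F (a, b)) m) l.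
Proof.
  induction l; auto; simpl list_prod; rewrite rsum_app, rsum_cons, IHl; f_equal.
  unfold rsum; rewrite map_map; auto.
Qed.

Lemma csum_list_prod {A B} (F : A * B -> C) l m :
  csum F (list_prod l m) = csum (fun a => csum (fun b => F (a, b)) m) l.
Proof.
  induction l; auto; simpl list_prod; rewrite csum_app, csum_cons, IHl; f_equal.
  unfold csum; rewrite map_map; auto.
Qed.

Lemma rsum_zrange_mono (F : Z -> R) N :
  (forall k, 0 <= F k) -> rsum F (zrange N) <= rsum F (zrange (S N)).
Proof.
  intros H; rewrite zrange_S, rsum_cons, rsum_app, rsum_cons; change (rsum F []) with 0.
  pose proof (H (- Z.of_nat (S N))%Z); pose proof (H (Z.of_nat (S N))); lra.
Qed.

(** Telescoping for the exponent 3/2: with y = x + 1, y^(-3/2) <= 2 (x^(-1/2) - y^(-1/2)). Each step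
    adds the two indices of equal absolute value, hence the coefficient 4; the term at 0 fixes 5. *)
Lemma exhausting_ZZ_aux N :
  rsum (fun k : Z => / (1 + Rabs (IZR k)) * / sqrt (1 + Rabs (IZR k))) (zrange N)
  <= 5 - 4 * / sqrt (INR (S N)).
Proof.
  induction N.
  - unfold zrange, rsum; simpl; rewrite Rabs_R0, !Rplus_0_r, sqrt_1, Rinv_1; lra.
  - rewrite zrange_S, rsum_cons, rsum_app, rsum_cons; unfold rsum at 2; simpl fold_right.
    rewrite opp_IZR, Rabs_Ropp, <- INR_IZR_INZ, (Rabs_pos_eq (INR (S N))) by apply pos_INR.
    replace (1 + INR (S N)) with (INR (S (S N))) by (rewrite (S_INR (S N)); ring).
    assert (Hx : 1 <= INR (S N)) by (rewrite S_INR; pose proof (pos_INR N); lra).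
    assert (Hy : INR (S (S N)) = INR (S N) + 1) by apply S_INR.
    set (x := INR (S N)) in *; set (y := INR (S (S N))) in *.
    assert (sx : 0 < sqrt x) by (apply sqrt_lt_R0; lra).
    assert (sy : 0 < sqrt y) by (apply sqrt_lt_R0; lra).
    assert (sxx : sqrt x * sqrt x = x) by (apply sqrt_def; lra).
    assert (syy : sqrt y * sqrt y = y) by (apply sqrt_def; lra).
    assert (sxy : sqrt x <= sqrt y) by (apply sqrt_le_1_alt; lra).
    set (a := sqrt x) in *; set (b := sqrt y) in *.
    assert (/ y * / b <= 2 * (/ a - / b)).
    { replace (2 * (/ a - / b)) with ((2 * (b * b - a * a) * / (a * (a + b))) * / b)
        by (field; repeat split; nra).
      apply Rmult_le_compat_r; [left; apply Rinv_0_lt_compat; auto|].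
      replace (b * b - a * a) with 1 by nra.
      rewrite <- syy, Rmult_1_r.
      apply Rmult_le_reg_r with (b * b * (a * (a + b))); [repeat apply Rmult_lt_0_compat; lra|].
      replace (/ (b * b) * (b * b * (a * (a + b)))) with (a * (a + b)) by (field; lra).
      replace (2 * / (a * (a + b)) * (b * b * (a * (a + b)))) with (2 * (b * b)) by (field; split; nra).
      nra. }
    lra.
Qed.

(** For x, y >= 1 one has xy <= (x + y - 1)^2, so the cubed weight is at most (xy)^(-3/2) with x = 1
    + |m|, y = 1 + |n|. The double sum then factors into two one-dimensional sums, each at most
    5. *)
Lemma exhausting_ZZ : exhausting ZZ_sq ZZ_wt 25.
Proof.
  split; [|split].
  - intros p; unfold ZZ_wt.
    pose proof (Rabs_pos (IZR (fst p))); pose proof (Rabs_pos (IZR (snd p))).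
    split; [left; apply Rinv_0_lt_compat; lra|].
    rewrite <- Rinv_1; apply Rinv_le_contravar; lra.
  - intros F HF N; unfold ZZ_sq; rewrite !rsum_list_prod.
    eapply Rle_trans.
    + apply rsum_zrange_mono; intros; apply rsum_ge0; auto.
    + apply rsum_le; intros; apply rsum_zrange_mono; auto.
  - intros N; unfold ZZ_sq; rewrite rsum_list_prod.
    set (a := fun k : Z => / (1 + Rabs (IZR k)) * / sqrt (1 + Rabs (IZR k))).
    assert (a0 : forall k, 0 <= a k).
    { intros k; unfold a; pose proof (Rabs_pos (IZR k)).
      apply Rmult_le_pos; left; apply Rinv_0_lt_compat; [|apply sqrt_lt_R0]; lra. }
    assert (H : forall m n, ZZ_wt (m, n) ^ 3 <= a n * a m).
    { intros m n; unfold ZZ_wt, a; simpl fst; simpl snd.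
      pose proof (Rabs_pos (IZR m)); pose proof (Rabs_pos (IZR n)).
      set (x := 1 + Rabs (IZR m)) in *; set (y := 1 + Rabs (IZR n)).
      replace (x + Rabs (IZR n)) with (x + y - 1) by (unfold y; ring).
      assert (x1 : 1 <= x) by (unfold x; lra).
      assert (y1 : 1 <= y) by (unfold y; lra).
      assert (sx : 0 < sqrt x) by (apply sqrt_lt_R0; lra).
      assert (sy : 0 < sqrt y) by (apply sqrt_lt_R0; lra).
      assert (sxx : sqrt x * sqrt x = x) by (apply sqrt_def; lra).
      assert (syy : sqrt y * sqrt y = y) by (apply sqrt_def; lra).
      rewrite pow_inv.
      replace (/ y * / sqrt y * (/ x * / sqrt x)) with (/ ((x * y) * (sqrt x * sqrt y)))
        by (field; lra).
      assert (E : sqrt x * sqrt y <= x + y - 1).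
      { assert (x * y <= (x + y - 1) * (x + y - 1)) by nra.
        apply Rsqr_incr_0_var; [|lra]; unfold Rsqr; nra. }
      assert (E2 : x * y <= (x + y - 1) * (x + y - 1)) by nra.
      apply Rinv_le_contravar; [repeat apply Rmult_lt_0_compat; lra|].
      replace ((x + y - 1) ^ 3) with ((x + y - 1) * (x + y - 1) * (x + y - 1)) by ring.
      apply Rmult_le_compat; [nra|apply Rmult_le_pos; lra|exact E2|exact E]. }
    assert (H5 : rsum a (zrange N) <= 5).
    { eapply Rle_trans; [apply exhausting_ZZ_aux|].
      assert (0 < / sqrt (INR (S N))).
      { apply Rinv_0_lt_compat, sqrt_lt_R0, lt_0_INR; lia. }
      lra. }
    assert (H6 : 0 <= rsum a (zrange N)) by (apply rsum_ge0; auto).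
    eapply Rle_trans; [apply rsum_le with (G := fun m => rsum a (zrange N) * a m)|].
    + intros m; eapply Rle_trans; [apply rsum_le; intros n; apply H|].
      rewrite (Rmult_comm (rsum a _)), <- rsum_scal; apply rsum_le; intros; lra.
    + rewrite rsum_scal; nra.
Qed.

(** * The complex exponential *)

Definition cexp (z : C) : C := (exp (fst z) * cos (snd z), exp (fst z) * sin (snd z)).

Lemma cexp_add z w : cexp (z + w)%C = (cexp z * cexp w)%C.
Proof.
  unfold cexp; apply injective_projections; simpl; rewrite exp_plus, ?cos_plus, ?sin_plus; ring.
Qed.

Lemma cexp_0 : cexp 0%C = 1%C.
Proof.
  unfold cexp; apply injective_projections; simpl; rewrite exp_0, ?cos_0, ?sin_0; ring.
Qed.

Lemma Cmod_cexp z : Cmod (cexp z) = exp (fst z).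
Proof.
  unfold Cmod, cexp; simpl.
  pose proof (sin2_cos2 (snd z)); unfold Rsqr in H.
  replace (exp (fst z) * cos (snd z) * (exp (fst z) * cos (snd z) * 1)
    + exp (fst z) * sin (snd z) * (exp (fst z) * sin (snd z) * 1))
    with (exp (fst z) * exp (fst z) * (sin (snd z) * sin (snd z) + cos (snd z) * cos (snd z))) by ring.
  rewrite H, Rmult_1_r; apply sqrt_square; left; apply exp_pos.
Qed.

Lemma cexp_neq_0 z : cexp z <> 0%C.
Proof. apply Cmod_gt_0; rewrite Cmod_cexp; apply exp_pos. Qed.

Lemma cexp_opp z : cexp (- z)%C = (/ cexp z)%C.
Proof.
  assert (H : (cexp (- z) * cexp z)%C = 1%C).
  { rewrite <- cexp_add; replace (- z + z)%C with (RtoC 0) by ring; apply cexp_0. }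
  replace (cexp (- z))%C with (cexp (- z) * cexp z * / cexp z)%C.
  - rewrite H; ring.
  - field; apply cexp_neq_0.
Qed.

Lemma cexp_eq_1 z : cexp z = 1%C -> exists k : Z, z = (2 * PI * Ci * RtoC (IZR k))%C.
Proof.
  intros H.
  assert (Hx : fst z = 0).
  { apply exp_inv; rewrite exp_0, <- Cmod_cexp, H, Cmod_1; auto. }
  assert (Hc : cos (snd z) = 1).
  { apply (f_equal fst) in H; unfold cexp in H; simpl in H; rewrite Hx, exp_0 in H; lra. }
  assert (Hs : sin (snd z / 2) = 0).
  { replace (snd z) with (2 * (snd z / 2)) in Hc by field; rewrite cos_2a_sin in Hc; nra. }
  apply sin_eq_0_0 in Hs; destruct Hs as [k Hk]; exists k.
  apply injective_projections; simpl; [rewrite Hx; ring|].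
  replace (snd z) with (2 * (snd z / 2)) by field; rewrite Hk; ring.
Qed.

Lemma cos_shift_Z x (k : Z) : cos (x + 2 * PI * IZR k) = cos x.
Proof.
  destruct (Z.le_gt_cases 0 k) as [H|H].
  - rewrite <- (Z2Nat.id k H), <- INR_IZR_INZ.
    replace (x + 2 * PI * INR (Z.to_nat k)) with (x + 2 * INR (Z.to_nat k) * PI) by ring.
    apply cos_period.
  - rewrite <- (cos_period _ (Z.to_nat (- k))), INR_IZR_INZ, Z2Nat.id, opp_IZR by lia.
    f_equal; ring.
Qed.

Lemma sin_shift_Z x (k : Z) : sin (x + 2 * PI * IZR k) = sin x.
Proof.
  destruct (Z.le_gt_cases 0 k) as [H|H].
  - rewrite <- (Z2Nat.id k H), <- INR_IZR_INZ.
    replace (x + 2 * PI * INR (Z.to_nat k)) with (x + 2 * INR (Z.to_nat k) * PI) by ring.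
    apply sin_period.
  - rewrite <- (sin_period _ (Z.to_nat (- k))), INR_IZR_INZ, Z2Nat.id, opp_IZR by lia.
    f_equal; ring.
Qed.

Lemma cexp_shift_Z z (k : Z) : cexp (z + 2 * PI * Ci * RtoC (IZR k))%C = cexp z.
Proof.
  unfold cexp; simpl.
  match goal with |- (exp ?a * cos ?b, _) = _ =>
    replace a with (fst z) by ring; replace b with (snd z + 2 * PI * IZR k) by ring end.
  rewrite cos_shift_Z, sin_shift_Z; auto.
Qed.

Lemma Rabs_sin_le x : Rabs (sin x) <= Rabs x.
Proof.
  destruct (MVT_gen sin 0 x cos) as [c [_ Hc]].
  - intros; apply is_derive_Reals, derivable_pt_lim_sin.
  - intros; apply continuity_sin.
  - rewrite sin_0, !Rminus_0_r in Hc; rewrite Hc, Rabs_mult.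
    pose proof (COS_bound c); assert (Rabs (cos c) <= 1) by (apply Rabs_le; lra).
    pose proof (Rabs_pos x); nra.
Qed.

Lemma cos_minus_1_bound x : Rabs (cos x - 1) <= x ^ 2 / 2.
Proof.
  replace (cos x - 1) with (- (2 * (sin (x / 2) * sin (x / 2)))).
  - rewrite Rabs_Ropp, !Rabs_mult, (Rabs_pos_eq 2) by lra.
    pose proof (Rabs_sin_le (x / 2)); pose proof (Rabs_pos (sin (x / 2))).
    assert (Rabs (sin (x / 2)) * Rabs (sin (x / 2)) <= Rabs (x / 2) * Rabs (x / 2)) by nra.
    replace (Rabs (x / 2) * Rabs (x / 2)) with ((x / 2) ^ 2) in H1
      by (rewrite <- (pow2_abs (x / 2)); ring).
    lra.
  - replace x with (2 * (x / 2)) at 3 by field; rewrite cos_2a_sin; ring.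
Qed.

Lemma sin_minus_id_bound x : Rabs x <= 1 -> Rabs (sin x - x) <= x ^ 2.
Proof.
  intros Hx; destruct (MVT_gen (fun y => sin y - y) 0 x (fun y => cos y - 1)) as [c [Hc1 Hc]].
  - intros; apply @is_derive_minus; [apply is_derive_Reals, derivable_pt_lim_sin|apply @is_derive_id].
  - intros; apply continuity_pt_minus; [apply continuity_sin|apply derivable_continuous_pt, derivable_pt_id].
  - simpl in Hc; rewrite sin_0, !Rminus_0_r in Hc; rewrite Hc, Rabs_mult.
    pose proof (cos_minus_1_bound c) as Hb.
    assert (Hcx : Rabs c <= Rabs x).
    { unfold Rmin, Rmax in Hc1; destruct (Rle_dec 0 x).
      - rewrite !Rabs_pos_eq; lra.
      - rewrite !Rabs_left1; lra. }
    assert (c ^ 2 <= Rabs x).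
    { rewrite <- pow2_abs; pose proof (Rabs_pos c); nra. }
    rewrite <- (pow2_abs x); pose proof (Rabs_pos x); nra.
Qed.

Lemma exp_minus_1_bound x : Rabs x <= 1 / 2 -> Rabs (exp x - 1 - x) <= 2 * x ^ 2.
Proof.
  intros Hx; apply Rabs_le_between in Hx.
  assert (H1 : forall y, 1 + y <= exp y).
  { intros y; destruct (Req_dec y 0) as [->|]; [rewrite exp_0; lra|left; apply exp_ineq1; auto]. }
  pose proof (H1 x); pose proof (H1 (- x)).
  rewrite exp_Ropp in H0; pose proof (exp_pos x).
  assert (exp x * (1 + - x) <= 1).
  { apply Rmult_le_compat_l with (r := exp x) in H0; [|lra]; rewrite Rinv_r in H0; lra. }
  rewrite Rabs_pos_eq by lra; nra.
Qed.

(** The first-order errors [e], [c], [s] of exp, cos and sin are expanded in both coordinates; the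
    estimates give 3 and 4, well within the constant 12. *)
Lemma cexp_quadratic h : Cmod h <= 1 / 2 -> Cmod (cexp h - 1 - h)%C <= 12 * Cmod h ^ 2.
Proof.
  intros Hh; destruct h as [x y].
  pose proof (Rabs_fst_le (x, y)) as hx; pose proof (Rabs_snd_le (x, y)) as hy; simpl in hx, hy.
  pose proof (exp_minus_1_bound x ltac:(lra)) as He.
  pose proof (cos_minus_1_bound y) as Hc.
  pose proof (sin_minus_id_bound y ltac:(lra)) as Hs.
  set (n := Cmod (x, y)) in *.
  rewrite <- (pow2_abs x) in He; rewrite <- (pow2_abs y) in Hc, Hs.
  pose proof (Rabs_pos x); pose proof (Rabs_pos y).
  assert (X2 : Rabs x ^ 2 <= n ^ 2) by nra.
  assert (Y2 : Rabs y ^ 2 <= n ^ 2) by nra.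
  assert (N2 : n ^ 2 <= 1 / 4) by (assert (0 <= n) by apply Cmod_ge_0; nra).
  set (e := exp x - 1 - x) in *; set (c := cos y - 1) in *; set (s := sin y - y) in *.
  assert (Ex : exp x = 1 + x + e) by (unfold e; ring).
  assert (Ec : cos y = 1 + c) by (unfold c; ring).
  assert (Es : sin y = y + s) by (unfold s; ring).
  assert (Q : Rabs (1 + x + e) <= 2).
  { eapply Rle_trans; [apply Rabs_triang|].
    pose proof (Rabs_triang 1 x); rewrite Rabs_R1 in H1; lra. }
  eapply Rle_trans; [apply Cmod_le_parts|].
  unfold cexp; simpl fst; simpl snd; rewrite Ex, Ec, Es.
  replace ((1 + x + e) * (1 + c) + - (1) + - x) with (e + (1 + x + e) * c) by ring.
  replace ((1 + x + e) * (y + s) + - 0 + - y) with ((x + e) * y + (1 + x + e) * s) by ring.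
  assert (E1 : Rabs (e + (1 + x + e) * c) <= 3 * n ^ 2).
  { eapply Rle_trans; [apply Rabs_triang|]; rewrite Rabs_mult.
    assert (Rabs (1 + x + e) * Rabs c <= 2 * (n ^ 2 / 2))
      by (apply Rmult_le_compat; auto using Rabs_pos; lra).
    lra. }
  assert (E2 : Rabs ((x + e) * y + (1 + x + e) * s) <= 4 * n ^ 2).
  { eapply Rle_trans; [apply Rabs_triang|]; rewrite !Rabs_mult.
    assert (Rabs (1 + x + e) * Rabs s <= 2 * n ^ 2)
      by (apply Rmult_le_compat; auto using Rabs_pos; lra).
    assert (Rabs (x + e) <= 2 * n).
    { eapply Rle_trans; [apply Rabs_triang|]; assert (0 <= n) by apply Cmod_ge_0; nra. }
    assert (Rabs (x + e) * Rabs y <= 2 * n * n)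
      by (apply Rmult_le_compat; auto using Rabs_pos).
    nra. }
  assert (0 <= n ^ 2) by apply pow2_ge_0.
  lra.
Qed.

(** Differentiation multiplies the coefficient by the bounded frequency [a p], so the family keeps
    its shape and the induction on the order closes. *)
Lemma FD_exp {I} (wt : I -> R) D k n (c a : I -> C) A :
  (forall p, 0 <= wt p <= 1) ->
  (forall p, Cmod (a p) <= A) -> fbound wt k c ->
  FD wt D k n (fun p z => c p * cexp (a p * z))%C.
Proof.
  intros wt01 HA Hc.
  assert (Hb : forall (c : I -> C) z, fbound wt k c -> fbound wt k (fun p => c p * cexp (a p * z))%C).
  { intros c' z [M [M0 HM]]; exists (M * exp (A * Cmod z)).
    split; [apply Rmult_le_pos; auto; left; apply exp_pos|]; intros p.
    rewrite Cmod_mult, Cmod_cexp.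
    replace (M * exp (A * Cmod z) * wt p ^ k) with (M * wt p ^ k * exp (A * Cmod z)) by ring.
    apply Rmult_le_compat; auto; [apply Cmod_ge_0|left; apply exp_pos|].
    assert (fst (a p * z)%C <= A * Cmod z).
    { eapply Rle_trans; [apply Rle_abs|]; eapply Rle_trans; [apply Rabs_fst_le|].
      rewrite Cmod_mult; apply Rmult_le_compat_r; auto; apply Cmod_ge_0. }
    destruct H as [H|H]; [left; apply exp_increasing; auto|rewrite H; right; auto]. }
  revert c Hc; induction n; intros c Hc; split; auto.
  exists (fun p z => (a p * c p) * cexp (a p * z))%C; split.
  - intros z _; destruct (Hb c z Hc) as [M [M0 HM]].
    exists (1 / (2 * (Rmax A 0 + 1))), (M * 12 * Rmax A 0 ^ 2).
    pose proof (Rmax_r A 0); pose proof (Rmax_l A 0).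
    split; [apply Rdiv_lt_0_compat; lra|].
    split; [repeat apply Rmult_le_pos; try lra; apply pow2_ge_0|].
    intros h Hh p.
    assert (Hah : Cmod (a p * h) <= Rmax A 0 * Cmod h).
    { rewrite Cmod_mult; apply Rmult_le_compat_r; [apply Cmod_ge_0|].
      eapply Rle_trans; [apply HA|auto]. }
    assert (Hah' : Cmod (a p * h) <= 1 / 2).
    { eapply Rle_trans; [apply Hah|].
      apply Rmult_lt_compat_l with (r := Rmax A 0 + 1) in Hh; [|lra].
      replace ((Rmax A 0 + 1) * (1 / (2 * (Rmax A 0 + 1)))) with (1 / 2) in Hh by (field; lra).
      pose proof (Cmod_ge_0 h); lra. }
    replace (c p * cexp (a p * (z + h)) - c p * cexp (a p * z) - h * (a p * c p * cexp (a p * z)))%C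
      with (c p * cexp (a p * z) * (cexp (a p * h) - 1 - a p * h))%C.
    2:{ replace (a p * (z + h))%C with (a p * z + a p * h)%C by ring; rewrite cexp_add; ring. }
    rewrite Cmod_mult.
    replace (M * 12 * Rmax A 0 ^ 2 * Cmod h ^ 2 * wt p ^ k)
      with ((M * wt p ^ k) * (12 * (Rmax A 0 * Cmod h) ^ 2)) by ring.
    apply Rmult_le_compat; auto using Cmod_ge_0.
    eapply Rle_trans; [apply cexp_quadratic; auto|].
    apply Rmult_le_compat_l; [lra|].
    apply pow_incr; split; auto; apply Cmod_ge_0.
  - apply IHn.
    apply (fbound_mul wt 0 k a c); auto; apply fbound_0 with A; auto.
Qed.

(** * Doubly periodic functions *)

Definition grid (tau : C) (x y : R) : C := (RtoC x + RtoC y * tau)%C.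

Lemma grid_small tau x y a b d : 0 < d ->
  Rabs (a - x) < d / (2 * (Cmod tau + 1)) -> Rabs (b - y) < d / (2 * (Cmod tau + 1)) ->
  Cmod (grid tau a b - grid tau x y) < d.
Proof.
  intros d0 H1 H2; pose proof (Cmod_ge_0 tau) as t0.
  replace (grid tau a b - grid tau x y)%C with (RtoC (a - x) + RtoC (b - y) * tau)%C
    by (unfold grid; rewrite !RtoC_minus; ring).
  eapply Rle_lt_trans; [apply Cmod_triangle|].
  rewrite Cmod_mult, !Cmod_R.
  set (q := d / (2 * (Cmod tau + 1))) in *.
  assert (q * (Cmod tau + 1) = d / 2) by (unfold q; field; lra).
  pose proof (Rabs_pos (b - y)); nra.
Qed.

Lemma cder_cont2d_fst f tau x y l : cder f (grid tau x y) l ->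
  continuity_2d_pt (fun a b => fst (f (grid tau a b))) x y.
Proof.
  intros H eps; destruct (cder_lipschitz _ _ _ H) as (d & M & d0 & M0 & HM).
  set (e := Rmin d (eps / (M + 1))).
  assert (e0 : 0 < e) by (apply Rmin_pos; auto; apply Rdiv_lt_0_compat; [apply cond_pos|lra]).
  pose proof (Cmod_ge_0 tau) as t0.
  assert (q0 : 0 < e / (2 * (Cmod tau + 1))) by (apply Rdiv_lt_0_compat; lra).
  exists (mkposreal _ q0); simpl; intros a b Ha Hb.
  pose proof (grid_small tau x y a b e e0 Ha Hb) as Hs.
  set (h := (grid tau a b - grid tau x y)%C) in *.
  replace (grid tau a b) with (grid tau x y + h)%C by (unfold h; ring).
  assert (Hd : Cmod h < d) by (eapply Rlt_le_trans; [apply Hs|apply Rmin_l]).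
  assert (He : Cmod h < eps / (M + 1)) by (eapply Rlt_le_trans; [apply Hs|apply Rmin_r]).
  specialize (HM h Hd).
  replace (fst (f (grid tau x y + h)%C) - fst (f (grid tau x y)))
    with (fst (f (grid tau x y + h) - f (grid tau x y))%C) by (simpl; ring).
  eapply Rle_lt_trans; [apply Rabs_fst_le|]; eapply Rle_lt_trans; [apply HM|].
  apply Rmult_lt_compat_l with (r := M + 1) in He; [|lra].
  replace ((M + 1) * (eps / (M + 1))) with (pos eps) in He by (field; lra).
  pose proof (Cmod_ge_0 h); lra.
Qed.

Lemma cder_cont2d_snd f tau x y l : cder f (grid tau x y) l ->
  continuity_2d_pt (fun a b => snd (f (grid tau a b))) x y.
Proof.
  intros H; apply (cder_scal (- Ci)%C), (cder_cont2d_fst _ tau) in H.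
  eapply continuity_2d_pt_ext; [|apply H]; intros; simpl; ring.
Qed.

Lemma cder_grid_x_fst f tau x y l : cder f (grid tau x y) l ->
  is_derive (fun t : R => fst (f (grid tau t y))) x (fst l).
Proof.
  intros H; pose proof (cder_line_fst f (RtoC y * tau)%C 1%C x l) as Hl.
  replace (fst l) with (fst (1 * l)%C) by (simpl; ring).
  eapply is_derive_ext; [|apply Hl].
  - intros t; simpl; f_equal; f_equal; unfold grid; ring.
  - replace (RtoC y * tau + RtoC x * 1)%C with (grid tau x y) by (unfold grid; ring); auto.
Qed.

Lemma cder_grid_x_snd f tau x y l : cder f (grid tau x y) l ->
  is_derive (fun t : R => snd (f (grid tau t y))) x (snd l).
Proof.
  intros H; pose proof (cder_line_snd f (RtoC y * tau)%C 1%C x l) as Hl.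
  replace (snd l) with (snd (1 * l)%C) by (simpl; ring).
  eapply is_derive_ext; [|apply Hl].
  - intros t; simpl; f_equal; f_equal; unfold grid; ring.
  - replace (RtoC y * tau + RtoC x * 1)%C with (grid tau x y) by (unfold grid; ring); auto.
Qed.

Lemma cder_grid_y_fst f tau x y l : cder f (grid tau x y) l ->
  is_derive (fun t : R => fst (f (grid tau x t))) y (fst (tau * l)%C).
Proof. apply (cder_line_fst f (RtoC x) tau y l). Qed.

Lemma cder_grid_y_snd f tau x y l : cder f (grid tau x y) l ->
  is_derive (fun t : R => snd (f (grid tau x t))) y (snd (tau * l)%C).
Proof. apply (cder_line_snd f (RtoC x) tau y l). Qed.

Lemma grid_shift1 tau x y : grid tau (x + 1) y = (grid tau x y + 1)%C.
Proof. unfold grid; rewrite RtoC_plus; ring. Qed.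

Lemma grid_shift2 tau x y : grid tau x (y + 1) = (grid tau x y + tau)%C.
Proof. unfold grid; rewrite RtoC_plus; ring. Qed.

Lemma grid_onto tau z : snd tau <> 0 -> exists x y, z = grid tau x y.
Proof.
  intros H; exists (fst z - snd z / snd tau * fst tau), (snd z / snd tau).
  unfold grid; apply injective_projections; simpl; field; auto.
Qed.

Lemma zero_derivative_line (g : R -> R) : (forall t, 0 <= t <= 1 -> is_derive g t 0) -> g 1 = g 0.
Proof.
  intros H; destruct (MVT_gen g 0 1 (fun _ => 0)) as [c [_ Hc]].
  - intros x Hx; rewrite Rmin_left, Rmax_right in Hx by lra; apply H; lra.
  - intros x Hx; rewrite Rmin_left, Rmax_right in Hx by lra.
    apply derivable_continuous_pt; eexists; apply is_derive_Reals, H; lra.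
  - lra.
Qed.

Lemma zero_derivative_segment f a b :
  (forall t : R, 0 <= t <= 1 -> cder f (a + RtoC t * (b - a))%C 0%C) -> f b = f a.
Proof.
  intros H.
  assert (E1 : (a + RtoC 1 * (b - a))%C = b) by ring.
  assert (E0 : (a + RtoC 0 * (b - a))%C = a) by ring.
  enough (E : f (a + RtoC 1 * (b - a))%C = f (a + RtoC 0 * (b - a))%C) by (rewrite E0, E1 in E; auto).
  apply injective_projections.
  - apply (zero_derivative_line (fun t => fst (f (a + RtoC t * (b - a))%C))); intros t Ht.
    replace 0 with (fst ((b - a) * 0)%C) by (simpl; ring); apply cder_line_fst; auto.
  - apply (zero_derivative_line (fun t => snd (f (a + RtoC t * (b - a))%C))); intros t Ht.
    replace 0 with (snd ((b - a) * 0)%C) by (simpl; ring); apply cder_line_snd; auto.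
Qed.

(** Both pieces of the integral are nonnegative, so the integral from 0 to y vanishes for every y;
    its derivative in y is [g]. *)
Lemma nonneg_integral_zero (g : R -> R) :
  (forall x, continuous g x) -> (forall x, 0 <= g x) -> RInt g 0 1 = 0 ->
  forall x, 0 < x < 1 -> g x = 0.
Proof.
  intros Hc H0 HI x Hx.
  assert (ex : forall a b, ex_RInt g a b).
  { intros; apply (@ex_RInt_continuous R_CompleteNormedModule); auto. }
  assert (HG : forall y, 0 <= y <= 1 -> RInt g 0 y = 0).
  { intros y Hy.
    assert (0 <= RInt g 0 y) by (apply RInt_ge_0; auto; lra).
    assert (0 <= RInt g y 1) by (apply RInt_ge_0; auto; lra).
    pose proof (RInt_Chasles g 0 y 1 (ex 0 y) (ex y 1)) as E; rewrite HI in E.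
    unfold plus in E; simpl in E; lra. }
  assert (D1 : is_derive (fun y => RInt g 0 y) x (g x)).
  { apply (is_derive_RInt g (fun y => RInt g 0 y) 0 x).
    - exists (mkposreal 1 Rlt_0_1); intros; apply (@RInt_correct R_CompleteNormedModule); auto.
    - auto. }
  assert (D2 : is_derive (fun y => RInt g 0 y) x 0).
  { apply is_derive_ext_loc with (fun _ => 0).
    - assert (e0 : 0 < Rmin x (1 - x)) by (apply Rmin_pos; lra).
      exists (mkposreal _ e0); intros y Hy; symmetry; apply HG.
      unfold ball in Hy; simpl in Hy; unfold AbsRing_ball, abs, minus, plus, opp in Hy; simpl in Hy.
      pose proof (Rmin_l x (1 - x)); pose proof (Rmin_r x (1 - x)).
      apply Rabs_def2 in Hy; lra.
    - apply @is_derive_const. }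
  rewrite <- (is_derive_unique _ _ _ D1); apply is_derive_unique; auto.
Qed.

Lemma continuity_2d_section g x y :
  continuity_2d_pt g x y -> continuous (fun t => g t y) x.
Proof.
  intros H; apply continuity_pt_filterlim.
  intros e He; destruct (H (mkposreal e He)) as [d Hd]; simpl in Hd.
  exists d; split; [apply cond_pos|]; intros t [_ Ht]; simpl in *.
  unfold Rdist in *; apply Hd; auto.
  rewrite Rminus_diag, Rabs_R0; apply cond_pos.
Qed.

(* Energy argument: [int_0^1 Im (f' conj f) dx] along the line of height [y] has derivative
   [-2 Im tau int_0^1 |f'|^2 dx], while it is periodic in [y]. *)
Lemma periodic_derivative_zero_mid tau f f1 f2 f3 :
  0 < snd tau ->
  (forall z, cder f z (f1 z)) -> (forall z, cder f1 z (f2 z)) -> (forall z, cder f2 z (f3 z)) ->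
  (forall z, f (z + 1)%C = f z) -> (forall z, f (z + tau)%C = f z) ->
  f1 (grid tau (1 / 2) 0) = 0%C.
Proof.
  intros Ht D0 D1 D2 P1 P2.
  assert (P1' : forall z, f1 (z + 1)%C = f1 z).
  { intros z; apply (cder_unique f z); auto.
    pose proof (cder_affine 1 1 f z (f1 (z + 1)%C)) as H.
    apply (cder_eq _ _ (1 * f1 (z + 1)%C)%C); [ring|].
    eapply cder_ext_loc; [apply Rlt_0_1| |apply H].
    - intros h _; simpl; rewrite <- (P1 (z + h)%C); f_equal; ring.
    - replace (1 * z + 1)%C with (z + 1)%C by ring; auto. }
  assert (P2' : forall z, f1 (z + tau)%C = f1 z).
  { intros z; apply (cder_unique f z); auto.
    pose proof (cder_affine 1 tau f z (f1 (z + tau)%C)) as H.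
    apply (cder_eq _ _ (1 * f1 (z + tau)%C)%C); [ring|].
    eapply cder_ext_loc; [apply Rlt_0_1| |apply H].
    - intros h _; simpl; rewrite <- (P2 (z + h)%C); f_equal; ring.
    - replace (1 * z + tau)%C with (z + tau)%C by ring; auto. }
  set (H := fun y x => snd (f1 (grid tau x y)) * fst (f (grid tau x y))
                       - fst (f1 (grid tau x y)) * snd (f (grid tau x y))).
  set (Hy := fun y x => snd (tau * f2 (grid tau x y))%C * fst (f (grid tau x y))
                        + snd (f1 (grid tau x y)) * fst (tau * f1 (grid tau x y))%C
                        - (fst (tau * f2 (grid tau x y))%C * snd (f (grid tau x y))
                           + fst (f1 (grid tau x y)) * snd (tau * f1 (grid tau x y))%C)).
  (* With H = Im (f' conj f) and K = Im (tau f' conj f), one has dK/dx = dH/dy + 2 Im(tau) |f'|^2.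
     As K is 1-periodic in x, integrating over a period leaves only the energy term in the
     derivative of [J]. *)
  set (K := fun y x => snd (tau * f1 (grid tau x y))%C * fst (f (grid tau x y))
                       - fst (tau * f1 (grid tau x y))%C * snd (f (grid tau x y))).
  set (E := fun y x => fst (f1 (grid tau x y)) ^ 2 + snd (f1 (grid tau x y)) ^ 2).
  set (Kx := fun y x => Hy y x + 2 * snd tau * E y x).
  assert (DH : forall y x, is_derive (fun u => H u x) y (Hy y x)).
  { intros y x; unfold H, Hy.
    apply @is_derive_minus; apply @is_derive_mult; try apply Rmult_comm;
      (apply cder_grid_y_fst || apply cder_grid_y_snd); auto. }
  assert (DK : forall y x, is_derive (K y) x (Kx y x)).
  { intros y x; unfold K.
    pose proof (cder_scal tau _ _ _ (D1 (grid tau x y))) as D1'.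
    assert (Q : is_derive (K y) x
      (plus (mult (snd (tau * f2 (grid tau x y))%C) (fst (f (grid tau x y))))
            (mult (snd (tau * f1 (grid tau x y))%C) (fst (f1 (grid tau x y))))
       - plus (mult (fst (tau * f2 (grid tau x y))%C) (snd (f (grid tau x y))))
            (mult (fst (tau * f1 (grid tau x y))%C) (snd (f1 (grid tau x y)))))).
    { unfold K; apply @is_derive_minus; apply @is_derive_mult; try apply Rmult_comm.
      - apply (cder_grid_x_snd (fun z => tau * f1 z)%C); auto.
      - apply cder_grid_x_fst; auto.
      - apply (cder_grid_x_fst (fun z => tau * f1 z)%C); auto.
      - apply cder_grid_x_snd; auto. }
    replace (Kx y x) with
      (plus (mult (snd (tau * f2 (grid tau x y))%C) (fst (f (grid tau x y))))
            (mult (snd (tau * f1 (grid tau x y))%C) (fst (f1 (grid tau x y))))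
       - plus (mult (fst (tau * f2 (grid tau x y))%C) (snd (f (grid tau x y))))
            (mult (fst (tau * f1 (grid tau x y))%C) (snd (f1 (grid tau x y)))));
      [exact Q|].
    unfold Kx, Hy, E, plus, mult; simpl; ring. }
  assert (CHy : forall y x, continuity_2d_pt (fun u v => Hy u v) y x).
  { intros y x.
    assert (S : continuity_2d_pt (fun a b => Hy b a) x y).
    { pose proof (cder_scal tau _ _ _ (D2 (grid tau x y))) as D2'.
      pose proof (cder_scal tau _ _ _ (D1 (grid tau x y))) as D1'.
      unfold Hy; apply continuity_2d_pt_minus; apply continuity_2d_pt_plus; apply continuity_2d_pt_mult.
      - apply (cder_cont2d_snd (fun z => tau * f2 z)%C _ _ _ _ D2').
      - eapply cder_cont2d_fst; auto.
      - eapply cder_cont2d_snd; auto.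
      - apply (cder_cont2d_fst (fun z => tau * f1 z)%C _ _ _ _ D1').
      - apply (cder_cont2d_fst (fun z => tau * f2 z)%C _ _ _ _ D2').
      - eapply cder_cont2d_snd; auto.
      - eapply cder_cont2d_fst; auto.
      - apply (cder_cont2d_snd (fun z => tau * f1 z)%C _ _ _ _ D1'). }
    intros e; destruct (S e) as [d Hd]; exists d; intros; apply Hd; auto. }
  assert (CH : forall y x, continuous (H y) x).
  { intros y x; apply (continuity_2d_section (fun a b => H b a)).
    unfold H; apply continuity_2d_pt_minus; apply continuity_2d_pt_mult;
      (eapply cder_cont2d_snd || eapply cder_cont2d_fst); auto. }
  assert (CE : forall y x, continuous (E y) x).
  { intros y x; apply (continuity_2d_section (fun a b => E b a)).
    unfold E; simpl; apply continuity_2d_pt_plus; repeat apply continuity_2d_pt_mult;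
      try apply continuity_2d_pt_const;
      (eapply cder_cont2d_snd || eapply cder_cont2d_fst); auto. }
  assert (CHx : forall y x, continuous (Hy y) x).
  { intros y x; apply (continuity_2d_section (fun a b => Hy b a)).
    intros e; destruct (CHy y x e) as [d Hd]; exists d; intros; apply Hd; auto. }
  set (J := fun y => RInt (H y) 0 1).
  assert (DJ : forall y, is_derive J y (- (2 * snd tau) * RInt (E y) 0 1)).
  { intros y.
    assert (Q : is_derive J y (RInt (fun x => Derive (fun u => H u x) y) 0 1)).
    { apply is_derive_RInt_param.
      - exists (mkposreal 1 Rlt_0_1); intros u _ t _; eexists; apply DH.
      - intros t _; eapply continuity_2d_pt_ext; [|apply CHy].
        intros u v; symmetry; apply is_derive_unique, DH.
      - exists (mkposreal 1 Rlt_0_1); intros u _; apply (@ex_RInt_continuous R_CompleteNormedModule); auto. }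
    replace (- (2 * snd tau) * RInt (E y) 0 1) with (RInt (fun x => Derive (fun u => H u x) y) 0 1);
      auto.
    rewrite (RInt_ext _ (fun x => Kx y x + - (2 * snd tau) * E y x)).
    2:{ intros x _; transitivity (Hy y x); [apply is_derive_unique, DH|]; unfold Kx; change (Hy y x = Hy y x + 2 * snd tau * E y x + - (2 * snd tau) * E y x); ring. }
    assert (CKx : forall x, continuous (Kx y) x).
    { intros x; apply (continuous_plus (Hy y) (fun x => 2 * snd tau * E y x)); auto.
      apply (continuous_mult (fun _ => 2 * snd tau)); auto; apply continuous_const. }
    assert (IK : is_RInt (Kx y) 0 1 (K y 1 - K y 0)).
    { apply (is_RInt_derive (K y) (Kx y)); auto. }
    assert (K10 : K y 1 - K y 0 = 0).
    { unfold K; replace 1 with (0 + 1) by ring; rewrite grid_shift1, P1, P1'; ring. }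
    rewrite K10 in IK.
    assert (IE : is_RInt (fun x => - (2 * snd tau) * E y x) 0 1 (- (2 * snd tau) * RInt (E y) 0 1)).
    { apply (is_RInt_scal (E y)), (@RInt_correct R_CompleteNormedModule),
        (@ex_RInt_continuous R_CompleteNormedModule); auto. }
    pose proof (is_RInt_plus _ _ _ _ _ _ IK IE) as IS.
    apply (@is_RInt_unique R_CompleteNormedModule) in IS.
    replace (- (2 * snd tau) * RInt (E y) 0 1) with (plus 0 (- (2 * snd tau) * RInt (E y) 0 1))
      by (unfold plus; simpl; ring).
    exact IS. }
  assert (E0 : forall y, 0 <= RInt (E y) 0 1).
  { intros y; apply RInt_ge_0; [lra| |].
    - apply (@ex_RInt_continuous R_CompleteNormedModule); auto.
    - intros; unfold E; nra. }
  assert (JP : forall y, J (y + 1) = J y).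
  { intros y; unfold J; apply RInt_ext; intros x _; unfold H.
    rewrite grid_shift2, P2, P2'; auto. }
  assert (JM : forall a b, a <= b -> J b <= J a).
  { intros a b Hab; destruct (MVT_gen J a b (fun y => - (2 * snd tau) * RInt (E y) 0 1)) as [c [_ Hc]].
    - intros; apply DJ.
    - intros; apply derivable_continuous_pt; eexists; apply is_derive_Reals, DJ.
    - specialize (E0 c); assert (0 <= 2 * snd tau * RInt (E c) 0 1 * (b - a)); [|lra].
      repeat apply Rmult_le_pos; lra. }
  assert (JC : forall a b, J a = J b).
  { assert (JC1 : forall a b, a <= b -> J a = J b).
    { intros a b Hab; apply Rle_antisym; [|apply JM; auto].
      assert (JN : forall n, J (a + INR n) = J a).
      { induction n; [rewrite Rplus_0_r; auto|]; rewrite S_INR, <- Rplus_assoc, JP; auto. }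
      destruct (INR_unbounded (b - a)) as [n Hn].
      rewrite <- (JN n); apply JM; lra. }
    intros a b; destruct (Rle_dec a b); [auto|symmetry; apply JC1; lra]. }
  assert (EZ : forall y, RInt (E y) 0 1 = 0).
  { intros y.
    assert (is_derive J y 0).
    { eapply is_derive_ext; [intros t; apply (JC y t)|apply @is_derive_const]. }
    pose proof (is_derive_unique _ _ _ (DJ y)) as U1.
    rewrite (is_derive_unique _ _ _ H0) in U1.
    symmetry in U1; apply Rmult_integral in U1; destruct U1; auto; lra. }
  pose proof (nonneg_integral_zero (E 0) (CE 0) ltac:(intros; unfold E; nra) (EZ 0) (1 / 2) ltac:(lra)) as Z.
  unfold E in Z; apply injective_projections; simpl; nra.
Qed.

(** Translating [f] moves any point to the middle of the unit segment, where the energy argument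
    gives a zero derivative; a function with zero derivative is constant along segments. Three
    derivatives are what the energy argument consumes. *)
Lemma doubly_periodic_constant tau f :
  0 < snd tau -> Diff (fun _ => True) 3 f ->
  (forall z, f (z + 1)%C = f z) -> (forall z, f (z + tau)%C = f z) ->
  forall z, f z = f 0%C.
Proof.
  intros Ht HD P1 P2 z.
  apply Diff_S in HD; destruct HD as [f1 [D0 HD]].
  apply Diff_S in HD; destruct HD as [f2 [D1 HD]].
  apply Diff_S in HD; destruct HD as [f3 [D2 _]].
  assert (Z : forall z, f1 z = 0%C).
  { intros a.
    assert (T : forall (g g' : C -> C) b, (forall z, True -> cder g z (g' z)) ->
              forall z, cder (fun z => g (z + b)%C) z (g' (z + b)%C)).
    { intros g g' b Hg y; apply (cder_eq _ _ (1 * g' (1 * y + b)%C)%C).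
      - replace (1 * y + b)%C with (y + b)%C by ring; ring.
      - eapply cder_ext_loc; [apply Rlt_0_1| |apply cder_affine, Hg; auto].
        intros h _; simpl; f_equal; ring. }
    set (b := (a - grid tau (1 / 2) 0)%C).
    replace a with (grid tau (1 / 2) 0 + b)%C by (unfold b; ring).
    apply (periodic_derivative_zero_mid tau (fun z => f (z + b)%C) (fun z => f1 (z + b)%C)
      (fun z => f2 (z + b)%C) (fun z => f3 (z + b)%C)); auto.
    - intros y; rewrite <- (P1 (y + b)%C); f_equal; ring.
    - intros y; rewrite <- (P2 (y + b)%C); f_equal; ring. }
  apply (zero_derivative_segment f 0%C z); intros t _.
  pose proof (D0 (0 + RtoC t * (z - 0))%C I) as H; rewrite Z in H; auto.
Qed.

(** * Lattice points, distance estimates and quasi-periodic functions *)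

Definition lattice (tau z : C) : Prop := exists m n : Z, z = grid tau (IZR m) (IZR n).

Lemma grid_lower tau : 0 < snd tau ->
  exists c, 0 < c /\ forall x y, c * (Rabs x + Rabs y) <= Cmod (grid tau x y).
Proof.
  intros Ht; pose proof (Cmod_ge_0 tau) as T0.
  set (B := 1 + (1 + Cmod tau) / snd tau).
  assert (B0 : 0 < B).
  { unfold B; assert (0 < (1 + Cmod tau) / snd tau); [apply Rdiv_lt_0_compat; lra|lra]. }
  exists (/ B); split; [apply Rinv_0_lt_compat; auto|]; intros x y.
  set (n := Cmod (grid tau x y)).
  assert (Hy : Rabs y <= n / snd tau).
  { pose proof (Rabs_snd_le (grid tau x y)) as H; fold n in H.
    replace (snd (grid tau x y)) with (y * snd tau) in H by (unfold grid; simpl; ring).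
    rewrite Rabs_mult, (Rabs_pos_eq (snd tau)) in H by lra.
    apply Rmult_le_reg_r with (snd tau); auto; unfold Rdiv; rewrite Rmult_assoc, Rinv_l by lra; lra. }
  assert (Hx : Rabs x <= n + Rabs y * Cmod tau).
  { rewrite <- (Cmod_R x), <- (Cmod_R y), <- Cmod_mult.
    replace (RtoC x) with (grid tau x y + - (RtoC y * tau))%C at 1 by (unfold grid; ring).
    eapply Rle_trans; [apply Cmod_triangle|]; rewrite Cmod_opp; fold n; lra. }
  apply Rmult_le_reg_l with B; auto; rewrite <- Rmult_assoc, Rinv_r, Rmult_1_l by lra.
  assert (Rabs y * (1 + Cmod tau) <= n / snd tau * (1 + Cmod tau)) by (apply Rmult_le_compat_r; lra).
  unfold B; replace ((1 + (1 + Cmod tau) / snd tau) * n) with (n + n / snd tau * (1 + Cmod tau))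
    by (field; lra).
  lra.
Qed.

Lemma grid_inj tau x y x' y' : 0 < snd tau -> grid tau x y = grid tau x' y' -> x = x' /\ y = y'.
Proof.
  intros Ht E; unfold grid in E; apply (f_equal snd) in E as E2; apply (f_equal fst) in E; simpl in *.
  assert (y = y') by nra; subst; split; auto; nra.
Qed.

Lemma grid_add tau x y x' y' : grid tau (x + x') (y + y') = (grid tau x y + grid tau x' y')%C.
Proof. unfold grid; rewrite !RtoC_plus; ring. Qed.

Lemma grid_opp tau x y : grid tau (- x) (- y) = (- grid tau x y)%C.
Proof. unfold grid; rewrite !RtoC_opp; ring. Qed.

Lemma lattice_add tau z w : lattice tau z -> lattice tau w -> lattice tau (z + w)%C.
Proof.
  intros (m & n & ->) (m' & n' & ->); exists (m + m')%Z, (n + n')%Z.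
  rewrite !plus_IZR, grid_add; auto.
Qed.

Lemma lattice_opp tau z : lattice tau z -> lattice tau (- z)%C.
Proof.
  intros (m & n & ->); exists (- m)%Z, (- n)%Z; rewrite !opp_IZR, grid_opp; auto.
Qed.

Lemma lattice_0 tau : lattice tau 0%C.
Proof. exists 0%Z, 0%Z; unfold grid; ring. Qed.

Lemma lattice_1 tau : lattice tau 1%C.
Proof. exists 1%Z, 0%Z; unfold grid; ring. Qed.

Lemma lattice_tau tau : lattice tau tau.
Proof. exists 0%Z, 1%Z; unfold grid; ring. Qed.

Lemma not_lattice_add tau z w : lattice tau w -> ~ lattice tau z -> ~ lattice tau (z + w)%C.
Proof.
  intros Hw Hz H; apply Hz; replace z with (z + w + - w)%C by ring.
  apply lattice_add; auto; apply lattice_opp; auto.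
Qed.

Lemma not_lattice_opp tau z : ~ lattice tau z -> ~ lattice tau (- z)%C.
Proof. intros Hz H; apply Hz; replace z with (- - z)%C by ring; apply lattice_opp; auto. Qed.

Lemma not_lattice_sub tau z w : lattice tau w -> ~ lattice tau z -> ~ lattice tau (z - w)%C.
Proof. intros; apply not_lattice_add; auto; apply lattice_opp; auto. Qed.

Lemma dist_to_Z x : (forall m : Z, x <> IZR m) ->
  exists d, 0 < d /\ forall m : Z, d <= Rabs (x - IZR m).
Proof.
  intros H; destruct (archimed x) as [H1 H2]; set (k := up x) in *.
  exists (Rmin (IZR k - x) (x - IZR (k - 1))); split.
  - apply Rmin_pos; [lra|].
    rewrite minus_IZR; specialize (H (k - 1)%Z); rewrite minus_IZR in H; lra.
  - intros m; destruct (Z.le_gt_cases k m) as [Hm|Hm].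
    + apply IZR_le in Hm; rewrite Rabs_left1 by lra.
      pose proof (Rmin_l (IZR k - x) (x - IZR (k - 1))); lra.
    + assert (Hm' : (m <= k - 1)%Z) by lia; apply IZR_le in Hm'.
      rewrite minus_IZR in Hm' |- *; rewrite Rabs_pos_eq by lra.
      pose proof (Rmin_r (IZR k - x) (x - (IZR k - 1))); lra.
Qed.

(** Far lattice points recede linearly in |m| + |n|. Near ones keep a fixed distance, because at
    least one of the real coordinates of [z] is not an integer and so stays away from all
    integers. *)
Lemma lattice_dist_lower tau z : 0 < snd tau -> ~ lattice tau z ->
  exists c, 0 < c /\ forall m n : Z,
    c * (1 + Rabs (IZR m) + Rabs (IZR n)) <= Cmod (z - grid tau (IZR m) (IZR n)).
Proof.
  intros Ht Hz; destruct (grid_lower tau Ht) as [c [c0 Hc]].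
  destruct (grid_onto tau z) as [x [y ->]]; [lra|].
  set (B := Rabs x + Rabs y + 1).
  assert (B0 : 1 <= B) by (unfold B; pose proof (Rabs_pos x); pose proof (Rabs_pos y); lra).
  assert (E : exists e, 0 < e /\ forall m n : Z,
    e * (1 + Rabs (IZR m) + Rabs (IZR n)) <= Rabs (x - IZR m) + Rabs (y - IZR n)).
  { assert (G : forall d, 0 < d -> (forall m n : Z, d <= Rabs (x - IZR m) + Rabs (y - IZR n)) ->
      exists e, 0 < e /\ forall m n : Z,
      e * (1 + Rabs (IZR m) + Rabs (IZR n)) <= Rabs (x - IZR m) + Rabs (y - IZR n)).
    { intros d d0 Hd.
      assert (r0 : 0 < Rmin d 1) by (apply Rmin_pos; lra).
      pose proof (Rmin_l d 1); pose proof (Rmin_r d 1).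
      set (r := Rmin d 1) in *.
      exists (r / (2 * B + 2)); split; [apply Rdiv_lt_0_compat; lra|]; intros m n.
      specialize (Hd m n).
      apply Rmult_le_reg_l with (2 * B + 2); [lra|].
      replace ((2 * B + 2) * (r / (2 * B + 2) * (1 + Rabs (IZR m) + Rabs (IZR n))))
        with (r * (1 + Rabs (IZR m) + Rabs (IZR n))) by (field; lra).
      assert (Rabs (IZR m) - Rabs x <= Rabs (x - IZR m))
        by (rewrite Rabs_minus_sym; apply Rabs_triang_inv).
      assert (Rabs (IZR n) - Rabs y <= Rabs (y - IZR n))
        by (rewrite Rabs_minus_sym; apply Rabs_triang_inv).
      pose proof (Rabs_pos (IZR m)); pose proof (Rabs_pos (IZR n)).
      set (s := Rabs (IZR m) + Rabs (IZR n)) in *.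
      set (D := Rabs (x - IZR m) + Rabs (y - IZR n)) in *.
      assert (s - B <= D) by (unfold s, D, B; lra).
      replace (1 + Rabs (IZR m) + Rabs (IZR n)) with (1 + s) by (unfold s; ring).
      assert (0 <= s) by (unfold s; lra).
      (* For s <= 2B + 1 the fixed gap suffices; beyond that, s - B is at least (1 + s) / 2. *)
      destruct (Rle_dec s (2 * B + 1)); nra. }
    destruct (excluded_middle_informative (exists m : Z, x = IZR m)) as [[m Hm]|Hm].
    - destruct (dist_to_Z y) as [d [d0 Hd]].
      { intros n Hn; apply Hz; exists m, n; subst; auto. }
      apply (G d); auto; intros k n; specialize (Hd n); pose proof (Rabs_pos (x - IZR k)); lra.
    - destruct (dist_to_Z x) as [d [d0 Hd]].
      { intros n Hn; apply Hm; exists n; auto. }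
      apply (G d); auto; intros k n; specialize (Hd k); pose proof (Rabs_pos (y - IZR n)); lra. }
  destruct E as [e [e0 He]].
  exists (c * e); split; [apply Rmult_lt_0_compat; auto|]; intros m n.
  replace (grid tau x y - grid tau (IZR m) (IZR n))%C with (grid tau (x - IZR m) (y - IZR n))
    by (unfold grid; rewrite !RtoC_minus; ring).
  eapply Rle_trans; [|apply Hc]; rewrite Rmult_assoc; apply Rmult_le_compat_l; auto; lra.
Qed.

Lemma lattice_separated tau : 0 < snd tau ->
  exists c, 0 < c /\ forall m n : Z, (m <> 0 \/ n <> 0)%Z ->
    c * (1 + Rabs (IZR m) + Rabs (IZR n)) <= Cmod (grid tau (IZR m) (IZR n)).
Proof.
  intros Ht; destruct (grid_lower tau Ht) as [c [c0 Hc]]; exists (c / 2); split; [lra|].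
  intros m n Hmn; eapply Rle_trans; [|apply Hc].
  assert (HZ : forall k : Z, (k <> 0)%Z -> 1 <= Rabs (IZR k)).
  { intros k Hk; rewrite <- abs_IZR; apply (IZR_le 1); lia. }
  pose proof (Rabs_pos (IZR m)); pose proof (Rabs_pos (IZR n)).
  destruct Hmn as [Hk|Hk]; specialize (HZ _ Hk); nra.
Qed.

Lemma not_lattice_open tau : 0 < snd tau -> Copen (fun z => ~ lattice tau z).
Proof.
  intros Ht z Hz; destruct (lattice_dist_lower tau z Ht Hz) as [c [c0 Hc]].
  exists c; split; auto; intros h Hh (m & n & E).
  specialize (Hc m n); rewrite <- E in Hc.
  replace (z - (z + h))%C with (- h)%C in Hc by ring; rewrite Cmod_opp in Hc.
  pose proof (Rabs_pos (IZR m)); pose proof (Rabs_pos (IZR n)); nra.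
Qed.

Lemma punctured_ball_not_lattice tau : 0 < snd tau ->
  exists d, 0 < d /\ forall z l, lattice tau l -> z <> l -> Cmod (z - l) < d -> ~ lattice tau z.
Proof.
  intros Ht; destruct (lattice_separated tau Ht) as [c [c0 Hc]]; exists c; split; auto.
  intros z l Hl Hzl Hd Hz.
  destruct (lattice_add _ _ _ Hz (lattice_opp _ _ Hl)) as (m & n & E).
  unfold Cminus in Hd; rewrite E in Hd.
  assert (Hmn : (m <> 0 \/ n <> 0)%Z).
  { destruct (Z.eq_dec m 0) as [->|]; auto; destruct (Z.eq_dec n 0) as [->|]; auto.
    exfalso; apply Hzl; replace z with (z + - l + l)%C by ring; rewrite E; unfold grid; ring. }
  specialize (Hc m n Hmn).
  pose proof (Rabs_pos (IZR m)); pose proof (Rabs_pos (IZR n)); nra.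
Qed.

Lemma shift_iterate (D : C -> Prop) (f : C -> C) w c :
  (forall z, D z -> D (z + w)%C /\ D (z - w)%C) ->
  (forall z, D z -> f (z + w)%C = (f z + c)%C) ->
  forall z (m : Z), D z -> D (z + IZR m * w)%C /\ f (z + IZR m * w)%C = (f z + IZR m * c)%C.
Proof.
  intros HD Hf z.
  assert (P : forall m, (0 <= m)%Z -> D z ->
    D (z + IZR m * w)%C /\ f (z + IZR m * w)%C = (f z + IZR m * c)%C).
  { apply (natlike_ind (fun m => D z -> D (z + IZR m * w)%C /\ f (z + IZR m * w)%C = (f z + IZR m * c)%C)).
    - intros Hz; replace (z + 0 * w)%C with z by ring; split; auto; ring.
    - intros m Hm IH Hz; destruct (IH Hz) as [H1 H2].
      unfold Z.succ; rewrite plus_IZR, RtoC_plus.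
      replace (z + (IZR m + 1) * w)%C with (z + IZR m * w + w)%C by ring.
      split; [apply HD; auto|rewrite Hf, H2; auto; ring]. }
  assert (N : forall m, (0 <= m)%Z -> D z ->
    D (z + - IZR m * w)%C /\ f (z + - IZR m * w)%C = (f z + - IZR m * c)%C).
  { apply (natlike_ind (fun m => D z -> D (z + - IZR m * w)%C /\ f (z + - IZR m * w)%C = (f z + - IZR m * c)%C)).
    - intros Hz; replace (z + - 0 * w)%C with z by ring; split; auto; ring.
    - intros m Hm IH Hz; destruct (IH Hz) as [H1 H2].
      unfold Z.succ; rewrite plus_IZR, RtoC_plus.
      replace (z + - (IZR m + 1) * w)%C with (z + - IZR m * w - w)%C by ring.
      destruct (HD _ H1) as [_ H3]; split; auto.
      pose proof (Hf _ H3) as E.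
      replace (z + - IZR m * w - w + w)%C with (z + - IZR m * w)%C in E by ring.
      rewrite H2 in E; replace (f (z + - IZR m * w - w))%C
        with (f (z + - IZR m * w - w) + c - c)%C by ring; rewrite <- E; ring. }
  intros m Hz; destruct (Z.le_gt_cases 0 m); [apply P; auto|].
  destruct (N (- m)%Z) as [H1 H2]; auto; [lia|].
  rewrite opp_IZR, RtoC_opp in H1, H2.
  replace (- - IZR m)%C with (RtoC (IZR m)) in H1, H2 by ring; auto.
Qed.

Lemma quasi_periodic_shift tau (f : C -> C) c1 c2 :
  (forall z, ~ lattice tau z -> f (z + 1)%C = (f z + c1)%C) ->
  (forall z, ~ lattice tau z -> f (z + tau)%C = (f z + c2)%C) ->
  forall z (m n : Z), ~ lattice tau z ->
    f (z + grid tau (IZR m) (IZR n))%C = (f z + IZR m * c1 + IZR n * c2)%C.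
Proof.
  intros H1 H2 z m n Hz.
  destruct (shift_iterate (fun z => ~ lattice tau z) f 1%C c1) with (z := z) (m := m) as [A1 A2]; auto.
  { intros y Hy; split; [apply not_lattice_add|apply not_lattice_sub]; auto using lattice_1. }
  destruct (shift_iterate (fun z => ~ lattice tau z) f tau c2)
    with (z := (z + IZR m * 1)%C) (m := n) as [B1 B2]; auto.
  { intros y Hy; split; [apply not_lattice_add|apply not_lattice_sub]; auto using lattice_tau. }
  unfold grid; replace (z + (IZR m + IZR n * tau))%C with (z + IZR m * 1 + IZR n * tau)%C by ring.
  rewrite B2, A2; auto.
Qed.

Lemma ball_open z d : Copen (fun y => Cmod (y - z) < d).
Proof.
  intros y Hy; exists (d - Cmod (y - z)); split; [lra|]; intros h Hh.
  replace (y + h - z)%C with ((y - z) + h)%C by ring.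
  eapply Rle_lt_trans; [apply Cmod_triangle|]; lra.
Qed.

(** Liouville's theorem in the form used for every identity below. The regular expression [g] near 0
    extends [f] across the lattice by quasi-periodicity; the derivative of the extension is entire
    and doubly periodic, hence constant. Order 4 leaves three derivatives for that derivative. *)
Lemma quasi_periodic_affine tau (f g : C -> C) c1 c2 d :
  0 < snd tau -> 0 < d ->
  Diff (fun z => ~ lattice tau z) 4 f -> Diff (fun z => Cmod z < d) 4 g ->
  (forall z, ~ lattice tau z -> Cmod z < d -> f z = g z) ->
  (forall z, ~ lattice tau z -> f (z + 1)%C = (f z + c1)%C) ->
  (forall z, ~ lattice tau z -> f (z + tau)%C = (f z + c2)%C) ->
  exists b, g 0%C = b /\ forall z, ~ lattice tau z -> f z = (c1 * z + b)%C.
Proof.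
  intros Ht d0 Hf Hg Hfg H1 H2.
  destruct (punctured_ball_not_lattice tau Ht) as [r [r0 Hr]].
  (* At a lattice point the value is forced by quasi-periodicity from [g 0]. The coordinates are
     recovered by [epsilon], and injectivity of [grid] makes them the intended ones. *)
  set (F := fun z => match excluded_middle_informative (lattice tau z) with
    | left H => let m := epsilon (inhabits 0%Z) (fun m => exists n, z = grid tau (IZR m) (IZR n)) in
                let n := epsilon (inhabits 0%Z) (fun n => exists m, z = grid tau (IZR m) (IZR n)) in
                (g 0 + IZR m * c1 + IZR n * c2)%C
    | right _ => f z end).
  assert (Foff : forall z, ~ lattice tau z -> F z = f z).
  { intros z Hz; unfold F; destruct (excluded_middle_informative (lattice tau z)); tauto. }
  assert (Fon : forall m n : Z, F (grid tau (IZR m) (IZR n)) = (g 0 + IZR m * c1 + IZR n * c2)%C).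
  { intros m n; unfold F; destruct (excluded_middle_informative _) as [H|H].
    - cbv zeta.
      assert (Em : epsilon (inhabits 0%Z) (fun m' => exists n', grid tau (IZR m) (IZR n) = grid tau (IZR m') (IZR n')) = m).
      { destruct (epsilon_spec (inhabits 0%Z) (fun m' => exists n', grid tau (IZR m) (IZR n) = grid tau (IZR m') (IZR n')))
          as [n' E]; [eauto|].
        apply grid_inj in E; auto; destruct E as [E _]; apply eq_IZR in E; auto. }
      assert (En : epsilon (inhabits 0%Z) (fun n' => exists m', grid tau (IZR m) (IZR n) = grid tau (IZR m') (IZR n')) = n).
      { destruct (epsilon_spec (inhabits 0%Z) (fun n' => exists m', grid tau (IZR m) (IZR n) = grid tau (IZR m') (IZR n')))
          as [m' E]; [eauto|].
        apply grid_inj in E; auto; destruct E as [_ E]; apply eq_IZR in E; auto. }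
      rewrite Em, En; auto.
    - exfalso; apply H; exists m, n; auto. }
  set (e := Rmin d r).
  assert (e0 : 0 < e) by (apply Rmin_pos; auto).
  assert (Fnear : forall m n y, Cmod (y - grid tau (IZR m) (IZR n)) < e ->
    F y = (g (1 * y + - grid tau (IZR m) (IZR n)) + (IZR m * c1 + IZR n * c2))%C).
  { intros m n y Hy; set (l := grid tau (IZR m) (IZR n)) in *.
    assert (Hl : lattice tau l) by (exists m, n; auto).
    assert (Hyd : Cmod (y - l) < d) by (eapply Rlt_le_trans; [apply Hy|apply Rmin_l]).
    assert (Hyr : Cmod (y - l) < r) by (eapply Rlt_le_trans; [apply Hy|apply Rmin_r]).
    replace (1 * y + - l)%C with (y - l)%C by ring.
    destruct (Ceq_dec y l) as [->|Hne].
    - unfold l at 1; rewrite Fon; replace (l - l)%C with (RtoC 0) by ring; ring.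
    - pose proof (Hr y l Hl Hne Hyr) as Hy'.
      pose proof (not_lattice_sub _ _ _ Hl Hy') as Hyl.
      rewrite Foff, <- Hfg by auto.
      replace y with (y - l + l)%C at 1 by ring; unfold l at 2.
      rewrite (quasi_periodic_shift tau f c1 c2) by auto; ring. }
  assert (FD : Diff (fun _ => True) 4 F).
  { apply Diff_local; intros z _.
    destruct (excluded_middle_informative (lattice tau z)) as [(m & n & E)|Hz].
    - exists e; split; auto.
      apply Diff_ext with (fun y => g (1 * y + - grid tau (IZR m) (IZR n)) + (IZR m * c1 + IZR n * c2))%C.
      + apply ball_open.
      + intros y Hy; symmetry; apply Fnear; rewrite <- E; auto.
      + apply Diff_add; [|apply Diff_const].
        eapply Diff_sub; [|apply Diff_affine, Hg]; simpl; intros y Hy.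
        rewrite <- E; replace (1 * y + - z)%C with (y - z)%C by ring.
        eapply Rlt_le_trans; [apply Hy|apply Rmin_l].
    - destruct (not_lattice_open tau Ht z Hz) as [q [q0 Hq]]; exists q; split; auto.
      assert (Hb : forall y, Cmod (y - z) < q -> ~ lattice tau y).
      { intros y Hy; replace y with (z + (y - z))%C by ring; auto. }
      apply Diff_ext with f; [apply ball_open| |].
      + intros y Hy; symmetry; apply Foff; auto.
      + eapply Diff_sub; [|apply Hf]; auto. }
  assert (F1 : forall z, F (z + 1)%C = (F z + c1)%C).
  { intros z; destruct (excluded_middle_informative (lattice tau z)) as [(m & n & E)|Hz].
    - replace (z + 1)%C with (grid tau (IZR (m + 1)) (IZR n))
        by (rewrite E, plus_IZR, grid_shift1; auto).
      rewrite Fon, E, Fon, plus_IZR, RtoC_plus; ring.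
    - rewrite !Foff; auto; apply not_lattice_add; auto using lattice_1. }
  assert (F2 : forall z, F (z + tau)%C = (F z + c2)%C).
  { intros z; destruct (excluded_middle_informative (lattice tau z)) as [(m & n & E)|Hz].
    - replace (z + tau)%C with (grid tau (IZR m) (IZR (n + 1)))
        by (rewrite E, plus_IZR, grid_shift2; auto).
      rewrite Fon, E, Fon, plus_IZR, RtoC_plus; ring.
    - rewrite !Foff; auto; apply not_lattice_add; auto using lattice_tau. }
  apply Diff_S in FD; destruct FD as [G [HG GD]].
  assert (PG : forall w c, (forall z, F (z + w)%C = (F z + c)%C) -> forall z, G (z + w)%C = G z).
  { intros w c Hw z; apply (cder_unique F z); auto.
    apply (cder_eq _ _ (1 * G (z + w)%C - 0)%C); [ring|].
    eapply cder_ext_loc; [apply Rlt_0_1| |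
      apply (cder_minus (fun y => F (1 * y + w)%C) (fun _ => c)); [apply cder_affine|apply cder_const]].
    - intros h _; simpl; replace (1 * (z + h) + w)%C with (z + h + w)%C by ring.
      rewrite Hw; ring.
    - replace (1 * z + w)%C with (z + w)%C by ring; auto. }
  pose proof (doubly_periodic_constant tau G Ht GD (PG _ _ F1) (PG _ _ F2)) as GC.
  assert (FA : forall z, F z = (G 0 * z + F 0)%C).
  { intros z.
    assert (E : (F z - G 0 * z)%C = (F 0 - G 0 * 0)%C).
    { apply (zero_derivative_segment (fun z => F z - G 0 * z)%C); intros t _.
      apply (cder_eq _ _ (G (0 + RtoC t * (z - 0)) - G 0 * 1)%C); [rewrite GC; ring|].
      apply cder_minus; auto; apply cder_scal, cder_id. }
    replace (F z) with (F z - G 0 * z + G 0 * z)%C by ring; rewrite E; ring. }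
  (* The slope is the increment of the affine function over the period 1. *)
  assert (Gc : G 0%C = c1).
  { pose proof (F1 0%C) as E; rewrite (FA (0 + 1)%C) in E.
    replace (G 0) with (G 0 * (0 + 1) + F 0 - F 0)%C by ring; rewrite E; ring. }
  assert (F00 : F 0%C = g 0%C).
  { replace (RtoC 0) with (grid tau (IZR 0) (IZR 0)) at 1 by (unfold grid; ring).
    rewrite Fon; ring. }
  exists (g 0%C); split; auto; intros z Hz; rewrite <- Foff, FA, Gc, F00; auto.
Qed.

(** * Lattice sums *)

Lemma FD_affine_inv {I} (wt : I -> R) D n (a b : I -> C) A B :
  (forall p, 0 <= wt p <= 1) ->
  (forall p, Cmod (a p) <= A) -> (forall p, Cmod (b p) <= B) ->
  (forall z, D z -> exists c, 0 < c /\ forall p, c <= Cmod (a p * z + b p)) ->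
  FD wt D 0 n (fun p z => / (a p * z + b p))%C.
Proof.
  intros wt01 HA HB Hc; apply FD_inv; auto; apply FD_add; auto.
  - apply (FD_mul wt wt01 D 0 0 n (fun p _ => a p) (fun _ z => z)); [|apply FD_id].
    apply FD_const, fbound_0 with A; auto.
  - apply FD_const, fbound_0 with B; auto.
Qed.

Definition lp (tau : C) (p : Z * Z) : C := grid tau (IZR (fst p)) (IZR (snd p)).

Definition origin (p : Z * Z) : bool := ((fst p =? 0) && (snd p =? 0))%Z%bool.

Lemma origin_true p : origin p = true -> p = (0, 0)%Z.
Proof.
  unfold origin; intros H; apply andb_prop in H; destruct H as [H1 H2].
  apply Z.eqb_eq in H1, H2; destruct p; simpl in *; subst; auto.
Qed.

Lemma origin_false p : origin p = false -> (fst p <> 0 \/ snd p <> 0)%Z.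
Proof.
  unfold origin; intros H; apply Bool.andb_false_iff in H; destruct H as [H|H];
    apply Z.eqb_neq in H; auto.
Qed.

(** Removes the origin exactly as the partial sums of [lat_sum] do, so that both forms agree by
    conversion. *)
Definition guard (f : Z * Z -> C) (p : Z * Z) : C := if origin p then 0%C else f p.

Definition li (tau : C) : Z * Z -> C := guard (fun p => / lp tau p)%C.

Definition lr (tau : C) (p : Z * Z) (z : C) : C := guard (fun p => / (z - lp tau p))%C p.

(** Unlike the complement of the lattice, this set contains 0: it is the natural domain of sums from
    which the term at the origin was removed. *)
Definition offpoles (tau z : C) : Prop := forall p, origin p = false -> z <> lp tau p.

Lemma ZZ_wt_pos p : 0 < ZZ_wt p.
Proof.
  unfold ZZ_wt; pose proof (Rabs_pos (IZR (fst p))); pose proof (Rabs_pos (IZR (snd p))).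
  apply Rinv_0_lt_compat; lra.
Qed.

Lemma ZZ_wt01 p : 0 <= ZZ_wt p <= 1.
Proof. apply exhausting_ZZ. Qed.

Lemma lp_upper tau p : ZZ_wt p * Cmod (lp tau p) <= 1 + Cmod tau.
Proof.
  unfold ZZ_wt, lp, grid.
  pose proof (Rabs_pos (IZR (fst p))); pose proof (Rabs_pos (IZR (snd p))).
  pose proof (Cmod_ge_0 tau).
  assert (Cmod (IZR (fst p) + IZR (snd p) * tau) <= Rabs (IZR (fst p)) + Rabs (IZR (snd p)) * Cmod tau).
  { eapply Rle_trans; [apply Cmod_triangle|]; rewrite Cmod_mult, !Cmod_R; lra. }
  set (s := 1 + Rabs (IZR (fst p)) + Rabs (IZR (snd p))) in *.
  apply Rmult_le_reg_l with s; [unfold s; lra|].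
  rewrite <- Rmult_assoc, Rinv_r, Rmult_1_l by (unfold s; lra).
  unfold s; nra.
Qed.

Lemma offpoles_lattice tau z : offpoles tau z -> ~ lattice tau z \/ z = 0%C.
Proof.
  intros H; destruct (excluded_middle_informative (lattice tau z)) as [(m & n & E)|]; auto.
  right; destruct (origin (m, n)) eqn:Ho.
  - apply origin_true in Ho; injection Ho as -> ->; rewrite E; unfold grid; ring.
  - exfalso; apply (H _ Ho E).
Qed.

Lemma not_lattice_offpoles tau z : ~ lattice tau z -> offpoles tau z.
Proof. intros H [m n] _ E; apply H; exists m, n; auto. Qed.

Lemma offpoles_lower tau z : 0 < snd tau -> offpoles tau z ->
  exists c, 0 < c /\ forall p, origin p = false -> c <= Cmod (ZZ_wt p * (z - lp tau p)).
Proof.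
  intros Ht Hz.
  assert (E : exists c, 0 < c /\ forall p, origin p = false ->
    c * (1 + Rabs (IZR (fst p)) + Rabs (IZR (snd p))) <= Cmod (z - lp tau p)).
  { destruct (offpoles_lattice _ _ Hz) as [H| ->].
    - destruct (lattice_dist_lower tau z Ht H) as [c [c0 Hc]]; exists c; split; auto.
    - destruct (lattice_separated tau Ht) as [c [c0 Hc]]; exists c; split; auto.
      intros p Hp; replace (0 - lp tau p)%C with (- lp tau p)%C by ring; rewrite Cmod_opp.
      apply Hc, origin_false; auto. }
  destruct E as [c [c0 Hc]]; exists c; split; auto; intros p Hp; specialize (Hc p Hp).
  rewrite Cmod_mult, Cmod_R, Rabs_pos_eq by (left; apply ZZ_wt_pos).
  unfold ZZ_wt.
  pose proof (Rabs_pos (IZR (fst p))); pose proof (Rabs_pos (IZR (snd p))).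
  set (s := 1 + Rabs (IZR (fst p)) + Rabs (IZR (snd p))) in *.
  apply Rmult_le_reg_l with s; [unfold s; lra|].
  rewrite <- Rmult_assoc, Rinv_r, Rmult_1_l by (unfold s; lra); lra.
Qed.

Lemma offpoles_open tau : 0 < snd tau -> Copen (offpoles tau).
Proof.
  intros Ht z Hz; destruct (offpoles_lower tau z Ht Hz) as [c [c0 Hc]].
  exists c; split; auto; intros h Hh p Hp E; specialize (Hc p Hp).
  rewrite <- E in Hc; replace (z - (z + h))%C with (- h)%C in Hc by ring.
  rewrite Cmod_mult, Cmod_opp, Cmod_R, Rabs_pos_eq in Hc by (left; apply ZZ_wt_pos).
  pose proof (ZZ_wt01 p); pose proof (Cmod_ge_0 h); nra.
Qed.

Lemma offpoles_0 tau : 0 < snd tau -> offpoles tau 0%C.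
Proof.
  intros Ht p Hp E; destruct (lattice_separated tau Ht) as [c [c0 Hc]].
  specialize (Hc (fst p) (snd p) (origin_false p Hp)); unfold lp in E; rewrite <- E, Cmod_0 in Hc.
  pose proof (Rabs_pos (IZR (fst p))); pose proof (Rabs_pos (IZR (snd p))); nra.
Qed.

Lemma offpoles_ball tau : 0 < snd tau ->
  exists d, 0 < d /\ forall z, Cmod z < d -> offpoles tau z.
Proof.
  intros Ht; destruct (offpoles_open tau Ht 0%C (offpoles_0 tau Ht)) as [d [d0 Hd]].
  exists d; split; auto; intros z Hz; replace z with (0 + z)%C by ring; auto.
Qed.

(** Numerator and denominator of 1/(z - l) are multiplied by the weight: the denominators become
    affine functions with bounded coefficients and a uniform lower bound, and the numerator supplies
    the decay. *)
Lemma FD_lr tau n : 0 < snd tau -> FD ZZ_wt (offpoles tau) 1 n (lr tau).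
Proof.
  intros Ht.
  set (a := fun p => if origin p then RtoC 0 else RtoC (ZZ_wt p)).
  (* At the origin the constant denominator 1 keeps the lower bound, while the numerator there is
     0. *)
  set (b := fun p => if origin p then RtoC 1 else (- (ZZ_wt p * lp tau p))%C).
  apply FD_ext with (fun p z => a p * / (a p * z + b p))%C; [apply offpoles_open; auto| |].
  - intros p z Hz; unfold a, b, lr, guard; destruct (origin p) eqn:Hp; [ring|].
    assert (RtoC (ZZ_wt p) <> 0%C).
    { intros E; apply RtoC_inj in E; pose proof (ZZ_wt_pos p); lra. }
    assert ((z - lp tau p)%C <> 0%C).
    { intros E; apply (Hz p Hp); replace z with (z - lp tau p + lp tau p)%C by ring; rewrite E; ring. }
    replace (ZZ_wt p * z + - (ZZ_wt p * lp tau p))%C with (ZZ_wt p * (z - lp tau p))%C by ring.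
    field; auto.
  - apply (FD_mul ZZ_wt ZZ_wt01 _ 1 0 n (fun p _ => a p)).
    + apply FD_const; exists 1; split; [lra|]; intros p; unfold a; destruct (origin p).
      * rewrite Cmod_0; pose proof (ZZ_wt_pos p); lra.
      * rewrite Cmod_R, Rabs_pos_eq; pose proof (ZZ_wt_pos p); lra.
    + apply FD_affine_inv with 1 (1 + Cmod tau); auto using ZZ_wt01.
      * intros p; unfold a; pose proof (ZZ_wt01 p); destruct (origin p); [rewrite Cmod_0; lra|].
        rewrite Cmod_R, Rabs_pos_eq; lra.
      * intros p; unfold b; destruct (origin p); [rewrite Cmod_1; pose proof (Cmod_ge_0 tau); lra|].
        rewrite Cmod_opp, Cmod_mult, Cmod_R, Rabs_pos_eq by (left; apply ZZ_wt_pos); apply lp_upper.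
      * intros z Hz; destruct (offpoles_lower tau z Ht Hz) as [c [c0 Hc]].
        exists (Rmin c 1); split; [apply Rmin_pos; lra|]; intros p; unfold a, b.
        destruct (origin p) eqn:Hp.
        -- replace (0 * z + 1)%C with (RtoC 1) by ring; rewrite Cmod_1; apply Rmin_r.
        -- replace (ZZ_wt p * z + - (ZZ_wt p * lp tau p))%C with (ZZ_wt p * (z - lp tau p))%C by ring.
           eapply Rle_trans; [apply Rmin_l|auto].
Qed.

Lemma lr_0 tau p : lr tau p 0%C = (- li tau p)%C.
Proof.
  unfold lr, li, guard; destruct (origin p); [ring|].
  replace (0 - lp tau p)%C with (- lp tau p)%C by ring.
  (* For a degenerate [tau] a nonzero index may give the lattice value 0; the convention that 0 has
     inverse 0 covers this case. *)
  destruct (Ceq_dec (lp tau p) 0) as [->|]; [|field; auto].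
  replace (- 0)%C with (RtoC 0) by ring.
  unfold Cinv; simpl; apply injective_projections; simpl; unfold Rdiv; ring.
Qed.

Lemma fbound_li tau : 0 < snd tau -> fbound ZZ_wt 1 (li tau).
Proof.
  intros Ht; pose proof (FD_bound ZZ_wt _ _ _ _ _ (FD_lr tau 0 Ht) (offpoles_0 tau Ht)) as [M [M0 HM]].
  exists M; split; auto; intros p; rewrite <- Cmod_opp, <- lr_0; auto.
Qed.

Lemma FD_li tau D n : 0 < snd tau -> FD ZZ_wt D 1 n (fun p _ => li tau p).
Proof. intros; apply FD_const, fbound_li; auto. Qed.

(** These sums give wzeta = 1/z + z^2 [Sv], wp = 1/z^2 + z [Su] and wp' = -2 (1/z^3 + [S3]).
    Extracting powers of z writes every term as a cubic monomial in 1/l and 1/(z - l), of visible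
    order 3 in the weight. *)
Definition Sv (tau z : C) : C := fsum ZZ_sq (fun p => li tau p * li tau p * lr tau p z)%C.
Definition Su (tau z : C) : C :=
  fsum ZZ_sq (fun p => li tau p * lr tau p z * (lr tau p z - li tau p))%C.
Definition S3 (tau z : C) : C := fsum ZZ_sq (fun p => lr tau p z * lr tau p z * lr tau p z)%C.
Definition S4 (tau z : C) : C :=
  fsum ZZ_sq (fun p => lr tau p z * lr tau p z * lr tau p z * lr tau p z)%C.
(** This is g2/20: the coefficient of z^2 in the Laurent expansion of wp. *)
Definition Sa (tau : C) : C :=
  (3 * fsum ZZ_sq (fun p => li tau p * li tau p * li tau p * li tau p))%C.
(** The exact remainder of the Laurent expansion of wp after its z^2 term, divided by z^4. Its value
    at 0 is five times the sum of l^(-6), that is g3/28. *)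
Definition Sb (tau z : C) : C :=
  fsum ZZ_sq (fun p => li tau p * li tau p * li tau p *
    (li tau p * lr tau p z * lr tau p z - 4 * li tau p * li tau p * lr tau p z))%C.

Ltac FDmul a b := apply (FD_mul ZZ_wt ZZ_wt01 _ a b).

Lemma FD_Sv tau n : 0 < snd tau ->
  FD ZZ_wt (offpoles tau) 3 n (fun p z => li tau p * li tau p * lr tau p z)%C.
Proof. intros; FDmul 2%nat 1%nat; [FDmul 1%nat 1%nat|]; auto using FD_li, FD_lr. Qed.

Lemma FD_Su tau n : 0 < snd tau ->
  FD ZZ_wt (offpoles tau) 3 n (fun p z => li tau p * lr tau p z * (lr tau p z - li tau p))%C.
Proof.
  intros; FDmul 2%nat 1%nat; [FDmul 1%nat 1%nat|apply FD_minus]; auto using FD_li, FD_lr, ZZ_wt01.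
Qed.

Lemma FD_S3 tau n : 0 < snd tau ->
  FD ZZ_wt (offpoles tau) 3 n (fun p z => lr tau p z * lr tau p z * lr tau p z)%C.
Proof. intros; FDmul 2%nat 1%nat; [FDmul 1%nat 1%nat|]; auto using FD_lr. Qed.

Lemma FD_S4 tau n : 0 < snd tau ->
  FD ZZ_wt (offpoles tau) 3 n (fun p z => lr tau p z * lr tau p z * lr tau p z * lr tau p z)%C.
Proof.
  intros; apply FD_weaken with 4%nat; auto using ZZ_wt01.
  FDmul 3%nat 1%nat; auto using FD_lr, FD_S3.
Qed.

Lemma FD_Sb tau n : 0 < snd tau ->
  FD ZZ_wt (offpoles tau) 3 n (fun p z => li tau p * li tau p * li tau p *
    (li tau p * lr tau p z * lr tau p z - 4 * li tau p * li tau p * lr tau p z))%C.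
Proof.
  intros; FDmul 3%nat 0%nat.
  - FDmul 2%nat 1%nat; [FDmul 1%nat 1%nat|]; auto using FD_li.
  - apply FD_weaken with 3%nat; auto using ZZ_wt01; apply FD_minus; auto using ZZ_wt01.
    + FDmul 2%nat 1%nat; [FDmul 1%nat 1%nat|]; auto using FD_li, FD_lr.
    + FDmul 2%nat 1%nat; [FDmul 1%nat 1%nat|]; auto using FD_li, FD_lr.
      FDmul 0%nat 1%nat; auto using FD_li; apply FD_scalar.
Qed.

Lemma Diff_Sv tau n : 0 < snd tau -> Diff (offpoles tau) n (Sv tau).
Proof. intros; apply (Diff_fsum ZZ_sq ZZ_wt 25); auto using exhausting_ZZ, FD_Sv. Qed.

Lemma Diff_Su tau n : 0 < snd tau -> Diff (offpoles tau) n (Su tau).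
Proof. intros; apply (Diff_fsum ZZ_sq ZZ_wt 25); auto using exhausting_ZZ, FD_Su. Qed.

Lemma Diff_S3 tau n : 0 < snd tau -> Diff (offpoles tau) n (S3 tau).
Proof. intros; apply (Diff_fsum ZZ_sq ZZ_wt 25); auto using exhausting_ZZ, FD_S3. Qed.

Lemma Diff_S4 tau n : 0 < snd tau -> Diff (offpoles tau) n (S4 tau).
Proof. intros; apply (Diff_fsum ZZ_sq ZZ_wt 25); auto using exhausting_ZZ, FD_S4. Qed.

Lemma Diff_Sb tau n : 0 < snd tau -> Diff (offpoles tau) n (Sb tau).
Proof. intros; apply (Diff_fsum ZZ_sq ZZ_wt 25); auto using exhausting_ZZ, FD_Sb. Qed.

Lemma FD_fbound {F : Z * Z -> C -> C} tau z : offpoles tau z -> FD ZZ_wt (offpoles tau) 3 0 F ->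
  fbound ZZ_wt 3 (fun p => F p z).
Proof. intros Hz HF; apply (FD_bound _ _ _ _ _ _ HF Hz). Qed.

(** The partial fraction identity z / (l (z - l)) = 1/(z - l) + 1/l. It is the relation behind the
    rearrangements of the lattice series, and it also holds at the guarded origin, where both sides
    are 0. *)
Lemma lr_fixpoint tau p z : offpoles tau z -> 0 < snd tau ->
  (z * li tau p * lr tau p z)%C = (lr tau p z + li tau p)%C.
Proof.
  intros Hz Ht; unfold lr, li, guard; destruct (origin p) eqn:Hp; [ring|].
  assert (lp tau p <> 0%C).
  { intros E; apply (offpoles_0 tau Ht p Hp); auto. }
  assert ((z - lp tau p)%C <> 0%C).
  { intros E; apply (Hz p Hp); replace z with (z - lp tau p + lp tau p)%C by ring; rewrite E; ring. }
  field; auto.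
Qed.

Lemma lat_sum_guard tau f : lat_sum tau f = fsum ZZ_sq (guard (fun p => f (lp tau p))).
Proof. reflexivity. Qed.

Lemma wzeta_Sv z tau : 0 < snd tau -> offpoles tau z ->
  wzeta z tau = (/ z + z * z * Sv tau z)%C.
Proof.
  intros Ht Hz; unfold Sv; rewrite <- (fsum_scal ZZ_sq ZZ_wt 25);
    [|apply exhausting_ZZ|apply (FD_fbound tau z Hz (FD_Sv tau 0 Ht))].
  unfold wzeta; rewrite lat_sum_guard; change Cadd with Cplus; change Defs.Cinv with Cinv; f_equal.
  apply fsum_ext; intros p.
  transitivity (z * z * (li tau p * li tau p) * lr tau p z)%C; [|ring].
  transitivity (z * li tau p * (z * li tau p * lr tau p z))%C; [|ring].
  rewrite lr_fixpoint by auto.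
  transitivity (z * li tau p * lr tau p z + z * li tau p * li tau p)%C; [|ring].
  rewrite lr_fixpoint by auto.
  unfold lr, li, guard; destruct (origin p) eqn:Hp; [ring|].
  change Cadd with Cplus; change Csub with Cminus; change Defs.Cinv with Cinv;
    change Defs.Cdiv with Cdiv; change (Defs.Cpow (lp tau p) 2) with (lp tau p * (lp tau p * 1))%C.
  assert (lp tau p <> 0%C) by (intros E; apply (offpoles_0 tau Ht p Hp); auto).
  assert ((z - lp tau p)%C <> 0%C).
  { intros E; apply (Hz p Hp); replace z with (z - lp tau p + lp tau p)%C by ring; rewrite E; ring. }
  field; auto.
Qed.

Lemma wp_Su z tau : 0 < snd tau -> offpoles tau z ->
  wp z tau = (/ (z * z) + z * Su tau z)%C.
Proof.
  intros Ht Hz; unfold Su; rewrite <- (fsum_scal ZZ_sq ZZ_wt 25);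
    [|apply exhausting_ZZ|apply (FD_fbound tau z Hz (FD_Su tau 0 Ht))].
  unfold wp; rewrite lat_sum_guard; change Cadd with Cplus; change Defs.Cinv with Cinv.
  change (Defs.Cpow z 2) with (z * (z * 1))%C; replace (z * (z * 1))%C with (z * z)%C by ring; f_equal.
  apply fsum_ext; intros p.
  transitivity ((z * li tau p * lr tau p z) * (lr tau p z - li tau p))%C; [|ring].
  rewrite lr_fixpoint by auto.
  unfold lr, li, guard; destruct (origin p) eqn:Hp; [ring|].
  change Csub with Cminus; change Defs.Cinv with Cinv.
  change (Defs.Cpow (lp tau p) 2) with (lp tau p * (lp tau p * 1))%C.
  change (Defs.Cpow (z - lp tau p)%C 2) with ((z - lp tau p) * ((z - lp tau p) * 1))%C.
  assert (lp tau p <> 0%C) by (intros E; apply (offpoles_0 tau Ht p Hp); auto).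
  assert ((z - lp tau p)%C <> 0%C).
  { intros E; apply (Hz p Hp); replace z with (z - lp tau p + lp tau p)%C by ring; rewrite E; ring. }
  field; auto.
Qed.

Lemma wp'_S3 z tau : 0 < snd tau -> offpoles tau z ->
  wp' z tau = (- (2) * (/ (z * z * z) + S3 tau z))%C.
Proof.
  intros Ht Hz; unfold wp', S3; rewrite lat_sum_guard.
  change (Cscal (-2)) with (Cmult (RtoC (-2))); change Cadd with Cplus; change Defs.Cinv with Cinv.
  change (Defs.Cpow z 3) with (z * (z * (z * 1)))%C; replace (z * (z * (z * 1)))%C with (z * z * z)%C by ring.
  replace (RtoC (-2)) with (- (2))%C by (apply injective_projections; simpl; ring); f_equal; f_equal.
  apply fsum_ext; intros p.
  unfold lr, guard; destruct (origin p) eqn:Hp; [ring|].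
  change (Defs.Cpow (Csub z (lp tau p)) 3)
    with ((z - lp tau p) * ((z - lp tau p) * ((z - lp tau p) * 1)))%C.
  assert ((z - lp tau p)%C <> 0%C).
  { intros E; apply (Hz p Hp); replace z with (z - lp tau p + lp tau p)%C by ring; rewrite E; ring. }
  field; auto.
Qed.

Lemma cder_lr tau p z : 0 < snd tau -> offpoles tau z ->
  cder (lr tau p) z (- (lr tau p z * lr tau p z))%C.
Proof.
  intros Ht Hz; unfold lr, guard; destruct (origin p) eqn:Hp.
  - apply (cder_eq _ _ 0%C); [ring|apply cder_const].
  - assert ((z - lp tau p)%C <> 0%C).
    { intros E; apply (Hz p Hp); replace z with (z - lp tau p + lp tau p)%C by ring; rewrite E; ring. }
    eapply cder_eq; [|apply cder_inv; auto; apply cder_minus; [apply cder_id|apply cder_const]].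
    simpl; ring.
Qed.

(* [z * Su] is [wp] minus its principal part; termwise [z i r (r - i) = r^2 - i^2]. *)
Lemma cder_zSu tau z : 0 < snd tau -> offpoles tau z ->
  cder (fun z => z * Su tau z)%C z (- (2) * S3 tau z)%C.
Proof.
  intros Ht Hz; destruct (offpoles_open tau Ht z Hz) as [d [d0 Hd]].
  assert (E : forall y, offpoles tau y -> (y * Su tau y)%C =
    fsum ZZ_sq (fun p => y * (li tau p * lr tau p y * (lr tau p y - li tau p)))%C).
  { intros y Hy; unfold Su; rewrite (fsum_scal ZZ_sq ZZ_wt 25); auto using exhausting_ZZ.
    apply (FD_fbound tau y Hy (FD_Su tau 0 Ht)). }
  apply cder_ext_loc with
    (f := fun y => fsum ZZ_sq (fun p => y * (li tau p * lr tau p y * (lr tau p y - li tau p)))%C) (d := d); auto.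
  { intros h Hh; rewrite E; auto. }
  unfold S3; rewrite <- (fsum_scal ZZ_sq ZZ_wt 25);
    [|apply exhausting_ZZ|apply (FD_fbound tau z Hz (FD_S3 tau 0 Ht))].
  apply (cder_fsum_termwise ZZ_sq ZZ_wt 25 exhausting_ZZ (offpoles tau) 0
    (fun p y => y * (li tau p * lr tau p y * (lr tau p y - li tau p)))%C
    (fun p z => - (2) * (lr tau p z * lr tau p z * lr tau p z))%C); auto.
  - FDmul 0%nat 3%nat; [apply FD_id|apply FD_Su; auto].
  - intros p.
    apply cder_ext_loc with (f := fun y => (lr tau p y * lr tau p y - li tau p * li tau p)%C) (d := d); auto.
    + intros h Hh; transitivity ((lr tau p (z + h) + li tau p) * (lr tau p (z + h) - li tau p))%C; [ring|].
      rewrite <- lr_fixpoint by auto; ring.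
    + eapply cder_eq; [|apply cder_minus; [apply cder_mul; apply cder_lr; auto|apply cder_const]].
      simpl; ring.
Qed.

Lemma cder_S3 tau z : 0 < snd tau -> offpoles tau z -> cder (S3 tau) z (- (3) * S4 tau z)%C.
Proof.
  intros Ht Hz.
  unfold S4; rewrite <- (fsum_scal ZZ_sq ZZ_wt 25);
    [|apply exhausting_ZZ|apply (FD_fbound tau z Hz (FD_S4 tau 0 Ht))].
  apply (cder_fsum_termwise ZZ_sq ZZ_wt 25 exhausting_ZZ (offpoles tau) 0
    (fun p z => lr tau p z * lr tau p z * lr tau p z)%C
    (fun p z => - (3) * (lr tau p z * lr tau p z * lr tau p z * lr tau p z))%C); auto.
  - apply FD_S3; auto.
  - intros p.
    eapply cder_eq; [|apply cder_mul; [apply cder_mul|]; apply cder_lr; auto].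
    simpl; ring.
Qed.

Lemma csum_zrange_S (g : Z -> C) N : csum g (zrange (S N)) =
  (g (- Z.of_nat (S N))%Z + csum g (zrange N) + g (Z.of_nat (S N)))%C.
Proof. rewrite zrange_S, csum_cons, csum_app, csum_cons, csum_nil; ring. Qed.

Lemma csum_zrange_0 (g : Z -> C) : csum g (zrange 0) = g 0%Z.
Proof. unfold zrange; simpl seq; simpl map; rewrite csum_cons, csum_nil; simpl; ring. Qed.

Lemma csum_zrange_opp (g : Z -> C) N : csum (fun k => g (- k)%Z) (zrange N) = csum g (zrange N).
Proof.
  induction N; [rewrite !csum_zrange_0; auto|].
  rewrite !csum_zrange_S, IHN, Z.opp_involutive; ring.
Qed.

Lemma csum_zrange_telescope (g : Z -> C) N :
  csum (fun k => g (k - 1)%Z - g k)%C (zrange N) = (g (- Z.of_nat N - 1)%Z - g (Z.of_nat N))%C.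
Proof.
  induction N; [rewrite csum_zrange_0; auto|].
  rewrite csum_zrange_S, IHN.
  replace (Z.of_nat (S N) - 1)%Z with (Z.of_nat N) by lia.
  replace (- Z.of_nat N - 1)%Z with (- Z.of_nat (S N))%Z by lia; ring.
Qed.

Lemma csum_zrange_delta (g : Z -> C) N :
  csum g (zrange N) = (g 0%Z + csum (fun k => if (k =? 0)%Z then 0%C else g k) (zrange N))%C.
Proof.
  induction N.
  - rewrite !csum_zrange_0; simpl; ring.
  - rewrite !csum_zrange_S, IHN.
    replace (- Z.of_nat (S N) =? 0)%Z with false by (symmetry; apply Z.eqb_neq; lia).
    replace (Z.of_nat (S N) =? 0)%Z with false by (symmetry; apply Z.eqb_neq; lia); ring.
Qed.

Lemma csum_sq (F : Z * Z -> C) N :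
  csum F (ZZ_sq N) = csum (fun m => csum (fun n => F (m, n)) (zrange N)) (zrange N).
Proof. apply csum_list_prod. Qed.

Lemma csum_guard (F : Z * Z -> C) N :
  csum F (ZZ_sq N) = (F (0, 0)%Z + csum (guard F) (ZZ_sq N))%C.
Proof.
  rewrite !csum_sq.
  rewrite (csum_ext (fun m => csum (fun n => F (m, n)) (zrange N))
    (fun m => csum (fun n => guard F (m, n)) (zrange N) + (if (m =? 0)%Z then F (0, 0)%Z else 0))%C).
  - rewrite csum_add, (csum_zrange_delta (fun m => if (m =? 0)%Z then F (0, 0)%Z else 0%C)).
    rewrite (csum_ext (fun k : Z => if (k =? 0)%Z then 0%C else if (k =? 0)%Z then F (0, 0)%Z else 0%C)
      (fun _ => (0 * 0)%C)).
    + rewrite csum_scal; simpl; ring.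
    + intros k; destruct (k =? 0)%Z; ring.
  - intros m; destruct (m =? 0)%Z eqn:E.
    + apply Z.eqb_eq in E; subst; rewrite csum_zrange_delta.
      rewrite Cplus_comm; f_equal; apply csum_ext; intros n; unfold guard, origin; simpl; auto.
    + replace (csum (fun n => guard F (m, n)) (zrange N)) with (csum (fun n => F (m, n)) (zrange N)).
      * ring.
      * apply csum_ext; intros n; unfold guard, origin; simpl; rewrite E; auto.
Qed.

Definition ZZopp (p : Z * Z) : Z * Z := (- fst p, - snd p)%Z.

Lemma csum_sq_opp (F : Z * Z -> C) N : csum (fun p => F (ZZopp p)) (ZZ_sq N) = csum F (ZZ_sq N).
Proof.
  rewrite !csum_sq; unfold ZZopp; simpl.
  rewrite (csum_ext _ (fun m => csum (fun n => F ((- m)%Z, n)) (zrange N))).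
  - apply (csum_zrange_opp (fun m => csum (fun n => F (m, n)) (zrange N))).
  - intros m; apply (csum_zrange_opp (fun n => F ((- m)%Z, n))).
Qed.

Lemma fsum_sq_opp (F : Z * Z -> C) : fsum ZZ_sq (fun p => F (ZZopp p)) = fsum ZZ_sq F.
Proof. unfold fsum; f_equal; apply functional_extensionality; intros; apply csum_sq_opp. Qed.

Lemma origin_opp p : origin (ZZopp p) = origin p.
Proof.
  unfold origin, ZZopp; simpl; f_equal; apply Bool.eq_iff_eq_true; rewrite !Z.eqb_eq; lia.
Qed.

Lemma lp_opp tau p : lp tau (ZZopp p) = (- lp tau p)%C.
Proof. unfold lp, ZZopp; simpl; rewrite !opp_IZR; apply grid_opp. Qed.

Lemma Cinv_opp (z : C) : (/ (- z))%C = (- / z)%C.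
Proof.
  destruct (Ceq_dec z 0) as [->|]; [|field; auto].
  replace (- 0)%C with (RtoC 0) by ring.
  unfold Cinv; simpl; apply injective_projections; simpl; unfold Rdiv; ring.
Qed.

Lemma li_opp tau p : li tau (ZZopp p) = (- li tau p)%C.
Proof.
  unfold li, guard; rewrite origin_opp, lp_opp; destruct (origin p); [ring|apply Cinv_opp].
Qed.

Lemma lr_opp tau p z : lr tau (ZZopp p) (- z)%C = (- lr tau p z)%C.
Proof.
  unfold lr, guard; rewrite origin_opp, lp_opp; destruct (origin p); [ring|].
  rewrite <- Cinv_opp; f_equal; ring.
Qed.

Lemma fsum_sq_odd (F : Z * Z -> C) : fbound ZZ_wt 3 F -> (forall p, F (ZZopp p) = (- F p)%C) ->
  fsum ZZ_sq F = 0%C.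
Proof.
  intros HF Ho.
  assert (E : fsum ZZ_sq F = (- (1) * fsum ZZ_sq F)%C).
  { rewrite <- (fsum_scal ZZ_sq ZZ_wt 25) by (auto using exhausting_ZZ).
    rewrite <- fsum_sq_opp; apply fsum_ext; intros; rewrite Ho; ring. }
  set (s := fsum ZZ_sq F) in *.
  replace s with ((s - - (1) * s) / 2)%C by field; rewrite <- E; field.
Qed.

Lemma offpoles_opp tau z : offpoles tau z -> offpoles tau (- z)%C.
Proof.
  intros H p Hp E; apply (H (ZZopp p)); [rewrite origin_opp; auto|].
  rewrite lp_opp, <- E; ring.
Qed.

Lemma fsum_odd_arg (F : Z * Z -> C -> C) tau z : 0 < snd tau -> offpoles tau z ->
  FD ZZ_wt (offpoles tau) 3 0 F -> (forall p y, F (ZZopp p) (- y)%C = (- F p y)%C) ->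
  fsum ZZ_sq (fun p => F p (- z)%C) = (- fsum ZZ_sq (fun p => F p z))%C.
Proof.
  intros Ht Hz HF Ho; rewrite <- (fsum_sq_opp (fun p => F p (- z)%C)).
  replace (- fsum ZZ_sq (fun p => F p z))%C with (- (1) * fsum ZZ_sq (fun p => F p z))%C by ring.
  rewrite <- (fsum_scal ZZ_sq ZZ_wt 25) by (auto using exhausting_ZZ; apply (FD_fbound tau z Hz HF)).
  apply fsum_ext; intros p; rewrite Ho; ring.
Qed.

Lemma Sv_odd tau z : 0 < snd tau -> offpoles tau z -> Sv tau (- z)%C = (- Sv tau z)%C.
Proof.
  intros Ht Hz; apply (fsum_odd_arg (fun p z => li tau p * li tau p * lr tau p z)%C tau); auto.
  - apply FD_Sv; auto.
  - intros; rewrite li_opp, lr_opp; ring.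
Qed.

Lemma Su_odd tau z : 0 < snd tau -> offpoles tau z -> Su tau (- z)%C = (- Su tau z)%C.
Proof.
  intros Ht Hz; apply (fsum_odd_arg (fun p z => li tau p * lr tau p z * (lr tau p z - li tau p))%C tau); auto.
  - apply FD_Su; auto.
  - intros; rewrite li_opp, lr_opp; ring.
Qed.

Lemma S3_odd tau z : 0 < snd tau -> offpoles tau z -> S3 tau (- z)%C = (- S3 tau z)%C.
Proof.
  intros Ht Hz; apply (fsum_odd_arg (fun p z => lr tau p z * lr tau p z * lr tau p z)%C tau); auto.
  - apply FD_S3; auto.
  - intros; rewrite lr_opp; ring.
Qed.

(** Termwise, (z - l)^(-2) - l^(-2) is expanded in z with an exact remainder. The coefficients of z
    and z^3 are sums of odd powers of 1/l and vanish by the symmetry of the squares. *)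
Lemma zSu_expansion tau z : 0 < snd tau -> offpoles tau z ->
  (z * Su tau z = z * z * Sa tau + z * z * z * z * Sb tau z)%C.
Proof.
  intros Ht Hz; unfold Su, Sa, Sb.
  assert (L2 : fbound ZZ_wt 2 (fun p => li tau p * li tau p)%C)
    by (apply (fbound_mul ZZ_wt 1 1); apply fbound_li; auto).
  assert (L3 : fbound ZZ_wt 3 (fun p => li tau p * li tau p * li tau p)%C)
    by (apply (fbound_mul ZZ_wt 2 1 (fun p => li tau p * li tau p)%C (li tau)); auto using fbound_li).
  assert (L4 : fbound ZZ_wt 4 (fun p => li tau p * li tau p * li tau p * li tau p)%C)
    by (apply (fbound_mul ZZ_wt 3 1 (fun p => li tau p * li tau p * li tau p)%C (li tau)); auto using fbound_li).
  assert (L5 : fbound ZZ_wt 5 (fun p => li tau p * li tau p * li tau p * li tau p * li tau p)%C)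
    by (apply (fbound_mul ZZ_wt 4 1 (fun p => li tau p * li tau p * li tau p * li tau p)%C (li tau)); auto using fbound_li).
  apply (fbound_weaken ZZ_wt ZZ_wt01 4 3) in L4; [|lia].
  apply (fbound_weaken ZZ_wt ZZ_wt01 5 3) in L5; [|lia].
  pose proof (FD_fbound tau z Hz (FD_Sb tau 0 Ht)) as LB.
  pose proof (FD_fbound tau z Hz (FD_Su tau 0 Ht)) as LU.
  assert (Sc : forall c F, fbound ZZ_wt 3 F -> fbound ZZ_wt 3 (fun p => c * F p)%C).
  { intros c F HF; apply (fbound_mul ZZ_wt 0 3 (fun _ => c) F); auto.
    apply fbound_0 with (Cmod c); intros; lra. }
  rewrite <- (fsum_scal ZZ_sq ZZ_wt 25) by (auto using exhausting_ZZ).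
  rewrite (fsum_ext ZZ_sq _ (fun p =>
    (2 * z) * (li tau p * li tau p * li tau p)
    + ((4 * z * z * z) * (li tau p * li tau p * li tau p * li tau p * li tau p)
    + ((3 * z * z) * (li tau p * li tau p * li tau p * li tau p)
    + (z * z * z * z) * (li tau p * li tau p * li tau p *
    (li tau p * lr tau p z * lr tau p z - 4 * li tau p * li tau p * lr tau p z)))))%C).
  - rewrite !(fsum_add ZZ_sq ZZ_wt 25), !(fsum_scal ZZ_sq ZZ_wt 25);
      auto using exhausting_ZZ, fbound_add.
    rewrite (fsum_sq_odd (fun p => li tau p * li tau p * li tau p)%C);
      [|auto|intros; rewrite li_opp; ring].
    rewrite (fsum_sq_odd (fun p => li tau p * li tau p * li tau p * li tau p * li tau p)%C);
      [|auto|intros; rewrite li_opp; ring].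
    ring.
  - intros p; pose proof (lr_fixpoint tau p z Hz Ht) as E.
    set (i := li tau p) in *; set (r := lr tau p z) in *.
    (* The difference of the two sides is an explicit multiple of the relation z i r = r + i, which
       vanishes. *)
    transitivity (r * r - i * i - (z * i * r - (r + i)) *
      ((i - r) + z * i * (2 * i - r) + z * z * i * i * (3 * i - r) + z * z * z * i * i * i * (4 * i - r)))%C;
      [|ring].
    transitivity ((z * i * r) * (r - i))%C; [ring|]; rewrite E; ring.
Qed.

(** * Periodicity *)

Lemma csum_minus {I} (F G : I -> C) l :
  csum (fun p => F p - G p)%C l = (csum F l - csum G l)%C.
Proof. induction l; [rewrite !csum_nil; ring|]; rewrite !csum_cons, IHl; ring. Qed.

Lemma Cdiff_eq (a b : C) : (a + - (1) * b)%C = 0%C -> a = b.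
Proof. intros H; replace a with (a + - (1) * b + b)%C by ring; rewrite H; ring. Qed.

Lemma Csub_eq0 (a b : C) : (a - b)%C = 0%C -> a = b.
Proof. intros H; replace a with (a - b + b)%C by ring; rewrite H; ring. Qed.

Ltac cring := apply Csub_eq0; ring.

(** The family with the origin included, so that translating z by a period is a translation of the
    index. *)
Definition full (tau z : C) (p : Z * Z) : C := (/ (z - lp tau p))%C.

(** Translating the index changes a square partial sum only along the boundary: O(N) terms of size
    O(N^(-2)). *)
Definition vanishing_shift (sh : Z * Z -> Z * Z) : Prop :=
  forall h, fbound ZZ_wt 2 h -> Ccv (fun N => csum (fun p => h (sh p) - h p)%C (ZZ_sq N)) (RtoC 0).

Lemma Ccv_0_inv (u : nat -> C) M : 0 <= M -> (forall N, Cmod (u N) <= M / INR (S N)) -> Ccv u (RtoC 0).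
Proof.
  intros M0 H.
  assert (E : forall e, 0 < e -> exists N0, forall N, (N >= N0)%nat -> Cmod (u N) < e).
  { intros e He; destruct (INR_unbounded (M / e)) as [N0 HN0]; exists N0; intros N HN.
    eapply Rle_lt_trans; [apply H|].
    assert (INR N0 <= INR (S N)) by (apply le_INR; lia).
    assert (0 < INR (S N)) by (apply lt_0_INR; lia).
    apply Rmult_lt_reg_r with (INR (S N)); auto.
    unfold Rdiv; rewrite Rmult_assoc, Rinv_l, Rmult_1_r by lra.
    apply Rmult_lt_compat_r with (r := e) in HN0; auto.
    unfold Rdiv in HN0; rewrite Rmult_assoc, Rinv_l in HN0 by lra; nra. }
  split; intros e He; destruct (E e He) as [N0 HN0]; exists N0; intros N HN;
    specialize (HN0 N HN); unfold Rdist; simpl; rewrite Rminus_0_r;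
    eapply Rle_lt_trans; eauto using Rabs_fst_le, Rabs_snd_le.
Qed.

Lemma csum_zrange_bound (g : Z -> C) B N : 0 <= B -> (forall k, Cmod (g k) <= B) ->
  Cmod (csum g (zrange N)) <= 2 * INR (S N) * B.
Proof.
  intros B0 H.
  assert (Cmod (csum g (zrange N)) <= (2 * INR N + 1) * B).
  { induction N.
    - rewrite csum_zrange_0; simpl; specialize (H 0%Z); lra.
    - rewrite csum_zrange_S, S_INR.
      eapply Rle_trans; [apply Cmod_triangle3|].
      pose proof (H (- Z.of_nat (S N))%Z); pose proof (H (Z.of_nat (S N))); lra. }
  rewrite S_INR; nra.
Qed.

Lemma ZZ_wt_large p N : INR N <= Rabs (IZR (fst p)) + Rabs (IZR (snd p)) ->
  ZZ_wt p ^ 2 <= / INR (S N) ^ 2.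
Proof.
  intros H; rewrite <- pow_inv; apply pow_incr; split; [left; apply ZZ_wt_pos|].
  unfold ZZ_wt; apply Rinv_le_contravar; [apply lt_0_INR; lia|rewrite S_INR; lra].
Qed.

Lemma boundary_column_bound h M N (k : Z) : 0 <= M -> (forall p, Cmod (h p) <= M * ZZ_wt p ^ 2) ->
  (Z.of_nat N <= Z.abs k)%Z ->
  Cmod (csum (fun n => h (k, n)) (zrange N)) <= 2 * M / INR (S N) /\
  Cmod (csum (fun m => h (m, k)) (zrange N)) <= 2 * M / INR (S N).
Proof.
  intros M0 H Hk; apply IZR_le in Hk; rewrite abs_IZR, <- INR_IZR_INZ in Hk.
  assert (0 < INR (S N)) by (apply lt_0_INR; lia).
  replace (2 * M / INR (S N)) with (2 * INR (S N) * (M * / INR (S N) ^ 2)) by (field; lra).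
  assert (P : 0 <= M * / INR (S N) ^ 2).
  { apply Rmult_le_pos; auto; left; apply Rinv_0_lt_compat, pow_lt; auto. }
  split; apply csum_zrange_bound; auto; intros n; (eapply Rle_trans; [apply H|]);
    apply Rmult_le_compat_l; auto; apply ZZ_wt_large; simpl;
    pose proof (Rabs_pos (IZR n)); lra.
Qed.

Definition sh1 (p : Z * Z) : Z * Z := (fst p - 1, snd p)%Z.
Definition sh2 (p : Z * Z) : Z * Z := (fst p, snd p - 1)%Z.

Lemma vanishing_sh1 : vanishing_shift sh1.
Proof.
  intros h [M [M0 HM]]; apply Ccv_0_inv with (4 * M); [lra|]; intros N.
  rewrite csum_sq; unfold sh1; simpl fst; simpl snd.
  rewrite (csum_ext _ (fun m => csum (fun n => h ((m - 1)%Z, n)) (zrange N)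
     - csum (fun n => h (m, n)) (zrange N))%C).
  - rewrite (csum_zrange_telescope (fun m => csum (fun n => h (m, n)) (zrange N))).
    eapply Rle_trans; [apply Cmod_triangle|]; rewrite Cmod_opp.
    pose proof (proj1 (boundary_column_bound h M N (- Z.of_nat N - 1) M0 HM ltac:(lia))).
    pose proof (proj1 (boundary_column_bound h M N (Z.of_nat N) M0 HM ltac:(lia))).
    replace (4 * M / INR (S N)) with (2 * M / INR (S N) + 2 * M / INR (S N)) by (unfold Rdiv; ring); lra.
  - intros m; apply csum_minus.
Qed.

Lemma vanishing_sh2 : vanishing_shift sh2.
Proof.
  intros h [M [M0 HM]]; apply Ccv_0_inv with (4 * M); [lra|]; intros N.
  rewrite csum_sq; unfold sh2; simpl fst; simpl snd.
  rewrite (csum_ext _ (fun m => h (m, (- Z.of_nat N - 1)%Z) + - (1) * h (m, Z.of_nat N))%C).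
  - rewrite csum_add, csum_scal.
    eapply Rle_trans; [apply Cmod_triangle|].
    replace (- (1) * csum (fun p => h (p, Z.of_nat N)) (zrange N))%C
      with (- csum (fun p => h (p, Z.of_nat N)) (zrange N))%C by ring.
    rewrite Cmod_opp.
    pose proof (proj2 (boundary_column_bound h M N (- Z.of_nat N - 1) M0 HM ltac:(lia))).
    pose proof (proj2 (boundary_column_bound h M N (Z.of_nat N) M0 HM ltac:(lia))).
    replace (4 * M / INR (S N)) with (2 * M / INR (S N) + 2 * M / INR (S N)) by (unfold Rdiv; ring); lra.
  - intros m; rewrite (csum_zrange_telescope (fun n => h (m, n))); ring.
Qed.

Section Periodicity.

Context (tau w : C) (sh : Z * Z -> Z * Z).
Hypothesis Ht : 0 < snd tau.
Hypothesis Hw : lattice tau w.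
Hypothesis Hsh : forall p, lp tau (sh p) = (lp tau p - w)%C.
Hypothesis Hv : vanishing_shift sh.

Lemma full_shift z p : full tau (z + w)%C p = full tau z (sh p).
Proof. unfold full; rewrite Hsh; f_equal; ring. Qed.

Lemma fbound_full z : ~ lattice tau z -> fbound ZZ_wt 1 (full tau z).
Proof.
  intros Hz; destruct (lattice_dist_lower tau z Ht Hz) as [c [c0 Hc]].
  exists (/ c); split; [left; apply Rinv_0_lt_compat; auto|]; intros [m n].
  specialize (Hc m n); unfold full, ZZ_wt, lp; simpl.
  pose proof (Rabs_pos (IZR m)); pose proof (Rabs_pos (IZR n)).
  set (s := 1 + Rabs (IZR m) + Rabs (IZR n)) in *.
  assert (0 < c * s) by (apply Rmult_lt_0_compat; unfold s; lra).
  rewrite Cmod_inv.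
  - rewrite Rmult_1_r, <- Rinv_mult; apply Rinv_le_contravar; auto.
  - apply Cmod_gt_0; lra.
Qed.

Lemma lr_guard_full z p : lr tau p z = guard (full tau z) p.
Proof. reflexivity. Qed.

Lemma guard_mul (f g : Z * Z -> C) p : (guard f p * guard g p)%C = guard (fun p => f p * g p)%C p.
Proof. unfold guard; destruct (origin p); auto; ring. Qed.

Lemma full_origin z : full tau z (0, 0)%Z = (/ z)%C.
Proof. unfold full, lp, grid; simpl; f_equal; ring. Qed.

(** The two square sums have terms of order 2 only and are kept as a difference. The second does not
    involve z, so it cancels when values at z + w and z are compared. *)
Lemma wp_partial_sums z : ~ lattice tau z ->
  Ccv (fun N => csum (fun p => full tau z p * full tau z p)%C (ZZ_sq N)
                - csum (fun p => li tau p * li tau p)%C (ZZ_sq N))%C (wp z tau).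
Proof.
  intros Hz; pose proof (not_lattice_offpoles _ _ Hz) as Hz'.
  assert (z0 : z <> 0%C) by (intros ->; apply Hz, lattice_0).
  rewrite wp_Su by auto; unfold Su.
  rewrite <- (fsum_scal ZZ_sq ZZ_wt 25);
    [|apply exhausting_ZZ|apply (FD_fbound tau z Hz' (FD_Su tau 0 Ht))].
  apply Ccv_ext with (fun N => / (z * z) +
    csum (fun p => z * (li tau p * lr tau p z * (lr tau p z - li tau p)))%C (ZZ_sq N))%C.
  - intros N; rewrite (csum_guard (fun p => full tau z p * full tau z p)%C), full_origin.
    rewrite (csum_ext _ (fun p => guard (fun p => full tau z p * full tau z p)%C p
       + - (1) * (li tau p * li tau p))%C).
    + rewrite csum_add, csum_scal; field; auto.
    + intros p; rewrite <- guard_mul, <- lr_guard_full.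
      transitivity ((z * li tau p * lr tau p z) * (lr tau p z - li tau p))%C; [ring|].
      rewrite lr_fixpoint by auto; ring.
  - apply Ccv_add; [apply Ccv_const|].
    apply (fsum_cv ZZ_sq ZZ_wt 25 exhausting_ZZ).
    apply (fbound_mul ZZ_wt 0 3 (fun _ => z));
      [apply fbound_0 with (Cmod z); intros; lra|apply (FD_fbound tau z Hz' (FD_Su tau 0 Ht))].
Qed.

Lemma wp_periodic z : ~ lattice tau z -> wp (z + w)%C tau = wp z tau.
Proof.
  intros Hz; pose proof (not_lattice_add _ _ _ Hw Hz) as Hzw.
  assert (HF : fbound ZZ_wt 2 (fun p => full tau z p * full tau z p)%C)
    by (apply (fbound_mul ZZ_wt 1 1); apply fbound_full; auto).
  assert (E : (wp (z + w)%C tau + - (1) * wp z tau)%C = 0%C).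
  { eapply Ccv_unique; [apply Ccv_add;
      [apply wp_partial_sums; auto|apply Ccv_scal, wp_partial_sums; auto]|].
    eapply Ccv_ext; [|apply (Hv _ HF)]; intros N; simpl.
    rewrite (csum_ext (fun p => full tau (z + w)%C p * full tau (z + w)%C p)%C
      (fun p => full tau z (sh p) * full tau z (sh p))%C) by (intros; rewrite full_shift; auto).
    rewrite (csum_ext _ (fun p => full tau z (sh p) * full tau z (sh p) + - (1) * (full tau z p * full tau z p))%C)
      by (intros; ring).
    rewrite csum_add, csum_scal; ring. }
  apply Cdiff_eq; auto.
Qed.

Lemma wp'_partial_sums z : ~ lattice tau z ->
  Ccv (fun N => - (2) * csum (fun p => full tau z p * full tau z p * full tau z p)%C (ZZ_sq N))%C (wp' z tau).
Proof.
  intros Hz; pose proof (not_lattice_offpoles _ _ Hz) as Hz'.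
  assert (z0 : z <> 0%C) by (intros ->; apply Hz, lattice_0).
  rewrite wp'_S3 by auto; apply Ccv_scal.
  apply Ccv_ext with (fun N => / (z * z * z) +
    csum (fun p => lr tau p z * lr tau p z * lr tau p z)%C (ZZ_sq N))%C.
  - intros N; rewrite (csum_guard (fun p => full tau z p * full tau z p * full tau z p)%C), full_origin.
    rewrite (csum_ext (fun p => lr tau p z * lr tau p z * lr tau p z)%C
      (guard (fun p => full tau z p * full tau z p * full tau z p)%C)).
    + field; auto.
    + intros p; rewrite lr_guard_full, !guard_mul; auto.
  - apply Ccv_add; [apply Ccv_const|].
    apply (fsum_cv ZZ_sq ZZ_wt 25 exhausting_ZZ), (FD_fbound tau z Hz' (FD_S3 tau 0 Ht)).
Qed.

Lemma wp'_periodic z : ~ lattice tau z -> wp' (z + w)%C tau = wp' z tau.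
Proof.
  intros Hz; pose proof (not_lattice_add _ _ _ Hw Hz) as Hzw.
  assert (HF : fbound ZZ_wt 2 (fun p => full tau z p * full tau z p * full tau z p)%C).
  { apply fbound_weaken with 3%nat; auto using ZZ_wt01.
    apply (fbound_mul ZZ_wt 2 1); [apply (fbound_mul ZZ_wt 1 1)|]; apply fbound_full; auto. }
  assert (E : (wp' (z + w)%C tau + - (1) * wp' z tau)%C = (- (2) * 0)%C).
  { eapply Ccv_unique; [apply Ccv_add;
      [apply wp'_partial_sums; auto|apply Ccv_scal, wp'_partial_sums; auto]|].
    eapply Ccv_ext; [|apply Ccv_scal, (Hv _ HF)]; intros N; simpl.
    rewrite (csum_ext (fun p => full tau (z + w)%C p * full tau (z + w)%C p * full tau (z + w)%C p)%C
      (fun p => full tau z (sh p) * full tau z (sh p) * full tau z (sh p))%C)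
      by (intros; rewrite full_shift; auto).
    rewrite (csum_ext _ (fun p => full tau z (sh p) * full tau z (sh p) * full tau z (sh p)
      + - (1) * (full tau z p * full tau z p * full tau z p))%C) by (intros; ring).
    rewrite csum_add, csum_scal; ring. }
  apply Cdiff_eq; rewrite E; ring.
Qed.

Lemma csum_li_0 N : csum (li tau) (ZZ_sq N) = 0%C.
Proof.
  assert (E : csum (li tau) (ZZ_sq N) = (- (1) * csum (li tau) (ZZ_sq N))%C).
  { rewrite <- csum_scal, <- csum_sq_opp; apply csum_ext; intros; rewrite li_opp; ring. }
  set (s := csum (li tau) (ZZ_sq N)) in *.
  replace s with ((s - - (1) * s) / 2)%C by field; rewrite <- E; field.
Qed.

(** The term 1/l of the summand drops out because each square sum of 1/l is zero by symmetry. *)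
Lemma wzeta_partial_sums z : ~ lattice tau z ->
  Ccv (fun N => csum (full tau z) (ZZ_sq N) + z * csum (fun p => li tau p * li tau p)%C (ZZ_sq N))%C
      (wzeta z tau).
Proof.
  intros Hz; pose proof (not_lattice_offpoles _ _ Hz) as Hz'.
  assert (z0 : z <> 0%C) by (intros ->; apply Hz, lattice_0).
  rewrite wzeta_Sv by auto; unfold Sv.
  rewrite <- (fsum_scal ZZ_sq ZZ_wt 25);
    [|apply exhausting_ZZ|apply (FD_fbound tau z Hz' (FD_Sv tau 0 Ht))].
  apply Ccv_ext with (fun N => / z +
    csum (fun p => z * z * (li tau p * li tau p * lr tau p z))%C (ZZ_sq N))%C.
  - intros N; rewrite (csum_guard (full tau z)), full_origin.
    rewrite (csum_ext _ (fun p => guard (full tau z) p + (li tau p + z * (li tau p * li tau p)))%C).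
    + rewrite !csum_add, csum_scal, csum_li_0; ring.
    + intros p; rewrite <- lr_guard_full.
      transitivity (z * li tau p * (z * li tau p * lr tau p z))%C; [ring|].
      rewrite lr_fixpoint by auto.
      transitivity (z * li tau p * lr tau p z + z * (li tau p * li tau p))%C; [ring|].
      rewrite lr_fixpoint by auto; ring.
  - apply Ccv_add; [apply Ccv_const|].
    apply (fsum_cv ZZ_sq ZZ_wt 25 exhausting_ZZ).
    apply (fbound_mul ZZ_wt 0 3 (fun _ => (z * z)%C));
      [apply fbound_0 with (Cmod (z * z)); intros; lra|apply (FD_fbound tau z Hz' (FD_Sv tau 0 Ht))].
Qed.

(* The increment of zeta over a period does not depend on the base point, because the boundary
   terms of the square partial sums at two base points differ by O(1/N). *)
Lemma wzeta_increment z z' : ~ lattice tau z -> ~ lattice tau z' ->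
  (wzeta (z + w)%C tau - wzeta z tau)%C = (wzeta (z' + w)%C tau - wzeta z' tau)%C.
Proof.
  intros Hz Hz'.
  assert (HF : fbound ZZ_wt 2 (fun p => full tau z p - full tau z' p)%C).
  { pose proof (fbound_mul ZZ_wt 1 1 _ _ (fbound_full z Hz) (fbound_full z' Hz')) as [M [M0 HM]].
    exists (Cmod (z' - z) * M); split; [apply Rmult_le_pos; auto; apply Cmod_ge_0|]; intros p.
    replace (full tau z p - full tau z' p)%C with ((z' - z) * (full tau z p * full tau z' p))%C.
    - rewrite Cmod_mult, Rmult_assoc; apply Rmult_le_compat_l; [apply Cmod_ge_0|apply HM].
    - unfold full.
      assert (N : forall y, ~ lattice tau y -> (y - lp tau p)%C <> 0%C).
      { intros y Hy E; apply Hy; exists (fst p), (snd p); fold (lp tau p).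
        replace y with (y - lp tau p + lp tau p)%C by ring; rewrite E; ring. }
      field; auto. }
  assert (E : ((wzeta (z + w)%C tau + - (1) * wzeta z tau)
     + - (1) * (wzeta (z' + w)%C tau + - (1) * wzeta z' tau))%C = 0%C).
  { eapply Ccv_unique; [apply Ccv_add; [|apply Ccv_scal]; apply Ccv_add;
      try apply Ccv_scal; apply wzeta_partial_sums; auto; apply not_lattice_add; auto|].
    eapply Ccv_ext; [|apply (Hv _ HF)]; intros N; simpl.
    rewrite (csum_ext (full tau (z + w)%C) (fun p => full tau z (sh p))) by (intros; apply full_shift).
    rewrite (csum_ext (full tau (z' + w)%C) (fun p => full tau z' (sh p))) by (intros; apply full_shift).
    rewrite (csum_ext _ (fun p => (full tau z (sh p) + - (1) * full tau z p)
       + - (1) * (full tau z' (sh p) + - (1) * full tau z' p))%C) by (intros; ring).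
    rewrite !csum_add, !csum_scal, !csum_add, !csum_scal; ring. }
  apply Cdiff_eq; rewrite <- E; ring.
Qed.

End Periodicity.

Lemma lp_sh1 tau p : lp tau (sh1 p) = (lp tau p - 1)%C.
Proof. unfold lp, sh1, grid; simpl fst; simpl snd; rewrite minus_IZR, RtoC_minus; ring. Qed.

Lemma lp_sh2 tau p : lp tau (sh2 p) = (lp tau p - tau)%C.
Proof. unfold lp, sh2, grid; simpl fst; simpl snd; rewrite minus_IZR, RtoC_minus; ring. Qed.

Lemma half_not_lattice tau (m n : Z) : 0 < snd tau ->
  Z.odd m = true \/ Z.odd n = true -> ~ lattice tau (grid tau (IZR m / 2) (IZR n / 2)).
Proof.
  intros Ht Ho (k & l & E); apply grid_inj in E; auto; destruct E as [E1 E2].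
  assert (H1 : m = (2 * k)%Z) by (apply eq_IZR; rewrite mult_IZR; lra).
  assert (H2 : n = (2 * l)%Z) by (apply eq_IZR; rewrite mult_IZR; lra).
  rewrite H1, H2, !Z.odd_mul in Ho; simpl in Ho; destruct Ho; discriminate.
Qed.

Lemma wzeta_odd tau z : 0 < snd tau -> offpoles tau z -> wzeta (- z)%C tau = (- wzeta z tau)%C.
Proof.
  intros Ht Hz; rewrite !wzeta_Sv, Sv_odd, Cinv_opp by (auto using offpoles_opp); cring.
Qed.

Lemma wp_even tau z : 0 < snd tau -> offpoles tau z -> wp (- z)%C tau = wp z tau.
Proof.
  intros Ht Hz; rewrite !wp_Su, Su_odd by (auto using offpoles_opp).
  replace (- z * - z)%C with (z * z)%C by ring; cring.
Qed.

Lemma wp'_odd tau z : 0 < snd tau -> offpoles tau z -> wp' (- z)%C tau = (- wp' z tau)%C.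
Proof.
  intros Ht Hz; rewrite !wp'_S3, S3_odd by (auto using offpoles_opp).
  replace (- z * - z * - z)%C with (- (z * z * z))%C by ring; rewrite Cinv_opp; cring.
Qed.

(** The increment does not depend on the base point; evaluated at -1/2, oddness turns it into 2
    wzeta(1/2), which is the definition of [eta1]. *)
Lemma wzeta_shift1 tau z : 0 < snd tau -> ~ lattice tau z ->
  wzeta (z + 1)%C tau = (wzeta z tau + eta1 tau)%C.
Proof.
  intros Ht Hz.
  assert (Hh : ~ lattice tau (RtoC (1 / 2))).
  { replace (RtoC (1 / 2)) with (grid tau (IZR 1 / 2) (IZR 0 / 2))
      by (unfold grid, Rdiv; rewrite Rmult_0_l; ring).
    apply half_not_lattice; auto. }
  pose proof (wzeta_increment tau 1%C sh1 Ht (lattice_1 tau) (lp_sh1 tau) vanishing_sh1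
    z (- RtoC (1 / 2))%C Hz (not_lattice_opp _ _ Hh)) as E.
  replace (- RtoC (1 / 2) + 1)%C with (RtoC (1 / 2)) in E
    by (rewrite <- RtoC_opp, <- RtoC_plus; f_equal; field).
  rewrite wzeta_odd in E by (auto using not_lattice_offpoles).
  unfold eta1; change (Cscal 2) with (Cmult (RtoC 2)).
  change (Defs.RtoC (1 / 2)) with (RtoC (1 / 2)).
  transitivity (wzeta (z + 1)%C tau - wzeta z tau + wzeta z tau)%C; [cring|rewrite E; cring].
Qed.

Lemma wzeta_shift2 tau z : 0 < snd tau -> ~ lattice tau z ->
  wzeta (z + tau)%C tau = (wzeta z tau + eta2 tau)%C.
Proof.
  intros Ht Hz.
  assert (Hh : ~ lattice tau (RtoC (1 / 2) * tau)%C).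
  { replace (RtoC (1 / 2) * tau)%C with (grid tau (IZR 0 / 2) (IZR 1 / 2))
      by (unfold grid; replace (0 / 2) with 0 by field; ring).
    apply half_not_lattice; auto. }
  pose proof (wzeta_increment tau tau sh2 Ht (lattice_tau tau) (lp_sh2 tau) vanishing_sh2
    z (- (RtoC (1 / 2) * tau))%C Hz (not_lattice_opp _ _ Hh)) as E.
  replace (- (RtoC (1 / 2) * tau) + tau)%C with (RtoC (1 / 2) * tau)%C in E
    by (apply injective_projections; simpl; field).
  rewrite wzeta_odd in E by (auto using not_lattice_offpoles).
  unfold eta2; change (Cscal 2) with (Cmult (RtoC 2)).
  change (Cscal (1 / 2) tau) with (RtoC (1 / 2) * tau)%C.
  transitivity (wzeta (z + tau)%C tau - wzeta z tau + wzeta z tau)%C; [cring|rewrite E; cring].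
Qed.

Lemma wp_shift tau z (m n : Z) : 0 < snd tau -> ~ lattice tau z ->
  wp (z + grid tau (IZR m) (IZR n))%C tau = wp z tau.
Proof.
  intros Ht Hz; rewrite (quasi_periodic_shift tau (fun z => wp z tau) 0 0); auto; [cring| |].
  - intros y Hy; rewrite (wp_periodic tau 1%C sh1) by (auto using lattice_1, lp_sh1, vanishing_sh1); cring.
  - intros y Hy; rewrite (wp_periodic tau tau sh2) by (auto using lattice_tau, lp_sh2, vanishing_sh2); cring.
Qed.

Lemma wp'_shift tau z (m n : Z) : 0 < snd tau -> ~ lattice tau z ->
  wp' (z + grid tau (IZR m) (IZR n))%C tau = wp' z tau.
Proof.
  intros Ht Hz; rewrite (quasi_periodic_shift tau (fun z => wp' z tau) 0 0); auto; [cring| |].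
  - intros y Hy; rewrite (wp'_periodic tau 1%C sh1) by (auto using lattice_1, lp_sh1, vanishing_sh1); cring.
  - intros y Hy; rewrite (wp'_periodic tau tau sh2) by (auto using lattice_tau, lp_sh2, vanishing_sh2); cring.
Qed.

Lemma wzeta_shift tau z (m n : Z) : 0 < snd tau -> ~ lattice tau z ->
  wzeta (z + grid tau (IZR m) (IZR n))%C tau = (wzeta z tau + IZR m * eta1 tau + IZR n * eta2 tau)%C.
Proof.
  intros Ht Hz; apply (quasi_periodic_shift tau (fun z => wzeta z tau)); auto; intros.
  - apply wzeta_shift1; auto.
  - apply wzeta_shift2; auto.
Qed.

(** * Fourier-type expansions *)

(** Raises exp(u) >= u to the fifth power with u = cy/5. Exponent 5 leaves 2 for the quadratic
    weights of the q-series and 3 for summability. *)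
Lemma exp_decay c y : 0 < c -> 0 < y -> exp (- (c * y)) <= (5 / c) ^ 5 * / y ^ 5.
Proof.
  intros c0 y0.
  assert (H : (c * y / 5) ^ 5 <= exp (c * y)).
  { replace (exp (c * y)) with (exp (c * y / 5) ^ 5).
    - apply pow_incr; split.
      + apply Rmult_le_pos; [apply Rmult_le_pos|]; lra.
      + assert (0 < c * y / 5) by (apply Rdiv_lt_0_compat; [apply Rmult_lt_0_compat|]; lra).
        pose proof (exp_ineq1 (c * y / 5) ltac:(lra)); lra.
    - simpl; rewrite Rmult_1_r, <- !exp_plus; f_equal; field. }
  rewrite exp_Ropp.
  replace ((5 / c) ^ 5 * / y ^ 5) with (/ (c * y / 5) ^ 5) by (field; lra).
  apply Rinv_le_contravar; auto.
  apply pow_lt; apply Rdiv_lt_0_compat; [apply Rmult_lt_0_compat|]; lra.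
Qed.

Lemma fbound_decay (w : nat -> R) c : 0 < c -> (forall k, Rabs (w k) <= INR (S k) ^ 2) ->
  fbound nat_wt 3 (fun k => RtoC (w k * exp (- (c * INR (S k))))).
Proof.
  intros c0 Hw; exists ((5 / c) ^ 5); split; [apply pow_le; left; apply Rdiv_lt_0_compat; lra|].
  intros k; rewrite Cmod_R, Rabs_mult, (Rabs_pos_eq (exp _)) by (left; apply exp_pos).
  assert (y0 : 0 < INR (S k)) by (apply lt_0_INR; lia).
  pose proof (exp_decay c (INR (S k)) c0 y0); specialize (Hw k).
  unfold nat_wt; rewrite pow_inv.
  eapply Rle_trans; [apply Rmult_le_compat; eauto; [apply Rabs_pos|left; apply exp_pos]|].
  apply Req_le; field; split; lra.
Qed.

Lemma lower_bound_finite (X : nat -> C) n : (forall k, X k <> 0%C) ->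
  exists c, 0 < c /\ forall k, (k < n)%nat -> c <= Cmod (X k).
Proof.
  intros H; induction n; [exists 1; split; [lra|intros; lia]|].
  destruct IHn as [c [c0 Hc]]; exists (Rmin c (Cmod (X n))); split.
  - apply Rmin_pos; auto; apply Cmod_gt_0; auto.
  - intros k Hk; destruct (Nat.eq_dec k n) as [->|]; [apply Rmin_r|].
    eapply Rle_trans; [apply Rmin_l|apply Hc; lia].
Qed.

(** The tail has |x k| <= 1/2, and the finitely many remaining terms have a positive minimum. *)
Lemma lower_bound_one_minus (x : nat -> C) : fbound nat_wt 1 x -> (forall k, x k <> 1%C) ->
  exists c, 0 < c /\ forall k, c <= Cmod (1 - x k).
Proof.
  intros [M [M0 HM]] H.
  destruct (INR_unbounded (2 * M)) as [n Hn].
  destruct (lower_bound_finite (fun k => 1 - x k)%C n) as [c [c0 Hc]].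
  { intros k E; apply (H k); replace (x k) with (1 - (1 - x k))%C by ring; rewrite E; ring. }
  exists (Rmin c (1 / 2)); split; [apply Rmin_pos; lra|]; intros k.
  destruct (Nat.lt_ge_cases k n) as [Hk|Hk].
  - eapply Rle_trans; [apply Rmin_l|auto].
  - eapply Rle_trans; [apply Rmin_r|].
    specialize (HM k); apply le_INR in Hk.
    assert (INR (S k) = INR k + 1) by apply S_INR.
    assert (Cmod (x k) <= 1 / 2).
    { eapply Rle_trans; [apply HM|]; unfold nat_wt; rewrite pow_1.
      apply Rmult_le_reg_r with (INR (S k)); [lra|].
      rewrite Rmult_assoc, Rinv_l by lra; lra. }
    pose proof (Cmod_rev_triangle 1 (- x k)); rewrite Cmod_1, Cmod_opp in H2.
    unfold Cminus; lra.
Qed.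

Lemma fsum_nat_peel (F : nat -> C) : fbound nat_wt 3 F ->
  fbound nat_wt 3 (fun k => F (S k)) ->
  fsum (seq 0) F = (F 0%nat + fsum (seq 0) (fun k => F (S k)))%C.
Proof.
  intros HF HF'.
  apply (Ccv_unique (fun N => csum F (seq 0 (S N)))).
  - apply (Ccv_subseq_S (fun N => csum F (seq 0 N))), (fsum_cv _ nat_wt 2 exhausting_nat); auto.
  - apply Ccv_ext with (fun N => F 0%nat + csum (fun k => F (S k)) (seq 0 N))%C.
    + intros N; change (seq 0 (S N)) with (0%nat :: seq 1 N).
      rewrite csum_cons, <- seq_shift, csum_map; auto.
    + apply Ccv_add; [apply Ccv_const|apply (fsum_cv _ nat_wt 2 exhausting_nat); auto].
Qed.

(* [1/(e^z - 1) - 1/z = 1/2 (1/(e^(z/2) - 1) - 2/z) - 1/(2 (e^(z/2) + 1))], iterated. *)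
Definition bern_term (j : nat) (z : C) : C :=
  (RtoC ((1 / 2) ^ S j) * / (1 * cexp (RtoC ((1 / 2) ^ S j) * z) + 1))%C.

(** The regular part of 1/(e^z - 1) at 0, the generating function of the Bernoulli numbers without
    its pole. The series presentation provides its derivatives at 0 itself. *)
Definition bern (z : C) : C := (- fsum (seq 0) (fun j => bern_term j z))%C.

Lemma half_pow_exp k : (1 / 2) ^ k = exp (- (ln 2 * INR k)).
Proof.
  induction k; [simpl; rewrite Rmult_0_r, Ropp_0, exp_0; auto|].
  rewrite S_INR; simpl; rewrite IHk.
  replace (- (ln 2 * (INR k + 1))) with (- ln 2 + - (ln 2 * INR k)) by ring.
  rewrite exp_plus, (exp_Ropp (ln 2)), exp_ln by lra; field.
Qed.

Lemma half_pow_bound k : 0 < (1 / 2) ^ k <= 1.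
Proof.
  split; [apply pow_lt; lra|]; eapply Rle_trans; [apply (pow_incr _ 1); lra|rewrite pow1; lra].
Qed.

Lemma FD_bern n : FD nat_wt (fun z => Cmod z < 1) 3 n bern_term.
Proof.
  apply (FD_mul nat_wt nat_wt01 _ 3 0 n (fun j _ => RtoC ((1 / 2) ^ S j))).
  - apply FD_const.
    replace (fun j => RtoC ((1 / 2) ^ S j)) with (fun k => RtoC (1 * exp (- (ln 2 * INR (S k))))).
    + apply fbound_decay.
      * rewrite <- ln_1; apply ln_increasing; lra.
      * intros k; rewrite Rabs_R1.
        assert (1 <= INR (S k)) by (rewrite S_INR; pose proof (pos_INR k); lra); nra.
    + apply functional_extensionality; intros k; rewrite half_pow_exp, Rmult_1_l; auto.
  - apply FD_inv; [apply nat_wt01| |].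
    + intros z Hz; exists 1; split; [lra|]; intros j.
      set (w := (RtoC ((1 / 2) ^ S j) * z)%C).
      assert (Hw : Rabs (snd w) < 1).
      { eapply Rle_lt_trans; [apply Rabs_snd_le|]; unfold w; rewrite Cmod_mult, Cmod_R, Rabs_pos_eq.
        - pose proof (half_pow_bound (S j)); pose proof (Cmod_ge_0 z); nra.
        - left; apply half_pow_bound. }
      apply Rabs_def2 in Hw; pose proof PI2_1.
      eapply Rle_trans; [|apply Rabs_fst_le]; eapply Rle_trans; [|apply Rle_abs].
      unfold cexp; simpl.
      pose proof (exp_pos (fst w)); pose proof (cos_ge_0 (snd w) ltac:(lra) ltac:(lra)).
      unfold w in *; simpl in *; nra.
    + apply FD_add; [apply FD_exp with 1; auto using nat_wt01|apply FD_scalar].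
      * intros p; pose proof (half_pow_bound (S p)); rewrite Cmod_R, Rabs_pos_eq; lra.
      * apply fbound_0 with 1; intros; rewrite Cmod_1; lra.
Qed.

(** The radius 1/24 makes the quadratic error 12 |w|^2 at most |w|/2. *)
Lemma cexp_minus_1_lower w : Cmod w <= 1 / 24 -> Cmod w / 2 <= Cmod (cexp w - 1).
Proof.
  intros H; pose proof (cexp_quadratic w ltac:(lra)).
  replace (cexp w - 1)%C with (w + (cexp w - 1 - w))%C by ring.
  eapply Rle_trans; [|apply Cmod_rev_triangle].
  pose proof (Cmod_ge_0 w); nra.
Qed.

(** After N halvings the defect is 2^(-N) [h](2^(-N) z), and [h] is bounded by 24 near 0, so the
    defect tends to 0. *)
Lemma bern_correct (z : C) : z <> 0%C -> Cmod z <= 1 / 24 ->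
  cexp z <> 1%C /\ (/ (cexp z - 1) = / z + bern z)%C.
Proof.
  assert (N1 : forall w : C, w <> 0%C -> Cmod w <= 1 / 24 -> (cexp w - 1)%C <> 0%C).
  { intros w Hw Hs; apply Cmod_gt_0; pose proof (cexp_minus_1_lower w Hs).
    assert (0 < Cmod w) by (apply Cmod_gt_0; auto); lra. }
  intros Hz Hs; split.
  { intros E; apply (N1 z Hz Hs); rewrite E; ring. }
  set (h := fun w : C => (/ (cexp w - 1) - / w)%C).
  assert (Hh : forall w : C, w <> 0%C -> Cmod w <= 1 / 24 -> Cmod (h w) <= 24).
  { intros w Hw Hws; pose proof (N1 w Hw Hws) as Hn.
    assert (w0 : 0 < Cmod w) by (apply Cmod_gt_0; auto).
    assert (e0 : 0 < Cmod (cexp w - 1)) by (apply Cmod_gt_0; auto).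
    replace (h w) with (- ((cexp w - 1 - w) * / (w * (cexp w - 1))))%C by (unfold h; field; auto).
    rewrite Cmod_opp, Cmod_mult, Cmod_inv, Cmod_mult.
    - pose proof (cexp_quadratic w ltac:(lra)); pose proof (cexp_minus_1_lower w Hws).
      apply Rmult_le_reg_r with (Cmod w * Cmod (cexp w - 1)); [apply Rmult_lt_0_compat; auto|].
      rewrite Rmult_assoc, Rinv_l, Rmult_1_r by (apply Rgt_not_eq, Rmult_lt_0_compat; auto).
      nra.
    - apply Cmod_gt_0; rewrite Cmod_mult; apply Rmult_lt_0_compat; auto. }
  set (p := fun N => RtoC ((1 / 2) ^ N)).
  assert (p0 : forall N, p N <> 0%C).
  { intros N E; apply RtoC_inj in E; pose proof (half_pow_bound N); lra. }
  assert (Hp : forall N, (p N * z)%C <> 0%C /\ Cmod (p N * z) <= 1 / 24).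
  { intros N; split; [apply Cmult_neq_0; auto|].
    unfold p; rewrite Cmod_mult, Cmod_R, Rabs_pos_eq by (left; apply half_pow_bound).
    pose proof (half_pow_bound N); pose proof (Cmod_ge_0 z); nra. }
  assert (Hd : forall N, (h z + csum (fun j => bern_term j z) (seq 0 N))%C = (p N * h (p N * z))%C).
  { induction N.
    - unfold p; simpl; rewrite csum_nil; replace (1 * z)%C with z by ring; ring.
    - rewrite seq_S, csum_app, csum_cons, csum_nil, Nat.add_0_l.
      transitivity (p N * h (p N * z) + bern_term N z)%C; [rewrite <- IHN; ring|].
      assert (pS : p N = (2 * p (S N))%C).
      { unfold p; simpl; rewrite RtoC_mult; apply injective_projections; simpl; field. }
      unfold bern_term; fold (p (S N)); rewrite pS; unfold h.
      replace (2 * p (S N) * z)%C with (p (S N) * z + p (S N) * z)%C by ring; rewrite cexp_add.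
      destruct (Hp (S N)) as [Hp1 Hp2]; pose proof (N1 _ Hp1 Hp2) as Hn.
      destruct (Hp N) as [Hq1 Hq2]; pose proof (N1 _ Hq1 Hq2) as Hm.
      rewrite pS in Hm; replace (2 * p (S N) * z)%C with (p (S N) * z + p (S N) * z)%C in Hm by ring.
      rewrite cexp_add in Hm.
      pose proof (p0 (S N)).
      set (e := cexp (p (S N) * z)) in *.
      assert (Hee : (e + 1)%C <> 0%C).
      { intros E; apply Hm; replace (e * e - 1)%C with ((e + 1) * (e - 1))%C by ring; rewrite E; ring. }
      assert (Hq3 : (p (S N) * z + p (S N) * z)%C <> 0%C).
      { rewrite pS in Hq1; replace (p (S N) * z + p (S N) * z)%C with (2 * p (S N) * z)%C by ring; auto. }
      assert (Hee' : (1 * e + 1)%C <> 0%C) by (replace (1 * e + 1)%C with (e + 1)%C by ring; auto).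
      field; repeat split; auto. }
  assert (HF : fbound nat_wt 3 (fun j => bern_term j z)).
  { apply (FD_bound nat_wt _ _ _ _ z (FD_bern 0)); lra. }
  assert (E : (h z + fsum (seq 0) (fun j => bern_term j z))%C = 0%C).
  { eapply Ccv_unique.
    - apply Ccv_add; [apply Ccv_const|apply (fsum_cv _ nat_wt 2 exhausting_nat), HF].
    - apply Ccv_0_inv with 24; [lra|]; intros N; rewrite Hd.
      destruct (Hp N) as [Hp1 Hp2]; rewrite Cmod_mult.
      specialize (Hh _ Hp1 Hp2).
      unfold p at 1; rewrite Cmod_R, Rabs_pos_eq by (left; apply half_pow_bound).
      rewrite Rmult_comm; apply Rmult_le_compat; auto; [apply Cmod_ge_0|left; apply half_pow_bound|].
      unfold Rdiv; rewrite Rmult_1_l, pow_inv; apply Rinv_le_contravar; [apply lt_0_INR; lia|].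
      clear; induction N; [simpl; lra|]; rewrite S_INR; simpl pow.
      assert (1 <= 2 ^ N) by (apply pow_R1_Rle; lra); lra. }
  unfold bern; unfold h in E.
  replace (/ z + - fsum (seq 0) (fun j => bern_term j z))%C
    with (/ (cexp z - 1) - (/ (cexp z - 1) - / z + fsum (seq 0) (fun j => bern_term j z)))%C by ring.
  rewrite E; ring.
Qed.

Lemma Diff_bern n : Diff (fun z => Cmod z < 1) n bern.
Proof. apply Diff_opp, (Diff_fsum _ nat_wt 2 exhausting_nat), FD_bern. Qed.

Definition kap : C := (2 * PI * Ci)%C.

Definition nome (z : C) : C := cexp (kap * z)%C.

(** The function g of the overview. It tends to 0 as Im z tends to plus infinity but to -1 in the
    other direction; this is why sums over all integers must be regularised, through g(-z) = -1 -
    g(z). *)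
Definition gq (z : C) : C := (nome z * / (1 - nome z))%C.

Lemma nome_add z w : nome (z + w)%C = (nome z * nome w)%C.
Proof. unfold nome; rewrite <- cexp_add; f_equal; ring. Qed.

Lemma nome_Z (m : Z) : nome (IZR m) = 1%C.
Proof.
  unfold nome, kap; rewrite <- cexp_0.
  replace (2 * PI * Ci * IZR m)%C with (0 + 2 * PI * Ci * RtoC (IZR m))%C by ring.
  apply cexp_shift_Z.
Qed.

Lemma kap_neq_0 : kap <> 0%C.
Proof.
  unfold kap; intros E; apply (f_equal snd) in E; simpl in E; pose proof PI_RGT_0; lra.
Qed.

Lemma nome_eq_1 z : nome z = 1%C -> exists m : Z, z = RtoC (IZR m).
Proof.
  intros H; apply cexp_eq_1 in H; destruct H as [k Hk]; exists k.
  fold kap in Hk.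
  replace z with (/ kap * (kap * z))%C by (field; apply kap_neq_0).
  rewrite Hk; field; apply kap_neq_0.
Qed.

Lemma nome_neq_0 z : nome z <> 0%C.
Proof. apply cexp_neq_0. Qed.

Lemma nome_opp z : nome (- z)%C = (/ nome z)%C.
Proof. unfold nome; rewrite <- cexp_opp; f_equal; ring. Qed.

Lemma Cmod_nome z : Cmod (nome z) = exp (- (2 * PI * snd z)).
Proof. unfold nome, kap; rewrite Cmod_cexp; f_equal; simpl; ring. Qed.

Lemma gq_shift1 z : gq (z + 1)%C = gq z.
Proof. unfold gq; rewrite nome_add, (nome_Z 1), Cmult_1_r; auto. Qed.

Lemma gq_opp z : nome z <> 1%C -> gq (- z)%C = (- (1) - gq z)%C.
Proof.
  intros H; unfold gq; rewrite nome_opp; pose proof (nome_neq_0 z).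
  assert ((1 - nome z)%C <> 0%C).
  { intros E; apply H; replace (nome z) with (1 - (1 - nome z))%C by ring; rewrite E; ring. }
  assert ((nome z - 1)%C <> 0%C).
  { intros E; apply H; replace (nome z) with (nome z - 1 + 1)%C by ring; rewrite E; ring. }
  field; auto.
Qed.

(** * The q-series with polynomial weights *)

Section QSeries.

Context (b : R).
Hypothesis b0 : 0 < b.

Definition qtau : C := (0, b).

Lemma qtau_im : 0 < snd qtau.
Proof. exact b0. Qed.

Definition qdom (z : C) : Prop := forall k : nat, nome (z + INR (S k) * qtau)%C <> 1%C.

Definition qgrowth (w : nat -> R) : Prop := forall k, Rabs (w k) <= INR (S k) ^ 2.

Definition qs (w : nat -> R) (z : C) : C :=
  fsum (seq 0) (fun k => RtoC (w k) * gq (z + INR (S k) * qtau))%C.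

Lemma nome_qtau k : nome (INR (S k) * qtau)%C = RtoC (exp (- (2 * PI * b * INR (S k)))).
Proof.
  unfold nome, cexp, kap; apply injective_projections; cbn [fst snd Cmult RtoC qtau Ci].
  - match goal with |- exp ?a * cos ?c = _ =>
      replace c with 0 by ring; replace a with (- (2 * PI * b * INR (S k))) by ring end.
    rewrite cos_0; ring.
  - match goal with |- exp ?a * sin ?c = _ => replace c with 0 by ring end.
    rewrite sin_0; ring.
Qed.

(** Separates the exponential decay in k from the dependence on z, the shape required by [FD_exp]
    and [FD_inv]. *)
Lemma qs_term w k z : (RtoC (w k) * gq (z + INR (S k) * qtau))%C =
  (RtoC (w k * exp (- (2 * PI * b * INR (S k)))) * cexp (kap * z)
   * / (1 - RtoC (1 * exp (- (2 * PI * b * INR (S k)))) * cexp (kap * z)))%C.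
Proof.
  unfold gq; rewrite nome_add, nome_qtau, RtoC_mult, Rmult_1_l; fold (nome z).
  rewrite (Cmult_comm (nome z) (RtoC (exp _))); ring.
Qed.

Lemma fbound_qcoef w : qgrowth w ->
  fbound nat_wt 3 (fun k => RtoC (w k * exp (- (2 * PI * b * INR (S k))))).
Proof.
  intros; apply fbound_decay; auto; pose proof PI_RGT_0.
  apply Rmult_lt_0_compat; auto; lra.
Qed.

Lemma qgrowth_1 : qgrowth (fun _ => 1).
Proof.
  intros k; rewrite Rabs_R1.
  assert (1 <= INR (S k)) by (rewrite S_INR; pose proof (pos_INR k); lra); nra.
Qed.

Lemma FD_qs w n : qgrowth w -> FD nat_wt qdom 3 n (fun k z => RtoC (w k) * gq (z + INR (S k) * qtau))%C.
Proof.
  intros Hw.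
  replace (fun k z => RtoC (w k) * gq (z + INR (S k) * qtau))%C with (fun k z =>
    (RtoC (w k * exp (- (2 * PI * b * INR (S k)))) * cexp (kap * z)
   * / (1 - RtoC (1 * exp (- (2 * PI * b * INR (S k)))) * cexp (kap * z)))%C)
    by (do 2 (apply functional_extensionality; intros); rewrite qs_term; auto).
  assert (HE : forall u, qgrowth u -> FD nat_wt qdom 3 n
    (fun k z => RtoC (u k * exp (- (2 * PI * b * INR (S k)))) * cexp (kap * z))%C).
  { intros u Hu; apply (FD_exp nat_wt qdom 3 n (fun k => RtoC (u k * exp (- (2 * PI * b * INR (S k)))))
      (fun _ => kap) (Cmod kap)); auto using nat_wt01, fbound_qcoef; intros; lra. }
  apply (FD_mul nat_wt nat_wt01 qdom 3 0); auto.
  apply FD_inv; [apply nat_wt01| |].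
  - intros z Hz; apply lower_bound_one_minus.
    + apply fbound_weaken with 3%nat; auto using nat_wt01.
      apply (FD_bound nat_wt _ _ _ _ z (HE _ qgrowth_1)); auto.
    + intros k E; apply (Hz k); rewrite nome_add, nome_qtau; rewrite Rmult_1_l in E.
      rewrite Cmult_comm; exact E.
  - apply FD_minus; [apply nat_wt01|apply FD_scalar|].
    apply FD_weaken with 3%nat; [apply nat_wt01|lia|]; apply (HE _ qgrowth_1).
Qed.

Lemma Diff_qs w n : qgrowth w -> Diff qdom n (qs w).
Proof. intros; apply (Diff_fsum _ nat_wt 2 exhausting_nat), FD_qs; auto. Qed.

Lemma fbound_qs w z : qgrowth w -> qdom z ->
  fbound nat_wt 3 (fun k => RtoC (w k) * gq (z + INR (S k) * qtau))%C.
Proof. intros Hw Hz; apply (FD_bound nat_wt _ _ _ _ z (FD_qs w 0 Hw)); auto. Qed.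

Lemma not_lattice_nome z : ~ lattice qtau z -> nome z <> 1%C.
Proof.
  intros Hz E; apply nome_eq_1 in E; destruct E as [m ->]; apply Hz.
  exists m, 0%Z; unfold grid; ring.
Qed.

Lemma not_lattice_qdom z : ~ lattice qtau z -> qdom z.
Proof.
  intros Hz k; apply not_lattice_nome, not_lattice_add; auto.
  exists 0%Z, (Z.of_nat (S k)); unfold grid; rewrite <- INR_IZR_INZ; ring.
Qed.

Lemma qdom_shift z : qdom z -> qdom (z + qtau)%C.
Proof.
  intros Hz k; specialize (Hz (S k)); rewrite (S_INR (S k)), RtoC_plus in Hz.
  replace (z + qtau + INR (S k) * qtau)%C with (z + (INR (S k) + 1) * qtau)%C by ring; auto.
Qed.

Lemma qdom_small z : Cmod z < b -> qdom z.
Proof.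
  intros Hz k E.
  assert (Cmod (nome (z + INR (S k) * qtau)) = 1) by (rewrite E; apply Cmod_1).
  rewrite Cmod_nome in H.
  assert (1 <= INR (S k)) by (rewrite S_INR; pose proof (pos_INR k); lra).
  pose proof (Rabs_snd_le z); pose proof (Rle_abs (- snd z)); rewrite Rabs_Ropp in H2.
  replace (snd (z + INR (S k) * qtau)%C) with (snd z + INR (S k) * b) in H
    by (unfold qtau; simpl; ring).
  assert (0 < 2 * PI * (snd z + INR (S k) * b)).
  { pose proof PI_RGT_0; apply Rmult_lt_0_compat; [lra|]; nra. }
  rewrite <- exp_0 in H; apply exp_inv in H; lra.
Qed.

(** Translating z by i b lowers the index by one; in exchange the weights move up and the first term
    splits off. *)
Lemma qs_peel u z : qgrowth u -> qgrowth (fun k => u (S k)) -> qdom z ->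
  qs u z = (RtoC (u 0%nat) * gq (z + qtau) + qs (fun k => u (S k)) (z + qtau))%C.
Proof.
  intros Hu Hu' Hz; unfold qs.
  assert (E : forall k, (RtoC (u (S k)) * gq (z + INR (S (S k)) * qtau))%C =
    (RtoC (u (S k)) * gq (z + qtau + INR (S k) * qtau))%C).
  { intros k; rewrite (S_INR (S k)), RtoC_plus; do 2 f_equal; ring. }
  rewrite fsum_nat_peel.
  - f_equal; [simpl INR; do 2 f_equal; ring|apply fsum_ext; auto].
  - apply fbound_qs; auto.
  - replace (fun k => (RtoC (u (S k)) * gq (z + INR (S (S k)) * qtau))%C)
      with (fun k => (RtoC (u (S k)) * gq (z + qtau + INR (S k) * qtau))%C)
      by (apply functional_extensionality; auto).
    apply (fbound_qs (fun k => u (S k))); auto using qdom_shift.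
Qed.

Lemma qs_lin u v c z : qgrowth u -> qgrowth v -> qdom z ->
  qs (fun k => u k + c * v k) z = (qs u z + RtoC c * qs v z)%C.
Proof.
  intros Hu Hv Hz; unfold qs.
  rewrite <- (fsum_scal _ nat_wt 2 exhausting_nat), <- (fsum_add _ nat_wt 2 exhausting_nat).
  - apply fsum_ext; intros k; rewrite RtoC_plus, RtoC_mult; ring.
  - apply fbound_qs; auto.
  - apply (fbound_mul nat_wt 0 3 (fun _ => RtoC c)); [|apply fbound_qs; auto].
    apply fbound_0 with (Cmod c); intros; lra.
  - apply fbound_qs; auto.
Qed.

Lemma qs_shift1 w z : qs w (z + 1)%C = qs w z.
Proof.
  apply fsum_ext; intros k; f_equal.
  replace (z + 1 + INR (S k) * qtau)%C with (z + INR (S k) * qtau + 1)%C by ring; apply gq_shift1.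
Qed.

(** The weights 1, k, k^2 for k >= 1, from the expansion of (k + s)^2 in powers of s. *)
Definition w0 (_ : nat) : R := 1.
Definition w1 (k : nat) : R := INR (S k).
Definition w2 (k : nat) : R := INR (S k) ^ 2.

Lemma qgrowth_w0 : qgrowth w0. Proof. exact qgrowth_1. Qed.

Lemma qgrowth_w1 : qgrowth w1.
Proof.
  intros k; unfold w1.
  assert (1 <= INR (S k)) by (rewrite S_INR; pose proof (pos_INR k); lra).
  rewrite Rabs_pos_eq; nra.
Qed.

Lemma qgrowth_w2 : qgrowth w2.
Proof. intros k; unfold w2; rewrite Rabs_pos_eq; [lra|apply pow2_ge_0]. Qed.

Lemma qgrowth_INR : qgrowth INR.
Proof. intros k; pose proof (pos_INR k); rewrite Rabs_pos_eq, S_INR; nra. Qed.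

Lemma qgrowth_INR2 : qgrowth (fun k => INR k ^ 2).
Proof.
  intros k; pose proof (pos_INR k); rewrite Rabs_pos_eq, S_INR by (apply pow2_ge_0); nra.
Qed.

Hint Resolve qgrowth_w0 qgrowth_w1 qgrowth_w2 qgrowth_INR qgrowth_INR2 : core.

Lemma qs0_down z : qdom z -> qs w0 (z + qtau)%C = (qs w0 z - gq (z + qtau))%C.
Proof.
  intros Hz; rewrite (qs_peel w0 z) by auto.
  change (fun k => w0 (S k)) with w0; unfold w0 at 2; ring.
Qed.

(** Peeling is applied to the weight k - 1, whose first value is 0, so no term splits off; linearity
    rewrites k - 1 through [w1] and [w0]. The next lemma does the same with (k - 1)^2. *)
Lemma qs1_down z : qdom z -> qs w1 (z + qtau)%C = (qs w1 z - qs w0 z)%C.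
Proof.
  intros Hz; pose proof (qs_peel INR z) as E.
  assert (H : qs INR z = (qs w1 z + RtoC (-1) * qs w0 z)%C).
  { rewrite <- qs_lin by auto; f_equal; apply functional_extensionality; intros k.
    unfold w1, w0; rewrite S_INR; ring. }
  rewrite E in H by auto; simpl INR in H at 1.
  change (fun k => INR (S k)) with w1 in H.
  replace (qs w1 (z + qtau)%C) with (0 * gq (z + qtau) + qs w1 (z + qtau))%C by ring; rewrite H.
  replace (RtoC (-1)) with (- (1))%C by (apply injective_projections; simpl; ring); ring.
Qed.

Lemma qs2_down z : qdom z -> qs w2 (z + qtau)%C = (qs w2 z - 2 * qs w1 z + qs w0 z)%C.
Proof.
  intros Hz; pose proof (qs_peel (fun k => INR k ^ 2) z) as E.
  assert (H : qs (fun k => INR k ^ 2) z = (qs w2 z + RtoC (-2) * qs w1 z + RtoC 1 * qs w0 z)%C).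
  { rewrite <- qs_lin, <- qs_lin; auto.
    - f_equal; apply functional_extensionality; intros k; unfold w2, w1, w0; rewrite S_INR; ring.
    - intros k; unfold w2, w1; rewrite S_INR; pose proof (pos_INR k).
      apply Rabs_le; nra. }
  rewrite E in H by auto; simpl INR in H at 1.
  change (fun k => INR (S k) ^ 2) with w2 in H.
  replace (0 ^ 2) with 0 in H by ring.
  replace (qs w2 (z + qtau)%C) with (0 * gq (z + qtau) + qs w2 (z + qtau))%C by ring; rewrite H.
  replace (RtoC (-2)) with (- (2))%C by (apply injective_projections; simpl; ring); ring.
Qed.


End QSeries.

(** [qA0], [qA1], [qA2] are the regularised sums over all integers k of k^j g(z + k i b), j = 0, 1,
    2: for negative k the term g is replaced by g + 1, which is minus g at the opposite point. *)
Definition qA0 b z := (gq z + qs b w0 z - qs b w0 (- z))%C.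
Definition qA1 b z := (qs b w1 z + qs b w1 (- z))%C.
Definition qA2 b z := (qs b w2 z - qs b w2 (- z))%C.

Lemma gq_neg b z : ~ lattice (qtau b) z -> gq (- z)%C = (- (1) - gq z)%C.
Proof. intros; apply gq_opp, (not_lattice_nome b); auto. Qed.

Section Shift.

Context (b : R) (z : C).
Hypothesis b0 : 0 < b.
Hypothesis Hz : ~ lattice (qtau b) z.

(** The downward shift rules are applied at -(z + i b) and solved for the values there; the
    reflection rule for g creates the constants -1. *)
Lemma qs_neg_shift :
  qs b w0 (- (z + qtau b))%C = (qs b w0 (- z) - 1 - gq z)%C /\
  qs b w1 (- (z + qtau b))%C = (qs b w1 (- z) + qs b w0 (- z) - 1 - gq z)%C /\
  qs b w2 (- (z + qtau b))%C = (qs b w2 (- z) + 2 * qs b w1 (- z) + qs b w0 (- z) - 1 - gq z)%C.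
Proof.
  assert (Hy : qdom b (- (z + qtau b))%C).
  { apply not_lattice_qdom, not_lattice_opp, not_lattice_add; auto using lattice_tau. }
  pose proof (qs0_down b b0 _ Hy) as E0; pose proof (qs1_down b b0 _ Hy) as E1;
    pose proof (qs2_down b b0 _ Hy) as E2.
  replace (- (z + qtau b) + qtau b)%C with (- z)%C in E0, E1, E2 by ring.
  rewrite (gq_neg b z Hz) in E0; rewrite E2, E1, E0; repeat split; ring.
Qed.

Lemma qA0_shift : qA0 b (z + qtau b)%C = (qA0 b z + 1)%C.
Proof.
  unfold qA0; rewrite (proj1 qs_neg_shift), (qs0_down b b0) by (apply not_lattice_qdom; auto); ring.
Qed.

Lemma qA1_shift : qA1 b (z + qtau b)%C = (qA1 b z - qA0 b z - 1)%C.
Proof.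
  unfold qA1, qA0; rewrite (proj1 (proj2 qs_neg_shift)), (qs1_down b b0) by (apply not_lattice_qdom; auto); ring.
Qed.

Lemma qA2_shift : qA2 b (z + qtau b)%C = (qA2 b z - 2 * qA1 b z + qA0 b z + 1)%C.
Proof.
  unfold qA2, qA1, qA0; rewrite (proj2 (proj2 qs_neg_shift)), (qs2_down b b0) by (apply not_lattice_qdom; auto); ring.
Qed.

Lemma qA_shift1 : qA0 b (z + 1)%C = qA0 b z /\ qA1 b (z + 1)%C = qA1 b z /\ qA2 b (z + 1)%C = qA2 b z.
Proof.
  assert (E : forall w, qs b w (- (z + 1))%C = qs b w (- z)%C).
  { intros w; rewrite <- (qs_shift1 b w (- (z + 1))%C); f_equal; ring. }
  unfold qA0, qA1, qA2; rewrite !E, !qs_shift1, gq_shift1; auto.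
Qed.

Lemma qA0_neg : qA0 b (- z)%C = (- (1) - qA0 b z)%C.
Proof. unfold qA0; rewrite (gq_neg b) by auto; replace (- - z)%C with z by ring; ring. Qed.

Lemma qA2_neg : qA2 b (- z)%C = (- qA2 b z)%C.
Proof. unfold qA2; replace (- - z)%C with z by ring; ring. Qed.

(** The positive factor in Im g(x) = sin(2 pi Re x) times e^(-2 pi Im x) / |1 - e^(2 pi i x)|^2. *)
Definition gpos (x : C) : R := exp (- (2 * PI * snd x)) / Cmod (1 - nome x) ^ 2.

Lemma gpos_pos x : nome x <> 1%C -> 0 < gpos x.
Proof.
  intros H; apply Rdiv_lt_0_compat; [apply exp_pos|]; apply pow_lt, Cmod_gt_0.
  intros E; apply H; replace (nome x) with (1 - (1 - nome x))%C by ring; rewrite E; ring.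
Qed.

Lemma snd_gq x : nome x <> 1%C -> snd (gq x) = sin (2 * PI * fst x) * gpos x.
Proof.
  intros H; unfold gq, gpos.
  assert (H' : (1 - nome x)%C <> 0%C).
  { intros E; apply H; replace (nome x) with (1 - (1 - nome x))%C by ring; rewrite E; ring. }
  assert (E : nome x = (exp (- (2 * PI * snd x)) * cos (2 * PI * fst x),
                        exp (- (2 * PI * snd x)) * sin (2 * PI * fst x))).
  { unfold nome, cexp, kap; simpl; f_equal; f_equal; f_equal; ring. }
  apply Cmod_gt_0 in H'; pose proof (Cmod2_alt (1 - nome x)%C) as Hm.
  unfold Re, Im in Hm; rewrite Hm.
  assert (P : 0 < Cmod (1 - nome x) ^ 2) by (apply pow_lt; auto).
  rewrite Hm in P; rewrite E in *; simpl in *; field; lra.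
Qed.

(** In this combination the terms at z + k i b carry (k + s)^2 and those at -z + k i b carry -(k -
    s)^2. The sine of the opposite real part supplies a second sign, so all imaginary parts are the
    same sine times nonnegative numbers. *)
Lemma q_imaginary_part (s : R) :
  snd (qA2 b z + 2 * s * qA1 b z + s * s * qA0 b z)%C = 0 -> sin (2 * PI * fst z) = 0.
Proof.
  intros H0.
  assert (Hz' : ~ lattice (qtau b) (- z)%C) by (apply not_lattice_opp; auto).
  pose proof (not_lattice_qdom b z Hz) as Dz; pose proof (not_lattice_qdom b _ Hz') as Dz'.
  assert (CV : forall w y, qgrowth w -> qdom b y -> Ccv (fun N => csum (fun k => RtoC (w k) *
      gq (y + INR (S k) * qtau b))%C (seq 0 N)) (qs b w y)).
  { intros w y Hw Hy; apply (fsum_cv _ nat_wt 2 exhausting_nat), (fbound_qs b b0); auto. }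
  set (x := fun k => (z + INR (S k) * qtau b)%C).
  set (y := fun k => (- z + INR (S k) * qtau b)%C).
  set (F := fun k => ((INR (S k) + s) * (INR (S k) + s) * gq (x k)
                      - (INR (S k) - s) * (INR (S k) - s) * gq (y k))%C).
  assert (CF : Ccv (fun N => s * s * gq z + csum F (seq 0 N))%C
    (qA2 b z + 2 * s * qA1 b z + s * s * qA0 b z)%C).
  { replace (qA2 b z + 2 * s * qA1 b z + s * s * qA0 b z)%C with
      (s * s * gq z + (qs b w2 z + (2 * s * qs b w1 z + (s * s * qs b w0 z
        + (- (1) * qs b w2 (- z) + (2 * s * qs b w1 (- z) + - (s * s) * qs b w0 (- z)))))))%C
      by (unfold qA0, qA1, qA2; ring).
    apply Ccv_ext with (fun N => s * s * gq z +
      (csum (fun k => RtoC (w2 k) * gq (z + INR (S k) * qtau b))%C (seq 0 N) +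
      (2 * s * csum (fun k => RtoC (w1 k) * gq (z + INR (S k) * qtau b))%C (seq 0 N) +
      (s * s * csum (fun k => RtoC (w0 k) * gq (z + INR (S k) * qtau b))%C (seq 0 N) +
      (- (1) * csum (fun k => RtoC (w2 k) * gq (- z + INR (S k) * qtau b))%C (seq 0 N) +
      (2 * s * csum (fun k => RtoC (w1 k) * gq (- z + INR (S k) * qtau b))%C (seq 0 N) +
      - (s * s) * csum (fun k => RtoC (w0 k) * gq (- z + INR (S k) * qtau b))%C (seq 0 N)))))))%C.
    - intros N; rewrite <- !csum_scal, <- !csum_add; f_equal; apply csum_ext; intros k.
      unfold F, x, y, w0, w1, w2; rewrite RtoC_pow; ring.
    - apply Ccv_add; [apply Ccv_const|].
      repeat apply Ccv_add; repeat apply Ccv_scal; apply CV; auto using qgrowth_w0, qgrowth_w1, qgrowth_w2. }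
  destruct CF as [_ CF]; cbv beta in CF; rewrite H0 in CF.
  destruct (Req_dec (sin (2 * PI * fst z)) 0) as [|Hs]; auto; exfalso.
  set (sn := sin (2 * PI * fst z)) in *.
  set (T := fun k => (INR (S k) + s) ^ 2 * gpos (x k) + (INR (S k) - s) ^ 2 * gpos (y k)).
  assert (Hg : 0 < gpos z) by (apply gpos_pos, (not_lattice_nome b); auto).
  assert (Gx : forall k, 0 < gpos (x k)) by (intros; apply gpos_pos, Dz).
  assert (Gy : forall k, 0 < gpos (y k)) by (intros; apply gpos_pos, Dz').
  assert (T0 : forall k, 0 <= T k).
  { intros k; specialize (Gx k); specialize (Gy k); unfold T.
    pose proof (pow2_ge_0 (INR (S k) + s)); pose proof (pow2_ge_0 (INR (S k) - s)); nra. }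
  assert (E : forall N, snd (s * s * gq z + csum F (seq 0 N))%C = sn * (s ^ 2 * gpos z + rsum T (seq 0 N))).
  { intros N.
    change (snd (s * s * gq z)%C + snd (csum F (seq 0 N)) = sn * (s ^ 2 * gpos z + rsum T (seq 0 N))).
    rewrite csum_snd.
    replace (snd (s * s * gq z)%C) with (s ^ 2 * snd (gq z)) by (simpl; ring).
    rewrite snd_gq by (apply (not_lattice_nome b); auto); fold sn.
    rewrite Rmult_plus_distr_l, <- rsum_scal; f_equal; [ring|].
    unfold rsum; f_equal; apply map_ext; intros k; unfold F, T.
    replace (snd ((INR (S k) + s) * (INR (S k) + s) * gq (x k)
                      - (INR (S k) - s) * (INR (S k) - s) * gq (y k))%C)
      with ((INR (S k) + s) ^ 2 * snd (gq (x k)) - (INR (S k) - s) ^ 2 * snd (gq (y k)))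
      by (rewrite <- RtoC_plus, <- RtoC_minus; simpl; ring).
    rewrite !snd_gq by (apply Dz || apply Dz').
    replace (fst (x k)) with (fst z) by (unfold x, qtau; simpl; ring).
    replace (fst (y k)) with (- fst z) by (unfold y, qtau; simpl; ring).
    replace (2 * PI * - fst z) with (- (2 * PI * fst z)) by ring; rewrite sin_neg; fold sn; ring. }
  (* The squares (1 + s)^2 and (1 - s)^2 cannot both vanish, so the first term already bounds the
     whole sum away from 0. *)
  assert (TP : 0 < T 0%nat).
  { unfold T; simpl INR; pose proof (Gx 0%nat); pose proof (Gy 0%nat).
    destruct (Req_dec s 1) as [Es|Es].
    - rewrite Es; assert (0 < (1 + 1) ^ 2 * gpos (x 0%nat)) by (apply Rmult_lt_0_compat; lra).
      replace ((1 - 1) ^ 2) with 0 by ring; lra.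
    - assert (0 < (1 - s) ^ 2) by (apply pow2_gt_0; lra).
      pose proof (pow2_ge_0 (1 + s)); nra. }
  assert (TN : forall N, T 0%nat <= s ^ 2 * gpos z + rsum T (seq 0 (S N))).
  { intros N; change (seq 0 (S N)) with (0%nat :: seq 1 N); rewrite rsum_cons.
    pose proof (rsum_ge0 T (seq 1 N) T0); pose proof (pow2_ge_0 s); nra. }
  assert (sp : 0 < Rabs sn) by (apply Rabs_pos_lt; auto).
  destruct (CF (Rabs sn * T 0%nat)) as [N HN]; [apply Rmult_lt_0_compat; auto|].
  specialize (HN (S N) ltac:(lia)); rewrite E in HN; unfold Rdist in HN.
  rewrite Rminus_0_r, Rabs_mult in HN.
  apply Rmult_lt_reg_l in HN; auto; specialize (TN N); pose proof (Rle_abs (s ^ 2 * gpos z + rsum T (seq 0 (S N)))).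
  lra.
Qed.

End Shift.

Lemma Diff_neg (D : C -> Prop) n f : (forall z, D z -> D (- z)%C) -> Diff D n f -> Diff D n (fun z => f (- z)%C).
Proof.
  intros HD Hf.
  replace (fun z => f (- z)%C) with (fun z => f (- (1) * z + 0)%C)
    by (apply functional_extensionality; intros; f_equal; ring).
  eapply Diff_sub; [|apply Diff_affine, Hf]; simpl; intros z Hz.
  replace (- (1) * z + 0)%C with (- z)%C by ring; auto.
Qed.

Lemma Diff_cexp D n a : Diff D n (fun z => cexp (a * z)%C).
Proof.
  replace (fun z => cexp (a * z)%C) with (fun z => 1 * cexp (a * z))%C
    by (apply functional_extensionality; intros; ring).
  apply (FD_exp unit_wt D 0 n (fun _ => RtoC 1) (fun _ => a) (Cmod a)); auto using unit_wt01.
  - intros; lra.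
  - apply (fbound_unit 0).
Qed.

Lemma Diff_gq b n : Diff (fun z => ~ lattice (qtau b) z) n gq.
Proof.
  apply Diff_mul; [apply Diff_cexp|apply Diff_inv].
  - intros z Hz E; apply (not_lattice_nome b z Hz).
    replace (nome z) with (1 - (1 - nome z))%C by ring; rewrite E; ring.
  - apply Diff_minus; [apply Diff_const|apply Diff_cexp].
Qed.

Ltac solve_Diff :=
  repeat first [assumption | apply Diff_const | apply Diff_id
               | apply Diff_opp | apply Diff_minus | apply Diff_add | apply Diff_mul].

(** * Identification of the elliptic functions of a rectangular lattice with q-series *)

Section Kernel.

Context (b : R) (phi P Q vv uu u1 : C -> C) (delta : C) (d : R).
Hypothesis b0 : 0 < b.
Hypothesis d0 : 0 < d.
Let L := lattice (qtau b).
Let off := fun z => ~ L z.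
Let ball := fun z : C => Cmod z < d.
Hypothesis Dphi : Diff off 4 phi.
Hypothesis DP : Diff off 4 P.
Hypothesis DQ : Diff off 4 Q.
Hypothesis Dvv : Diff ball 4 vv.
Hypothesis Duu : Diff ball 4 uu.
Hypothesis Du1 : Diff ball 4 u1.
Hypothesis Ephi : forall z, off z -> ball z -> phi z = (/ z + z * vv z)%C.
Hypothesis EP : forall z, off z -> ball z -> P z = (/ (z * z) + z * uu z)%C.
Hypothesis EQ : forall z, off z -> ball z -> Q z = (- (2) * / (z * z * z) + u1 z)%C.
Hypothesis phi_1 : forall z, off z -> phi (z + 1)%C = phi z.
Hypothesis P_1 : forall z, off z -> P (z + 1)%C = P z.
Hypothesis Q_1 : forall z, off z -> Q (z + 1)%C = Q z.
Hypothesis phi_tau : forall z, off z -> phi (z + qtau b)%C = (phi z - delta)%C.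
Hypothesis P_tau : forall z, off z -> P (z + qtau b)%C = P z.
Hypothesis Q_tau : forall z, off z -> Q (z + qtau b)%C = Q z.
Hypothesis phi_odd : forall z, off z -> phi (- z)%C = (- phi z)%C.
Hypothesis P_even : forall z, off z -> P (- z)%C = P z.
Hypothesis Q_odd : forall z, off z -> Q (- z)%C = (- Q z)%C.

Let Hq : 0 < snd (qtau b) := qtau_im b b0.

Lemma half_off : off (RtoC (1 / 2)).
Proof.
  replace (RtoC (1 / 2)) with (grid (qtau b) (IZR 1 / 2) (IZR 0 / 2))
    by (unfold grid, Rdiv; rewrite Rmult_0_l; ring).
  apply half_not_lattice; auto.
Qed.

Lemma off_neq_0 z : off z -> z <> 0%C.
Proof. intros H ->; apply H, lattice_0. Qed.

(** A radius on which three things hold together: the local expansions, the absence of poles of the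
    q-series, and the formula for [bern]. *)
Let rho := Rmin d (Rmin b (1 / (24 * (Cmod kap + 1)))).

Lemma rho_pos : 0 < rho.
Proof.
  pose proof (Cmod_ge_0 kap).
  repeat apply Rmin_pos; auto; apply Rdiv_lt_0_compat; lra.
Qed.

Lemma rho_spec z : Cmod z < rho ->
  Cmod z < d /\ qdom b z /\ qdom b (- z)%C /\ Cmod (kap * z) <= 1 / 24 /\ Cmod (kap * z) < 1.
Proof.
  intros H; unfold rho in H.
  pose proof (Rmin_l d (Rmin b (1 / (24 * (Cmod kap + 1))))).
  pose proof (Rmin_r d (Rmin b (1 / (24 * (Cmod kap + 1))))).
  pose proof (Rmin_l b (1 / (24 * (Cmod kap + 1)))).
  pose proof (Rmin_r b (1 / (24 * (Cmod kap + 1)))).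
  assert (Hk : Cmod (kap * z) <= 1 / 24).
  { rewrite Cmod_mult; pose proof (Cmod_ge_0 kap); pose proof (Cmod_ge_0 z).
    assert (Hz : Cmod z < 1 / (24 * (Cmod kap + 1))) by lra.
    apply Rmult_lt_compat_l with (r := Cmod kap + 1) in Hz; [|lra].
    replace ((Cmod kap + 1) * (1 / (24 * (Cmod kap + 1)))) with (1 / 24) in Hz by (field; lra).
    lra. }
  split; [lra|split; [apply qdom_small; auto; lra|split; [|lra]]].
  apply qdom_small; auto; rewrite Cmod_opp; lra.
Qed.

Lemma Diff_small_qs w n : qgrowth w ->
  Diff (fun z => Cmod z < rho) n (qs b w) /\ Diff (fun z => Cmod z < rho) n (fun z => qs b w (- z)%C).
Proof.
  intros Hw; assert (H : Diff (fun z => Cmod z < rho) n (qs b w)).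
  { eapply Diff_sub; [|apply (Diff_qs b b0); auto]; intros z Hz; apply rho_spec; auto. }
  split; auto; apply Diff_neg; auto; intros z Hz; rewrite Cmod_opp; auto.
Qed.

Lemma Diff_off_qs w n : qgrowth w -> Diff off n (qs b w) /\ Diff off n (fun z => qs b w (- z)%C).
Proof.
  intros Hw; assert (H : Diff off n (qs b w)).
  { eapply Diff_sub; [|apply (Diff_qs b b0); auto]; intros z Hz; apply not_lattice_qdom; auto. }
  split; auto; apply Diff_neg; auto; intros z Hz; apply not_lattice_opp; auto.
Qed.

Lemma Diff_off_qA : Diff off 4 (qA0 b) /\ Diff off 4 (qA1 b) /\ Diff off 4 (qA2 b).
Proof.
  destruct (Diff_off_qs w0 4 qgrowth_w0), (Diff_off_qs w1 4 qgrowth_w1), (Diff_off_qs w2 4 qgrowth_w2).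
  split; [|split].
  - apply Diff_minus; auto; apply Diff_add; auto; apply Diff_gq.
  - apply Diff_add; auto.
  - apply Diff_minus; auto.
Qed.

Lemma Diff_small_sub f n : Diff ball n f -> Diff (fun z => Cmod z < rho) n f.
Proof. apply Diff_sub; intros z Hz; apply rho_spec; auto. Qed.

Lemma gq_near_0 z : off z -> Cmod z < rho -> gq z = (- (1) - / (kap * z) - bern (kap * z))%C.
Proof.
  intros Hz Hr; pose proof kap_neq_0; pose proof (off_neq_0 z Hz).
  assert (kz : (kap * z)%C <> 0%C) by (apply Cmult_neq_0; auto).
  destruct (bern_correct (kap * z)%C kz) as [H1 H2]; [apply rho_spec; auto|].
  unfold gq; fold (nome z) in *.
  replace (- (1) - / (kap * z) - bern (kap * z))%C with (- (1) - (/ (kap * z) + bern (kap * z)))%C by ring.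
  rewrite <- H2.
  assert ((nome z - 1)%C <> 0%C).
  { intros E; apply H1; replace (nome z) with (nome z - 1 + 1)%C by ring; rewrite E; ring. }
  assert ((1 - nome z)%C <> 0%C).
  { intros E; apply H3; replace (nome z - 1)%C with (- (1 - nome z))%C by ring; rewrite E; ring. }
  field; auto.
Qed.

(** [phi] stands for zeta made 1-periodic by a linear term. Its pole 1/z cancels that of [kap]
    [qA0], so the sum is affine with slope 0. Being constant, it has no increment over i b, which
    gives Legendre's relation [delta] = 2 pi i; oddness fixes the constant. *)
Lemma phi_qA0 : delta = kap /\ forall z, off z -> phi z = (- kap * (qA0 b z + 1 / 2))%C.
Proof.
  destruct (quasi_periodic_affine (qtau b) (fun z => phi z + kap * qA0 b z)%C
    (fun z => z * vv z + kap * (- (1) - bern (kap * z + 0) + (qs b w0 z - qs b w0 (- z))))%C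
    0%C (kap - delta)%C rho) as [c [_ Hc]]; auto.
  - apply rho_pos.
  - apply Diff_add; auto; apply Diff_mul; [apply Diff_const|apply Diff_off_qA].
  - destruct (Diff_small_qs w0 4 qgrowth_w0).
    apply Diff_add; [apply Diff_mul; [apply Diff_id|apply Diff_small_sub; auto]|].
    apply Diff_mul; [apply Diff_const|]; apply Diff_add; [|apply Diff_minus; auto].
    apply Diff_minus; [apply Diff_const|].
    eapply Diff_sub; [|apply (Diff_affine (fun z => Cmod z < 1)), Diff_bern]; simpl.
    intros z Hz; replace (kap * z + 0)%C with (kap * z)%C by ring; apply rho_spec; auto.
  - intros z Hz Hr; rewrite Ephi by (auto; apply rho_spec; auto).
    unfold qA0; rewrite gq_near_0 by auto.
    replace (kap * z + 0)%C with (kap * z)%C by ring.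
    pose proof kap_neq_0; pose proof (off_neq_0 z Hz); field; auto.
  - intros z Hz; rewrite phi_1, (proj1 (qA_shift1 b z)) by auto; ring.
  - intros z Hz; rewrite phi_tau, qA0_shift by auto; ring.
  - pose proof half_off as Hh; set (h := RtoC (1 / 2)) in *.
    assert (Hh' : off (- h)%C) by (apply not_lattice_opp; auto).
    assert (Hc2 : (c + c)%C = (- kap)%C).
    { pose proof (Hc h Hh) as E1; pose proof (Hc _ Hh') as E2.
      rewrite phi_odd, qA0_neg in E2 by auto.
      transitivity ((0 * h + c) + (0 * - h + c))%C; [ring|].
      rewrite <- E1, <- E2; ring. }
    assert (Hc' : c = (- kap / 2)%C) by (rewrite <- Hc2; field).
    split.
    + pose proof (Hc h Hh) as E1.
      assert (Hht : off (h + qtau b)%C) by (apply not_lattice_add; auto using lattice_tau).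
      pose proof (Hc _ Hht) as E2; rewrite phi_tau, qA0_shift in E2 by auto.
      replace delta with (kap - ((phi h - delta + kap * (qA0 b h + 1)) - (phi h + kap * qA0 b h)))%C by ring.
      rewrite E1, E2; ring.
    + intros z Hz; pose proof (Hc z Hz) as E.
      replace (phi z) with (phi z + kap * qA0 b z - kap * qA0 b z)%C by ring.
      rewrite E, Hc'; field.
Qed.

(** The double poles of phi^2 and P cancel, and by [phi_qA0] the increment over i b is compensated
    by that of [qA1]. Both sides are even, so parity gives no information on the constant; it is
    determined at the next order. *)
Lemma P_qA1 : exists c1, forall z, off z -> (phi z * phi z - P z)%C = (c1 - 2 * kap * kap * qA1 b z)%C.
Proof.
  destruct phi_qA0 as [Ed Ephi'].
  destruct (quasi_periodic_affine (qtau b) (fun z => phi z * phi z - P z + 2 * kap * kap * qA1 b z)%C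
    (fun z => 2 * vv z + z * vv z * (z * vv z) - z * uu z
              + 2 * kap * kap * (qs b w1 z + qs b w1 (- z)))%C
    0%C 0%C rho) as [c [_ Hc]]; auto.
  - apply rho_pos.
  - apply Diff_add; [apply Diff_minus; auto; apply Diff_mul; auto|].
    apply Diff_mul; [apply Diff_const|apply Diff_off_qA].
  - destruct (Diff_small_qs w1 4 qgrowth_w1).
    pose proof (Diff_small_sub _ _ Dvv); pose proof (Diff_small_sub _ _ Duu).
    solve_Diff.
  - intros z Hz Hr; destruct (rho_spec z Hr) as [Hd _].
    rewrite Ephi, EP by auto; unfold qA1.
    pose proof (off_neq_0 z Hz); field; auto.
  - intros z Hz; rewrite phi_1, P_1, (proj1 (proj2 (qA_shift1 b z))) by auto; ring.
  - intros z Hz; rewrite phi_tau, P_tau, qA1_shift by auto; rewrite Ed.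
    replace (qA1 b z - qA0 b z - 1)%C with (qA1 b z - (qA0 b z + 1 / 2) - 1 / 2)%C by field.
    replace (2 * kap * kap * (qA1 b z - (qA0 b z + 1 / 2) - 1 / 2))%C
      with (2 * kap * kap * qA1 b z + 2 * kap * (- kap * (qA0 b z + 1 / 2)) - kap * kap)%C by field.
    rewrite <- (Ephi' z Hz); ring.
  - exists c; intros z Hz; pose proof (Hc z Hz) as E.
    replace (phi z * phi z - P z)%C with
      (phi z * phi z - P z + 2 * kap * kap * qA1 b z - 2 * kap * kap * qA1 b z)%C by ring.
    rewrite E; ring.
Qed.

(** The poles of phi^3 - 3 phi P - Q cancel and oddness makes the remaining constant 0. The
    increment over i b of this function involves the unknown [c1] of the previous step; since it
    must vanish, [c1] = kap^2/6. *)
Lemma PQ_qA2 : forall z, off z ->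
  (phi z * phi z - P z)%C = (kap * kap / 6 - 2 * kap * kap * qA1 b z)%C /\
  (phi z * phi z * phi z - 3 * phi z * P z - Q z)%C = (- (3) * kap * kap * kap * qA2 b z)%C.
Proof.
  destruct phi_qA0 as [Ed Ephi']; destruct P_qA1 as [c1 EA1].
  destruct (quasi_periodic_affine (qtau b)
    (fun z => phi z * phi z * phi z - 3 * phi z * P z - Q z + 3 * kap * kap * kap * qA2 b z)%C
    (fun z => 3 * z * vv z * vv z + z * vv z * (z * vv z) * (z * vv z) - 3 * uu z
              - 3 * (z * uu z) * (z * vv z) - u1 z
              + 3 * kap * kap * kap * (qs b w2 z - qs b w2 (- z)))%C
    0%C (- (3) * kap * c1 + kap * kap * kap / 2)%C rho) as [c [_ Hc]]; auto.
  - apply rho_pos.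
  - apply Diff_add; [|apply Diff_mul; [apply Diff_const|apply Diff_off_qA]].
    solve_Diff.
  - destruct (Diff_small_qs w2 4 qgrowth_w2).
    pose proof (Diff_small_sub _ _ Dvv); pose proof (Diff_small_sub _ _ Duu); pose proof (Diff_small_sub _ _ Du1).
    solve_Diff.
  - intros z Hz Hr; destruct (rho_spec z Hr) as [Hd _].
    rewrite Ephi, EP, EQ by auto; unfold qA2.
    pose proof (off_neq_0 z Hz); field; auto.
  - intros z Hz; rewrite phi_1, P_1, Q_1, (proj2 (proj2 (qA_shift1 b z))) by auto; ring.
  - intros z Hz; rewrite phi_tau, P_tau, Q_tau, qA2_shift by auto; rewrite Ed.
    pose proof (EA1 z Hz) as E1; pose proof (Ephi' z Hz) as E2.
    set (f := phi z) in *; set (p := P z) in *; set (a1 := qA1 b z) in *; set (a0 := qA0 b z) in *.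
    replace p with (f * f - (f * f - p))%C by ring; rewrite E1, E2; field.
  - assert (G : forall z, off z -> c = 0%C).
    { intros z Hz; assert (Hz' : off (- z)%C) by (apply not_lattice_opp; auto).
      pose proof (Hc z Hz) as E1; pose proof (Hc _ Hz') as E2.
      rewrite phi_odd, P_even, Q_odd, qA2_neg in E2 by auto.
      replace c with (((0 * z + c) + (0 * - z + c)) / 2)%C by field.
      rewrite <- E1, <- E2; field. }
    intros z Hz; pose proof (G z Hz) as c0.
    assert (Hzt : off (z + qtau b)%C) by (apply not_lattice_add; auto using lattice_tau).
    pose proof (Hc z Hz) as E1; pose proof (Hc _ Hzt) as E2.
    rewrite c0 in *.
    split.
    + rewrite (EA1 z Hz).
      rewrite phi_tau, P_tau, Q_tau, qA2_shift in E2 by auto; rewrite Ed in E2.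
      pose proof (EA1 z Hz) as E3; pose proof (Ephi' z Hz) as E4.
      set (f := phi z) in *; set (p := P z) in *; set (a1 := qA1 b z) in *; set (a0 := qA0 b z) in *;
        set (a2 := qA2 b z) in *; set (q := Q z) in *.
      (* The increment over i b computed from the shift rules, set equal to 0 because the function
         is constant. *)
      assert (K : (- (3) * kap * c1 + kap * kap * kap / 2)%C = 0%C).
      { transitivity (((f - kap) * (f - kap) * (f - kap) - 3 * (f - kap) * p - q
          + 3 * kap * kap * kap * (a2 - 2 * a1 + a0 + 1))
          - (f * f * f - 3 * f * p - q + 3 * kap * kap * kap * a2))%C.
        - replace p with (f * f - (f * f - p))%C by ring; rewrite E3, E4; field.
        - rewrite E1, E2; ring. }
      pose proof kap_neq_0.
      replace c1 with (kap * kap / 6 - (- (3) * kap * c1 + kap * kap * kap / 2) / (3 * kap))%C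
        by (field; auto).
      rewrite K; field; auto.
    + transitivity (phi z * phi z * phi z - 3 * phi z * P z - Q z + 3 * kap * kap * kap * qA2 b z
        - 3 * kap * kap * kap * qA2 b z)%C; [ring|]; rewrite E1; ring.
Qed.

(** Expanding the cubic in s and substituting the three identities gives -3 kap^3 times the q-series
    combination minus B_3(s)/3, with B_3 the third Bernoulli polynomial. For real s this last term
    is real, so a zero forces the imaginary part of the series to vanish. *)
Lemma kernel_zero_sin (s : R) z : off z ->
  ((phi z + delta * s) * (phi z + delta * s) * (phi z + delta * s)
   - 3 * P z * (phi z + delta * s) - Q z)%C = 0%C ->
  sin (2 * PI * fst z) = 0.
Proof.
  intros Hz H; destruct phi_qA0 as [Ed Ephi']; destruct (PQ_qA2 z Hz) as [E1 E2].
  pose proof (Ephi' z Hz) as E0; rewrite Ed in H.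
  assert (K : (- (3) * kap * kap * kap * ((qA2 b z + 2 * s * qA1 b z + s * s * qA0 b z)
     - RtoC (s ^ 3 / 3 - s ^ 2 / 2 + s / 6)))%C = 0%C).
  { rewrite <- H.
    transitivity ((phi z * phi z * phi z - 3 * phi z * P z - Q z)
      + 3 * kap * s * (phi z * phi z - P z) + 3 * kap * kap * s * s * phi z + kap * kap * kap * s * s * s)%C;
      [|ring].
    replace (RtoC (s ^ 3 / 3 - s ^ 2 / 2 + s / 6)) with (s * s * s / 3 - s * s / 2 + s / 6)%C
      by (apply injective_projections; simpl; field).
    rewrite E1, E2, E0; field. }
  assert (K2 : (qA2 b z + 2 * s * qA1 b z + s * s * qA0 b z)%C = RtoC (s ^ 3 / 3 - s ^ 2 / 2 + s / 6)).
  { pose proof kap_neq_0 as k0.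
    set (X := (qA2 b z + 2 * s * qA1 b z + s * s * qA0 b z)%C) in *; set (Y := RtoC (s ^ 3 / 3 - s ^ 2 / 2 + s / 6)) in *.
    replace X with (Y + (- (3) * kap * kap * kap * (X - Y)) / (- (3) * kap * kap * kap))%C by (field; auto).
    rewrite K; field; auto. }
  apply (q_imaginary_part b z b0 Hz s); rewrite K2; reflexivity.
Qed.

End Kernel.

Lemma Diff_wzeta tau n : 0 < snd tau -> Diff (fun z => ~ lattice tau z) n (fun z => wzeta z tau).
Proof.
  intros Ht; apply Diff_ext with (fun z => / z + z * z * Sv tau z)%C.
  - apply not_lattice_open; auto.
  - intros z Hz; rewrite wzeta_Sv; auto using not_lattice_offpoles.
  - apply Diff_add; [apply Diff_inv; [|apply Diff_id]; intros z Hz ->; apply Hz, lattice_0|].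
    apply Diff_mul; [apply Diff_mul; apply Diff_id|].
    eapply Diff_sub; [|apply Diff_Sv; auto]; intros; apply not_lattice_offpoles; auto.
Qed.

Lemma Diff_wp tau n : 0 < snd tau -> Diff (fun z => ~ lattice tau z) n (fun z => wp z tau).
Proof.
  intros Ht; apply Diff_ext with (fun z => / (z * z) + z * Su tau z)%C.
  - apply not_lattice_open; auto.
  - intros z Hz; rewrite wp_Su; auto using not_lattice_offpoles.
  - apply Diff_add; [apply Diff_inv; [|apply Diff_mul; apply Diff_id]|].
    + intros z Hz; assert (z <> 0%C) by (intros ->; apply Hz, lattice_0); apply Cmult_neq_0; auto.
    + apply Diff_mul; [apply Diff_id|].
      eapply Diff_sub; [|apply Diff_Su; auto]; intros; apply not_lattice_offpoles; auto.
Qed.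

Lemma Diff_wp' tau n : 0 < snd tau -> Diff (fun z => ~ lattice tau z) n (fun z => wp' z tau).
Proof.
  intros Ht; apply Diff_ext with (fun z => - (2) * (/ (z * z * z) + S3 tau z))%C.
  - apply not_lattice_open; auto.
  - intros z Hz; rewrite wp'_S3; auto using not_lattice_offpoles.
  - apply Diff_mul; [apply Diff_const|].
    apply Diff_add; [apply Diff_inv; [|apply Diff_mul; [apply Diff_mul|]; apply Diff_id]|].
    + intros z Hz; assert (z <> 0%C) by (intros ->; apply Hz, lattice_0); repeat apply Cmult_neq_0; auto.
    + eapply Diff_sub; [|apply Diff_S3; auto]; intros; apply not_lattice_offpoles; auto.
Qed.

Lemma Diff_scaled (D : C -> Prop) n w f : Diff D n f -> Diff (fun x => D (w * x)%C) n (fun x => f (w * x)%C).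
Proof.
  intros Hf; replace (fun x => f (w * x)%C) with (fun x => f (w * x + 0)%C)
    by (apply functional_extensionality; intros; f_equal; ring).
  eapply Diff_sub; [|apply Diff_affine, Hf]; simpl; intros z Hz.
  replace (w * z + 0)%C with (w * z)%C by ring; auto.
Qed.

Definition E3 (tau Z z : C) : C := (Z * Z * Z - 3 * wp z tau * Z - wp' z tau)%C.

(** * Non-vanishing of the denominator for a lattice with an orthogonal basis *)

Section OrthogonalBasis.

Context (tau : C) (a1 b1 a2 b2 : Z) (b : R).
Hypothesis Ht : 0 < snd tau.
Hypothesis b0 : 0 < b.
Hypothesis det1 : (a1 * b2 - b1 * a2 = 1)%Z.
Let om1 := grid tau (IZR a1) (IZR b1).
Let om2 := grid tau (IZR a2) (IZR b2).
Hypothesis orth : om2 = (qtau b * om1)%C.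
Let h1 := (IZR a1 * eta1 tau + IZR b1 * eta2 tau)%C.
Let h2 := (IZR a2 * eta1 tau + IZR b2 * eta2 tau)%C.

Lemma detR : IZR a1 * IZR b2 - IZR b1 * IZR a2 = 1.
Proof. rewrite <- !mult_IZR, <- minus_IZR, det1; auto. Qed.

Lemma om1_neq_0 : om1 <> 0%C.
Proof.
  intros E; pose proof detR; unfold om1 in E.
  replace (RtoC 0) with (grid tau 0 0) in E by (unfold grid; ring).
  apply grid_inj in E; auto; destruct E as [E1 E2]; rewrite E1, E2 in H; lra.
Qed.

Lemma lattice_scaled x : lattice (qtau b) x <-> lattice tau (om1 * x)%C.
Proof.
  split; intros (m & n & E).
  - exists (m * a1 + n * a2)%Z, (m * b1 + n * b2)%Z; rewrite E.
    transitivity (IZR m * om1 + IZR n * om2)%C; [rewrite orth; unfold grid; ring|].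
    unfold om1, om2, grid; rewrite !plus_IZR, !mult_IZR, !RtoC_plus, !RtoC_mult; ring.
  - exists (m * b2 - n * a2)%Z, (n * a1 - m * b1)%Z.
    replace x with (om1 * x / om1)%C by (field; apply om1_neq_0).
    rewrite E.
    replace (grid tau (IZR m) (IZR n)) with
      (RtoC (IZR (m * b2 - n * a2)) * om1 + RtoC (IZR (n * a1 - m * b1)) * om2)%C.
    + rewrite orth; unfold grid; field; apply om1_neq_0.
    + transitivity (RtoC (IZR m * (IZR a1 * IZR b2 - IZR b1 * IZR a2)) +
        RtoC (IZR n * (IZR a1 * IZR b2 - IZR b1 * IZR a2)) * tau)%C.
      * unfold om1, om2, grid; rewrite !minus_IZR, !mult_IZR; apply injective_projections; simpl; ring.
      * rewrite detR, !Rmult_1_r; reflexivity.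
Qed.

Lemma off_scaled x : ~ lattice (qtau b) x -> ~ lattice tau (om1 * x)%C.
Proof. rewrite lattice_scaled; auto. Qed.

(** Homogeneity: the substitution z = [om1] x carries the lattice to Z + i b Z. Subtracting the
    linear term with coefficient [om1] [h1] makes zeta 1-periodic, and Z_{r,s} becomes phi + delta s
    with delta = [h1] [om2] - [om1] [h2]. *)
Lemma orthogonal_zero_sin (r s : R) :
  let z := (r * om1 + s * om2)%C in
  ~ lattice tau z -> E3 tau (wzeta z tau - r * h1 - s * h2)%C z = 0%C -> sin (2 * PI * r) = 0.
Proof.
  intros z Hz HE.
  destruct (offpoles_ball tau Ht) as [d [d0 Hd]].
  set (x := (r + s * qtau b)%C).
  assert (Ez : (om1 * x)%C = z) by (unfold x, z; rewrite orth; ring).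
  assert (Ht1 : forall x, (om1 * (x + 1))%C = (om1 * x + om1)%C) by (intros; ring).
  assert (Ht2 : forall x, (om1 * (x + qtau b))%C = (om1 * x + om2)%C) by (intros; rewrite orth; ring).
  pose proof (Cmod_ge_0 om1) as n0.
  assert (HB : forall y, Cmod y < d / (Cmod om1 + 1) -> offpoles tau (om1 * y)%C).
  { intros y Hy; apply Hd; rewrite Cmod_mult.
    apply Rmult_lt_compat_l with (r := Cmod om1 + 1) in Hy; [|lra].
    replace ((Cmod om1 + 1) * (d / (Cmod om1 + 1))) with d in Hy by (field; lra).
    pose proof (Cmod_ge_0 y); lra. }
  assert (SB : forall f n, Diff (offpoles tau) n f ->
     Diff (fun y => Cmod y < d / (Cmod om1 + 1)) n (fun y => f (om1 * y)%C)).
  { intros f n Hf; eapply Diff_sub; [|apply (Diff_scaled _ n om1 f Hf)]; auto. }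
  assert (SO : forall f n, Diff (fun z => ~ lattice tau z) n f ->
     Diff (fun y => ~ lattice (qtau b) y) n (fun y => f (om1 * y)%C)).
  { intros f n Hf; eapply Diff_sub; [|apply (Diff_scaled _ n om1 f Hf)]; intros; apply off_scaled; auto. }
  pose proof (SB _ 4%nat (Diff_Sv tau 4 Ht)); pose proof (SB _ 4%nat (Diff_Su tau 4 Ht));
    pose proof (SB _ 4%nat (Diff_S3 tau 4 Ht)).
  pose proof (SO _ 4%nat (Diff_wzeta tau 4 Ht)); pose proof (SO _ 4%nat (Diff_wp tau 4 Ht));
    pose proof (SO _ 4%nat (Diff_wp' tau 4 Ht)).
  assert (Hfst : fst x = r) by (unfold x, qtau; simpl; ring).
  rewrite <- Hfst.
  apply (kernel_zero_sin b
    (fun y => om1 * wzeta (om1 * y)%C tau - om1 * h1 * y)%C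
    (fun y => om1 * om1 * wp (om1 * y)%C tau)%C
    (fun y => om1 * om1 * om1 * wp' (om1 * y)%C tau)%C
    (fun y => om1 * om1 * om1 * y * Sv tau (om1 * y) - om1 * h1)%C
    (fun y => om1 * om1 * om1 * Su tau (om1 * y))%C
    (fun y => - (2) * (om1 * om1 * om1) * S3 tau (om1 * y))%C
    (h1 * om2 - om1 * h2)%C (d / (Cmod om1 + 1))) with (s := s); auto.
  - apply Rdiv_lt_0_compat; lra.
  - solve_Diff.
  - solve_Diff.
  - solve_Diff.
  - solve_Diff.
  - solve_Diff.
  - solve_Diff.
  - intros y Hy Hb; rewrite wzeta_Sv by auto.
    pose proof om1_neq_0; assert (y <> 0%C) by (intros ->; apply Hy, lattice_0).
    field; auto.
  - intros y Hy Hb; rewrite wp_Su by auto.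
    pose proof om1_neq_0; assert (y <> 0%C) by (intros ->; apply Hy, lattice_0).
    field; auto.
  - intros y Hy Hb; rewrite wp'_S3 by auto.
    pose proof om1_neq_0; assert (y <> 0%C) by (intros ->; apply Hy, lattice_0).
    field; auto.
  - intros y Hy; rewrite Ht1; unfold om1 at 3; rewrite wzeta_shift by (auto using off_scaled).
    unfold h1; ring.
  - intros y Hy; rewrite Ht1; unfold om1 at 4; rewrite wp_shift by (auto using off_scaled); auto.
  - intros y Hy; rewrite Ht1; unfold om1 at 5; rewrite wp'_shift by (auto using off_scaled); auto.
  - intros y Hy; rewrite Ht2; unfold om2 at 1; rewrite wzeta_shift by (auto using off_scaled).
    rewrite orth; unfold h1, h2; ring.
  - intros y Hy; rewrite Ht2; unfold om2 at 1; rewrite wp_shift by (auto using off_scaled); auto.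
  - intros y Hy; rewrite Ht2; unfold om2 at 1; rewrite wp'_shift by (auto using off_scaled); auto.
  - intros y Hy; replace (om1 * - y)%C with (- (om1 * y))%C by ring.
    rewrite wzeta_odd by (auto using not_lattice_offpoles, off_scaled); ring.
  - intros y Hy; replace (om1 * - y)%C with (- (om1 * y))%C by ring.
    rewrite wp_even by (auto using not_lattice_offpoles, off_scaled); ring.
  - intros y Hy; replace (om1 * - y)%C with (- (om1 * y))%C by ring.
    rewrite wp'_odd by (auto using not_lattice_offpoles, off_scaled); ring.
  - intros Hx; apply Hz; rewrite <- Ez; apply lattice_scaled; auto.
  - cbv beta; rewrite Ez.
    transitivity (om1 * om1 * om1 * E3 tau (wzeta z tau - r * h1 - s * h2)%C z)%C; [|rewrite HE; ring].
    replace (om1 * wzeta z tau - om1 * h1 * x + (h1 * om2 - om1 * h2) * s)%C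
      with (om1 * (wzeta z tau - r * h1 - s * h2))%C by (unfold x; rewrite orth; ring).
    unfold E3; ring.
Qed.

End OrthogonalBasis.

Lemma sin_2PI_zero x : sin (2 * PI * x) = 0 -> exists k : Z, x = IZR k / 2.
Proof.
  intros H; apply sin_eq_0_0 in H; destruct H as [k Hk]; exists k.
  pose proof PI_RGT_0; apply Rmult_eq_reg_l with PI; lra.
Qed.

(** The pair (r, s) is rewritten in the orthogonal basis, where one application controls each
    coordinate. Half-integrality returns to (r, s) because the base change is integral. *)
Lemma E3_rs_neq_0 tau (a1 b1 a2 b2 : Z) b (r s : R) : 0 < snd tau -> 0 < b ->
  (a1 * b2 - b1 * a2 = 1)%Z ->
  grid tau (IZR a2) (IZR b2) = (qtau b * grid tau (IZR a1) (IZR b1))%C ->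
  ~ (exists m n : Z, r = IZR m / 2 /\ s = IZR n / 2) ->
  E3 tau (wzeta (grid tau r s) tau - r * eta1 tau - s * eta2 tau)%C (grid tau r s) <> 0%C.
Proof.
  intros Ht b0 Hdet Ho Hrs HE; apply Hrs.
  pose proof (f_equal IZR Hdet) as HdR; rewrite minus_IZR, !mult_IZR in HdR.
  assert (Hz : ~ lattice tau (grid tau r s)).
  { intros (m & n & E); apply grid_inj in E; auto; destruct E as [-> ->].
    apply Hrs; exists (2 * m)%Z, (2 * n)%Z; rewrite !mult_IZR; split; field. }
  set (r' := r * IZR b2 - s * IZR a2); set (s' := s * IZR a1 - r * IZR b1).
  assert (Er : r = r' * IZR a1 + s' * IZR a2).
  { transitivity (r * (IZR a1 * IZR b2 - IZR b1 * IZR a2)); [rewrite HdR; ring|unfold r', s'; ring]. }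
  assert (Es : s = r' * IZR b1 + s' * IZR b2).
  { transitivity (s * (IZR a1 * IZR b2 - IZR b1 * IZR a2)); [rewrite HdR; ring|unfold r', s'; ring]. }
  clearbody r' s'.
  assert (EG : grid tau r s = (r' * grid tau (IZR a1) (IZR b1) + s' * grid tau (IZR a2) (IZR b2))%C).
  { rewrite Er, Es; unfold grid; rewrite !RtoC_plus, !RtoC_mult; ring. }
  assert (S1 : sin (2 * PI * r') = 0).
  { apply (orthogonal_zero_sin tau a1 b1 a2 b2 b Ht b0 Hdet Ho r' s'); rewrite <- EG; auto.
    rewrite <- HE; f_equal; rewrite Er, Es, !RtoC_plus, !RtoC_mult; ring. }
  assert (S2 : sin (2 * PI * s') = 0).
  { assert (Ho' : grid tau (IZR (- a1)) (IZR (- b1)) = (qtau (/ b) * grid tau (IZR a2) (IZR b2))%C).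
    { rewrite Ho, !opp_IZR, grid_opp; set (w := grid tau (IZR a1) (IZR b1)).
      replace (qtau (/ b) * (qtau b * w))%C with ((qtau (/ b) * qtau b) * w)%C by ring.
      replace (qtau (/ b) * qtau b)%C with (- (1))%C; [ring|].
      apply injective_projections; unfold qtau; simpl; field; lra. }
    assert (EG' : grid tau r s = (s' * grid tau (IZR a2) (IZR b2)
       + - r' * grid tau (IZR (- a1)) (IZR (- b1)))%C).
    { rewrite EG, !opp_IZR, grid_opp; ring. }
    rewrite <- RtoC_opp in EG'.
    apply (orthogonal_zero_sin tau a2 b2 (- a1) (- b1) (/ b) Ht (Rinv_0_lt_compat _ b0) ltac:(lia) Ho' s' (- r'));
      rewrite <- EG'; auto.
    rewrite <- HE; f_equal; rewrite Er, Es, !opp_IZR, !RtoC_plus, !RtoC_opp, !RtoC_mult; ring. }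
  apply sin_2PI_zero in S1; apply sin_2PI_zero in S2; destruct S1 as [k ->], S2 as [l ->].
  exists (k * a1 + l * a2)%Z, (k * b1 + l * b2)%Z.
  rewrite Er, Es, !plus_IZR, !mult_IZR; split; field.
Qed.

(** * The Weierstrass equation *)

Section Weierstrass.

Context (tau : C).
Hypothesis Ht : 0 < snd tau.

Definition wp'' (z : C) : C := (6 * (/ (z * z * z * z) + S4 tau z))%C.

Lemma off_ne_0 z : ~ lattice tau z -> z <> 0%C.
Proof. intros H ->; apply H, lattice_0. Qed.

Lemma cder_inv_id (z : C) : z <> 0%C -> cder (fun z => / z)%C z (- (/ z * / z))%C.
Proof.
  intros H; eapply cder_eq; [|apply cder_inv; [auto|apply cder_id]]; simpl; ring.
Qed.

Lemma cder_wp z : ~ lattice tau z -> cder (fun z => wp z tau) z (wp' z tau).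
Proof.
  intros Hz; pose proof (off_ne_0 z Hz) as z0; pose proof (not_lattice_offpoles _ _ Hz) as Hp.
  destruct (not_lattice_open tau Ht z Hz) as [d [d0 Hd]].
  apply cder_ext_loc with (f := fun z => (/ z * / z + z * Su tau z)%C) (d := d); auto.
  - intros h Hh; rewrite wp_Su by (auto using not_lattice_offpoles).
    pose proof (off_ne_0 _ (Hd h Hh)); field; auto.
  - eapply cder_eq; [|apply cder_add; [apply cder_mul; apply cder_inv_id; auto|apply cder_zSu; auto]].
    cbv beta; rewrite wp'_S3 by auto; field; auto.
Qed.

Lemma cder_wp' z : ~ lattice tau z -> cder (fun z => wp' z tau) z (wp'' z).
Proof.
  intros Hz; pose proof (off_ne_0 z Hz) as z0; pose proof (not_lattice_offpoles _ _ Hz) as Hp.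
  destruct (not_lattice_open tau Ht z Hz) as [d [d0 Hd]].
  apply cder_ext_loc with (f := fun z => (- (2) * (/ z * / z * / z + S3 tau z))%C) (d := d); auto.
  - intros h Hh; rewrite wp'_S3 by (auto using not_lattice_offpoles).
    pose proof (off_ne_0 _ (Hd h Hh)); field; auto.
  - eapply cder_eq; [|apply cder_scal, cder_add;
      [apply cder_mul; [apply cder_mul|]; apply cder_inv_id; auto|apply cder_S3; auto]].
    cbv beta; unfold wp''; field; auto.
Qed.

Lemma wp''_shift z (m n : Z) : ~ lattice tau z -> wp'' (z + grid tau (IZR m) (IZR n))%C = wp'' z.
Proof.
  intros Hz; set (l := grid tau (IZR m) (IZR n)).
  assert (Hl : lattice tau l) by (exists m, n; auto).
  assert (Hzl : ~ lattice tau (z + l)%C) by (apply not_lattice_add; auto).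
  destruct (not_lattice_open tau Ht z Hz) as [d [d0 Hd]].
  apply (cder_unique (fun z => wp' z tau) z); [|apply cder_wp'; auto].
  pose proof (cder_wp' _ Hzl) as H.
  replace (z + l)%C with (1 * z + l)%C in H by ring; apply cder_affine in H.
  replace (z + l)%C with (1 * z + l)%C by ring.
  eapply cder_eq; [|apply cder_ext_loc with (d := d) (3 := H); auto].
  - ring.
  - intros h Hh; cbv beta; replace (1 * (z + h) + l)%C with (z + h + l)%C by ring.
    apply wp'_shift; auto.
Qed.

(** Differentiates the expansion of z [Su] in two ways; the expansion of [S3] follows from
    uniqueness of the derivative. *)
Lemma Sb_derivative : exists Sb1, Diff (offpoles tau) 4 Sb1 /\
  (forall z, offpoles tau z -> (- (2) * S3 tau z)%C =
     (2 * Sa tau * z + 4 * z * z * z * Sb tau z + z * z * z * z * Sb1 z)%C).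
Proof.
  pose proof (Diff_Sb tau 5 Ht) as H; apply Diff_S in H; destruct H as [Sb1 [H1 H2]].
  exists Sb1; split; auto; intros z Hz.
  apply (cder_unique (fun z => z * Su tau z)%C z); [apply cder_zSu; auto|].
  destruct (offpoles_open tau Ht z Hz) as [d [d0 Hd]].
  apply cder_ext_loc with (f := fun z => (Sa tau * (z * z) + z * z * (z * z) * Sb tau z)%C) (d := d); auto.
  - intros h Hh; rewrite zSu_expansion by auto; ring.
  - eapply cder_eq; [|apply cder_add; [apply cder_scal, cder_mul; apply cder_id|
      apply cder_mul; [apply cder_mul; apply cder_mul; apply cder_id|apply H1; auto]]].
    cbv beta; ring.
Qed.

Lemma S4_0 : S4 tau 0%C = (Sa tau / 3)%C.
Proof.
  unfold Sa, S4.
  replace (fsum ZZ_sq (fun p => lr tau p 0 * lr tau p 0 * lr tau p 0 * lr tau p 0)%C)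
    with (fsum ZZ_sq (fun p => li tau p * li tau p * li tau p * li tau p)%C).
  - field.
  - apply fsum_ext; intros p; rewrite lr_0; ring.
Qed.

Lemma off_Diff_grid1 (f : C -> C) :
  (forall z (m n : Z), ~ lattice tau z -> f (z + grid tau (IZR m) (IZR n))%C = f z) ->
  (forall z, ~ lattice tau z -> f (z + 1)%C = (f z + 0)%C) /\
  (forall z, ~ lattice tau z -> f (z + tau)%C = (f z + 0)%C).
Proof.
  intros H; split; intros z Hz.
  - replace (z + 1)%C with (z + grid tau (IZR 1) (IZR 0))%C by (unfold grid; ring).
    rewrite H by auto; ring.
  - replace (z + tau)%C with (z + grid tau (IZR 0) (IZR 1))%C by (unfold grid; ring).
    rewrite H by auto; ring.
Qed.

(** Liouville applied to wp'^2 - 4 wp^3 + g2 wp, with g2 = 20 [Sa]: the explicit expansions cancel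
    all poles, and the constant is the value -28 [Sb] at 0, that is -g3. *)
Lemma wp_ode1 z : ~ lattice tau z ->
  (wp' z tau * wp' z tau)%C =
  (4 * wp z tau * wp z tau * wp z tau - 20 * Sa tau * wp z tau - 28 * Sb tau 0)%C.
Proof.
  destruct (offpoles_ball tau Ht) as [d [d0 Hd]]; destruct Sb_derivative as [Sb1 [D1 E1]].
  set (f := fun z => (wp' z tau * wp' z tau - 4 * (wp z tau * wp z tau * wp z tau) + 20 * Sa tau * wp z tau)%C).
  set (W := fun z => (z * (2 * Sa tau + 4 * z * z * Sb tau z + z * z * z * Sb1 z))%C).
  set (U := fun z => (z * z * (Sa tau + z * z * Sb tau z))%C).
  destruct (off_Diff_grid1 f) as [F1 F2].
  { intros y m n Hy; unfold f; rewrite wp_shift, wp'_shift; auto. }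
  destruct (quasi_periodic_affine tau f
    (fun z => - (28) * Sb tau z - 4 * z * Sb1 z + W z * W z
       - 12 * (z * z) * ((Sa tau + z * z * Sb tau z) * (Sa tau + z * z * Sb tau z))
       - 4 * (U z * U z * U z) + 20 * Sa tau * U z)%C 0%C 0%C d) as [c [Hc0 Hc]]; auto.
  - pose proof (Diff_wp tau 4 Ht); pose proof (Diff_wp' tau 4 Ht); unfold f; solve_Diff.
  - assert (Diff (fun z => Cmod z < d) 4 (Sb tau)) by (eapply Diff_sub; [|apply Diff_Sb; auto]; auto).
    assert (Diff (fun z => Cmod z < d) 4 Sb1) by (eapply Diff_sub; [|apply D1]; auto).
    unfold W, U; solve_Diff.
  - intros y Hy Hyd; unfold f; pose proof (off_ne_0 y Hy) as y0; specialize (Hd y Hyd).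
    rewrite wp_Su, wp'_S3, zSu_expansion by auto.
    replace (- (2) * (/ (y * y * y) + S3 tau y))%C
      with (- (2) * / (y * y * y) + (- (2) * S3 tau y))%C by ring.
    rewrite E1 by auto; unfold W, U; field; auto.
  - intros Hz; specialize (Hc z Hz); unfold f in Hc.
    transitivity ((0 * z + c) + 4 * wp z tau * wp z tau * wp z tau - 20 * Sa tau * wp z tau)%C.
    + rewrite <- Hc; ring.
    + rewrite <- Hc0; unfold W, U; ring.
Qed.

(** Obtained by a second use of Liouville, so that it holds also where wp' vanishes and
    differentiating [wp_ode1] would leave a factor 0. The constant is 6 [S4](0) - 12 [Sa] = -10
    [Sa]. *)
Lemma wp_ode2 z : ~ lattice tau z -> wp'' z = (6 * wp z tau * wp z tau - 10 * Sa tau)%C.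
Proof.
  destruct (offpoles_ball tau Ht) as [d [d0 Hd]].
  set (f := fun z => (wp'' z - 6 * (wp z tau * wp z tau))%C).
  set (U := fun z => (z * z * (Sa tau + z * z * Sb tau z))%C).
  destruct (off_Diff_grid1 f) as [F1 F2].
  { intros y m n Hy; unfold f; rewrite wp_shift, wp''_shift; auto. }
  destruct (quasi_periodic_affine tau f
    (fun z => 6 * S4 tau z - 12 * (Sa tau + z * z * Sb tau z) - 6 * (U z * U z))%C 0%C 0%C d)
    as [c [Hc0 Hc]]; auto.
  - pose proof (Diff_wp tau 4 Ht).
    assert (Diff (fun z => ~ lattice tau z) 4 wp'').
    { apply Diff_mul; [apply Diff_const|]; apply Diff_add.
      - apply Diff_inv; [|solve_Diff].
        intros y Hy; pose proof (off_ne_0 y Hy); repeat apply Cmult_neq_0; auto.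
      - eapply Diff_sub; [|apply Diff_S4; auto]; intros; apply not_lattice_offpoles; auto. }
    unfold f; solve_Diff.
  - assert (Diff (fun z => Cmod z < d) 4 (Sb tau)) by (eapply Diff_sub; [|apply Diff_Sb; auto]; auto).
    assert (Diff (fun z => Cmod z < d) 4 (S4 tau)) by (eapply Diff_sub; [|apply Diff_S4; auto]; auto).
    unfold U; solve_Diff.
  - intros y Hy Hyd; unfold f, wp''; pose proof (off_ne_0 y Hy) as y0; specialize (Hd y Hyd).
    rewrite wp_Su, zSu_expansion by auto; unfold U; field; auto.
  - intros Hz; specialize (Hc z Hz); unfold f in Hc.
    transitivity ((0 * z + c) + 6 * wp z tau * wp z tau)%C; [rewrite <- Hc; ring|].
    rewrite <- Hc0, S4_0; unfold U; field.
Qed.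

(** A half period differs from its opposite by a lattice point, so the odd periodic function wp'
    equals its own negative there. *)
Lemma wp'_half (m n : Z) : Z.odd m = true \/ Z.odd n = true ->
  wp' (grid tau (IZR m / 2) (IZR n / 2)) tau = RtoC 0.
Proof.
  intros Ho; pose proof (half_not_lattice tau m n Ht Ho) as Hh.
  set (h := grid tau (IZR m / 2) (IZR n / 2)) in *.
  pose proof (not_lattice_opp _ _ Hh) as Hh'.
  pose proof (wp'_shift tau (- h)%C m n Ht Hh') as E.
  replace (- h + grid tau (IZR m) (IZR n))%C with h in E.
  - rewrite wp'_odd in E by (auto using not_lattice_offpoles).
    transitivity ((wp' h tau + wp' h tau) / 2)%C; [apply Csub_eq0; field|].
    rewrite E at 1; apply Csub_eq0; field.
  - unfold h, grid; apply injective_projections; simpl; field.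
Qed.

Lemma wp_half_mod2 (m n k l : Z) : Z.odd k = true \/ Z.odd l = true ->
  (exists i, m = k + 2 * i)%Z -> (exists j, n = l + 2 * j)%Z ->
  wp (grid tau (IZR m / 2) (IZR n / 2)) tau = wp (grid tau (IZR k / 2) (IZR l / 2)) tau.
Proof.
  intros Ho [i ->] [j ->]; rewrite <- (wp_shift tau (grid tau (IZR k / 2) (IZR l / 2)) i j);
    auto using half_not_lattice.
  f_equal; rewrite <- grid_add, !plus_IZR, !mult_IZR; f_equal; field.
Qed.

Lemma e1_grid : e1 tau = wp (grid tau (IZR 1 / 2) (IZR 0 / 2)) tau.
Proof. unfold e1; f_equal; unfold grid; apply injective_projections; simpl; field. Qed.

Lemma e2_grid : e2 tau = wp (grid tau (IZR 0 / 2) (IZR 1 / 2)) tau.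
Proof. unfold e2; f_equal; unfold grid; apply injective_projections; simpl; field. Qed.

Lemma e3_grid : e3 tau = wp (grid tau (IZR 1 / 2) (IZR 1 / 2)) tau.
Proof. unfold e3; f_equal; unfold grid; apply injective_projections; simpl; field. Qed.

Lemma half_cubic (m n : Z) e : Z.odd m = true \/ Z.odd n = true ->
  e = wp (grid tau (IZR m / 2) (IZR n / 2)) tau ->
  (4 * e * e * e - 20 * Sa tau * e - 28 * Sb tau 0)%C = 0%C.
Proof.
  intros Ho ->; rewrite <- wp_ode1 by (apply half_not_lattice; auto).
  rewrite wp'_half by auto; ring.
Qed.

End Weierstrass.

(** * The reflection symmetry of a lattice with real cross-ratio *)

Lemma MVT_open (f f' : R -> R) a b : a < b -> (forall x, a <= x <= b -> is_derive f x (f' x)) ->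
  exists c, a <= c <= b /\ f b - f a = f' c * (b - a).
Proof.
  intros Hab H; destruct (MVT_gen f a b f') as [c [Hc E]].
  - intros x Hx; rewrite Rmin_left, Rmax_right in Hx by lra; apply H; lra.
  - intros x Hx; rewrite Rmin_left, Rmax_right in Hx by lra.
    apply derivable_continuous_pt; eexists; apply is_derive_Reals, H; lra.
  - rewrite Rmin_left, Rmax_right in Hc by lra; eauto.
Qed.

(** Integration of f' <= G' from 0, where the functions need not be differentiable: the bound f <= M
    x replaces the initial value. If f - G were positive at x, it would be at least as large at a
    much smaller y, contradicting that bound. *)
Lemma majorant_upper (f f' G G' : R -> R) e M : 0 <= M ->
  (forall x, 0 < x < e -> is_derive f x (f' x)) ->
  (forall x, 0 < x < e -> is_derive G x (G' x)) ->
  (forall x, 0 < x < e -> 0 <= G x) ->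
  (forall x, 0 < x < e -> f' x <= G' x) ->
  (forall x, 0 < x < e -> f x <= M * x) ->
  forall x, 0 < x < e -> f x <= G x.
Proof.
  intros M0 Df DG G0 Hd Hf x Hx; apply Rnot_lt_le; intros Hn.
  set (eta := f x - G x).
  set (y := Rmin (x / 2) (eta / (2 * (M + 1)))).
  assert (eta0 : 0 < eta) by (unfold eta; lra).
  assert (y0 : 0 < y) by (apply Rmin_pos; [lra|apply Rdiv_lt_0_compat; lra]).
  assert (yx : y <= x / 2) by apply Rmin_l.
  assert (ye : y <= eta / (2 * (M + 1))) by apply Rmin_r.
  destruct (MVT_open (fun t => f t - G t) (fun t => f' t - G' t) y x) as [c [Hc E]]; [lra| |].
  - intros t Htt; apply @is_derive_minus; [apply Df|apply DG]; lra.
  - cbv beta in E; fold eta in E.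
    assert (f' c - G' c <= 0) by (specialize (Hd c ltac:(lra)); lra).
    assert (eta <= f y - G y) by nra.
    specialize (Hf y ltac:(lra)); specialize (G0 y ltac:(lra)).
    apply Rmult_le_compat_r with (r := 2 * (M + 1)) in ye; [|lra].
    replace (eta / (2 * (M + 1)) * (2 * (M + 1))) with eta in ye by (field; lra).
    nra.
Qed.

Lemma majorant_abs (f f' G G' : R -> R) e M : 0 <= M ->
  (forall x, 0 < x < e -> is_derive f x (f' x)) ->
  (forall x, 0 < x < e -> is_derive G x (G' x)) ->
  (forall x, 0 < x < e -> 0 <= G x) ->
  (forall x, 0 < x < e -> Rabs (f' x) <= G' x) ->
  (forall x, 0 < x < e -> Rabs (f x) <= M * x) ->
  forall x, 0 < x < e -> Rabs (f x) <= G x.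
Proof.
  intros M0 Df DG G0 Hd Hf x Hx; apply Rabs_le; split.
  - apply Ropp_le_cancel; rewrite Ropp_involutive.
    apply (majorant_upper (fun t => - f t) (fun t => - f' t) G G' e M); auto.
    + intros t Htt; apply @is_derive_opp; auto.
    + intros t Htt; eapply Rle_trans; [|apply Hd; auto]; rewrite <- Rabs_Ropp; apply Rle_abs.
    + intros t Htt; eapply Rle_trans; [|apply Hf; auto]; rewrite <- Rabs_Ropp; apply Rle_abs.
  - apply (majorant_upper f f' G G' e M); auto.
    + intros t Htt; eapply Rle_trans; [apply Rle_abs|auto].
    + intros t Htt; eapply Rle_trans; [apply Rle_abs|auto].
Qed.

Lemma is_derive_monomial c n x : is_derive (fun t => c * t ^ S n) x (c * INR (S n) * x ^ n).
Proof.
  replace (c * INR (S n) * x ^ n) with (c * (INR (S n) * 1 * x ^ pred (S n))) by (simpl pred; ring).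
  apply is_derive_scal, is_derive_pow, @is_derive_id.
Qed.

(* The indicial exponents of D'' = (12 / x^2) D are -3 and 4, so a solution that is O(x^5) vanishes;
   integrating twice turns the bound M x^5 into (13/20) M x^5 for each real component. *)
Lemma singular_ode_zero (A A1 A2 B B1 B2 : R -> R) e M M1 : 0 < e -> 0 <= M -> 0 <= M1 ->
  (forall x, 0 < x < e -> is_derive A x (A1 x) /\ is_derive A1 x (A2 x)
    /\ is_derive B x (B1 x) /\ is_derive B1 x (B2 x)) ->
  (forall x, 0 < x < e -> A2 x ^ 2 + B2 x ^ 2 <= (13 / x ^ 2) ^ 2 * (A x ^ 2 + B x ^ 2)) ->
  (forall x, 0 < x < e -> A x ^ 2 + B x ^ 2 <= (M * x ^ 5) ^ 2) ->
  (forall x, 0 < x < e -> Rabs (A1 x) <= M1 * x /\ Rabs (B1 x) <= M1 * x) ->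
  forall x, 0 < x < e -> A x = 0 /\ B x = 0.
Proof.
  intros e0 M0 M10 HD H2 HM HM1.
  (* Two real components, each at most 13/20 of the previous bound, combine to sqrt(2) times 13/20,
     which is below 92/100: a contraction. *)
  assert (step : forall N, 0 <= N ->
    (forall x, 0 < x < e -> A x ^ 2 + B x ^ 2 <= (N * x ^ 5) ^ 2) ->
    forall x, 0 < x < e -> A x ^ 2 + B x ^ 2 <= (92 / 100 * N * x ^ 5) ^ 2).
  { intros N N0 HN.
    assert (comp : forall F F1 F2 : R -> R,
      (forall x, 0 < x < e -> is_derive F x (F1 x) /\ is_derive F1 x (F2 x)) ->
      (forall x, 0 < x < e -> F x ^ 2 <= A x ^ 2 + B x ^ 2) ->
      (forall x, 0 < x < e -> F2 x ^ 2 <= A2 x ^ 2 + B2 x ^ 2) ->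
      (forall x, 0 < x < e -> Rabs (F1 x) <= M1 * x) ->
      forall x, 0 < x < e -> Rabs (F x) <= 13 / 20 * N * x ^ 5).
    { intros F F1 F2 HF HF0 HF2 HF1.
      assert (b2 : forall x, 0 < x < e -> Rabs (F2 x) <= 13 * N * x ^ 3).
      { intros x Hx; assert (0 < x ^ 3) by (apply pow_lt; lra).
        rewrite <- (Rabs_pos_eq (13 * N * x ^ 3)) by nra.
        apply Rsqr_le_abs_0; unfold Rsqr.
        replace (F2 x * F2 x) with (F2 x ^ 2) by ring.
        eapply Rle_trans; [apply HF2; auto|]; eapply Rle_trans; [apply H2; auto|].
        eapply Rle_trans; [apply Rmult_le_compat_l; [apply pow2_ge_0|apply HN; auto]|].
        apply Req_le; field; lra. }
      assert (b1 : forall x, 0 < x < e -> Rabs (F1 x) <= 13 / 4 * N * x ^ 4).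
      { apply (majorant_abs F1 F2 (fun x => 13 / 4 * N * x ^ 4) (fun x => 13 / 4 * N * INR 4 * x ^ 3) e M1); auto.
        - intros x Hx; apply HF; auto.
        - intros x Hx; apply is_derive_monomial.
        - intros x Hx; assert (0 < x ^ 4) by (apply pow_lt; lra); nra.
        - intros x Hx; eapply Rle_trans; [apply b2; auto|]; simpl INR; apply Req_le; field. }
      apply (majorant_abs F F1 (fun x => 13 / 20 * N * x ^ 5) (fun x => 13 / 20 * N * INR 5 * x ^ 4) e (N * e ^ 4)); auto.
      - apply Rmult_le_pos; auto; apply pow_le; lra.
      - intros x Hx; apply HF; auto.
      - intros x Hx; apply is_derive_monomial.
      - intros x Hx; assert (0 < x ^ 5) by (apply pow_lt; lra); nra.
      - intros x Hx; eapply Rle_trans; [apply b1; auto|]; simpl INR; apply Req_le; field.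
      - intros x Hx; assert (0 < x ^ 5) by (apply pow_lt; lra).
        apply Rle_trans with (N * x ^ 5).
        + rewrite <- (Rabs_pos_eq (N * x ^ 5)) by nra; apply Rsqr_le_abs_0; unfold Rsqr.
          specialize (HF0 x Hx); specialize (HN x Hx); lra.
        + assert (x ^ 4 <= e ^ 4) by (apply pow_incr; lra).
          replace (N * x ^ 5) with (N * x ^ 4 * x) by ring.
          apply Rmult_le_compat_r; [lra|]; apply Rmult_le_compat_l; auto. }
    intros x Hx.
    assert (CA : Rabs (A x) <= 13 / 20 * N * x ^ 5).
    { apply (comp A A1 A2); auto.
      - intros y Hy; destruct (HD y Hy) as (? & ? & ? & ?); auto.
      - intros y Hy; pose proof (pow2_ge_0 (B y)); lra.
      - intros y Hy; pose proof (pow2_ge_0 (B2 y)); lra.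
      - intros y Hy; apply HM1; auto. }
    assert (CB : Rabs (B x) <= 13 / 20 * N * x ^ 5).
    { apply (comp B B1 B2); auto.
      - intros y Hy; destruct (HD y Hy) as (? & ? & ? & ?); auto.
      - intros y Hy; pose proof (pow2_ge_0 (A y)); lra.
      - intros y Hy; pose proof (pow2_ge_0 (A2 y)); lra.
      - intros y Hy; apply HM1; auto. }
    rewrite <- (pow2_abs (A x)), <- (pow2_abs (B x)).
    pose proof (Rabs_pos (A x)); pose proof (Rabs_pos (B x)).
    set (t := N * x ^ 5) in *.
    replace (92 / 100 * N * x ^ 5) with (92 / 100 * t) by (unfold t; ring).
    replace (13 / 20 * N * x ^ 5) with (13 / 20 * t) in CA, CB by (unfold t; ring).
    assert (Rabs (A x) ^ 2 <= (13 / 20 * t) ^ 2) by (apply pow_incr; lra).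
    assert (Rabs (B x) ^ 2 <= (13 / 20 * t) ^ 2) by (apply pow_incr; lra).
    pose proof (pow2_ge_0 t); nra. }
  assert (iter : forall n x, 0 < x < e -> A x ^ 2 + B x ^ 2 <= ((92 / 100) ^ n * M * x ^ 5) ^ 2).
  { induction n; intros x Hx; [simpl pow at 3; rewrite Rmult_1_l; auto|].
    replace ((92 / 100) ^ S n * M * x ^ 5) with (92 / 100 * ((92 / 100) ^ n * M) * x ^ 5) by (simpl; ring).
    apply step; auto; apply Rmult_le_pos; auto; apply pow_le; lra. }
  intros x Hx.
  assert (Z : A x ^ 2 + B x ^ 2 <= 0).
  { apply Rnot_lt_le; intros Hn.
    set (c := (M * x ^ 5) ^ 2) in *.
    assert (c0 : 0 <= c) by apply pow2_ge_0.
    destruct (pow_lt_1_zero (92 / 100) ltac:(rewrite Rabs_pos_eq; lra)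
      ((A x ^ 2 + B x ^ 2) / (c + 1))) as [n Hn'].
    { apply Rdiv_lt_0_compat; lra. }
    specialize (Hn' n (Nat.le_refl n)); specialize (iter n x Hx).
    assert (q0 : 0 < (92 / 100) ^ n) by (apply pow_lt; lra).
    assert (q1 : (92 / 100) ^ n <= 1) by (eapply Rle_trans; [apply (pow_incr _ 1); lra|rewrite pow1; lra]).
    rewrite Rabs_pos_eq in Hn' by lra.
    apply Rmult_lt_compat_r with (r := c + 1) in Hn'; [|lra].
    replace ((A x ^ 2 + B x ^ 2) / (c + 1) * (c + 1)) with (A x ^ 2 + B x ^ 2) in Hn' by (field; lra).
    set (q := (92 / 100) ^ n) in *.
    replace ((q * M * x ^ 5) ^ 2) with (q * q * c) in iter by (unfold c; ring).
    assert (q * q * c <= q * c) by nra.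
    nra. }
  pose proof (pow2_ge_0 (A x)); pose proof (pow2_ge_0 (B x)); split; nra.
Qed.

(** The energy E = A^2 + B^2 + A1^2 + B1^2 satisfies E' <= (2 + K^2) E, by bounding each product by
    a sum of squares; hence E e^(-cx) does not increase and stays 0. *)
Lemma gronwall_zero (A A1 A2 B B1 B2 : R -> R) a b K : a < b -> 0 <= K ->
  (forall x, a <= x <= b -> is_derive A x (A1 x) /\ is_derive A1 x (A2 x)
    /\ is_derive B x (B1 x) /\ is_derive B1 x (B2 x)) ->
  (forall x, a <= x <= b -> A2 x ^ 2 + B2 x ^ 2 <= K ^ 2 * (A x ^ 2 + B x ^ 2)) ->
  A a = 0 -> B a = 0 -> A1 a = 0 -> B1 a = 0 -> A b = 0 /\ B b = 0.
Proof.
  intros Hab K0 HD H2 a1 a2 a3 a4.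
  set (E := fun x => A x ^ 2 + B x ^ 2 + A1 x ^ 2 + B1 x ^ 2).
  set (E' := fun x => 2 * A x * A1 x + 2 * B x * B1 x + 2 * A1 x * A2 x + 2 * B1 x * B2 x).
  set (c := 2 + K ^ 2).
  assert (DE : forall x, a <= x <= b -> is_derive (fun t => E t * exp (- (c * t))) x
    ((E' x - c * E x) * exp (- (c * x)))).
  { intros x Hx; destruct (HD x Hx) as (DA & DA1 & DB & DB1); unfold E.
    auto_derive.
    - repeat split; eexists; eauto.
    - assert (U : forall F F' : R -> R, is_derive F x (F' x) -> Derive (fun t : R => F t) x = F' x)
        by (intros; apply is_derive_unique; auto).
      rewrite (U A A1), (U A1 A2), (U B B1), (U B1 B2) by auto.
      unfold E'; ring. }
  destruct (MVT_open _ _ a b Hab DE) as [x [Hx EQ]].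
  assert (E' x - c * E x <= 0).
  { specialize (H2 x Hx); unfold E', E, c.
    pose proof (pow2_ge_0 (A x - A1 x)); pose proof (pow2_ge_0 (B x - B1 x)).
    pose proof (pow2_ge_0 (A2 x - A1 x)); pose proof (pow2_ge_0 (B2 x - B1 x)).
    pose proof (pow2_ge_0 (A x)); pose proof (pow2_ge_0 (B x)).
    pose proof (pow2_ge_0 (A1 x)); pose proof (pow2_ge_0 (B1 x)).
    assert (0 <= K ^ 2 * (A1 x ^ 2 + B1 x ^ 2)).
    { apply Rmult_le_pos; [apply pow2_ge_0|lra]. }
    nra. }
  assert (Ea : E a = 0) by (unfold E; rewrite a1, a2, a3, a4; ring).
  rewrite Ea, Rmult_0_l, Rminus_0_r in EQ.
  pose proof (exp_pos (- (c * x))); pose proof (exp_pos (- (c * b))).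
  assert ((E' x - c * E x) * exp (- (c * x)) * (b - a) <= 0).
  { assert (0 <= (- (E' x - c * E x)) * exp (- (c * x)) * (b - a)).
    { apply Rmult_le_pos; [apply Rmult_le_pos|]; lra. }
    lra. }
  assert (Eb : E b <= 0) by nra.
  unfold E in Eb.
  pose proof (pow2_ge_0 (A b)); pose proof (pow2_ge_0 (B b)).
  pose proof (pow2_ge_0 (A1 b)); pose proof (pow2_ge_0 (B1 b)); split; nra.
Qed.

Lemma Cmod2_parts (z : C) : fst z ^ 2 + snd z ^ 2 = Cmod z ^ 2.
Proof. symmetry; apply Cmod2_alt. Qed.

Lemma line_fst f (v l : C) (t : R) : cder f (t * v)%C l ->
  is_derive (fun s : R => fst (f (s * v)%C)) t (fst (v * l)%C).
Proof.
  intros H; apply is_derive_ext with (fun s : R => fst (f (0 + s * v)%C)).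
  - intros s; do 2 f_equal; ring.
  - apply cder_line_fst; replace (0 + t * v)%C with (t * v)%C by ring; auto.
Qed.

Lemma line_snd f (v l : C) (t : R) : cder f (t * v)%C l ->
  is_derive (fun s : R => snd (f (s * v)%C)) t (snd (v * l)%C).
Proof.
  intros H; apply is_derive_ext with (fun s : R => snd (f (0 + s * v)%C)).
  - intros s; do 2 f_equal; ring.
  - apply cder_line_snd; replace (0 + t * v)%C with (t * v)%C by ring; auto.
Qed.

Lemma line_bounded f (v : C) a b : a <= b -> (forall t : R, a <= t <= b -> exists l, cder f (t * v)%C l) ->
  exists B, forall t : R, a <= t <= b -> Cmod (f (t * v)%C) <= B.
Proof.
  intros Hab H.
  set (h := fun t : R => Rabs (fst (f (t * v)%C)) + Rabs (snd (f (t * v)%C))).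
  destruct (continuity_ab_maj h a b Hab) as [m [Hm _]].
  - intros c Hc; destruct (H c Hc) as [l Hl]; apply continuity_pt_plus.
    + apply (continuity_pt_comp (fun t : R => fst (f (t * v)%C)) Rabs); [|apply Rcontinuity_abs].
      apply derivable_continuous_pt; eexists; apply is_derive_Reals, line_fst; eauto.
    + apply (continuity_pt_comp (fun t : R => snd (f (t * v)%C)) Rabs); [|apply Rcontinuity_abs].
      apply derivable_continuous_pt; eexists; apply is_derive_Reals, line_snd; eauto.
  - exists (h m); intros t Htt; eapply Rle_trans; [apply Cmod_le_parts|apply Hm; auto].
Qed.

Lemma is_derive_zero_on (F F' : R -> R) e : (forall x, 0 < x < e -> is_derive F x (F' x)) ->
  (forall x, 0 < x < e -> F x = 0) -> forall x, 0 < x < e -> F' x = 0.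
Proof.
  intros HF H0 x Hx; rewrite <- (is_derive_unique _ _ _ (HF x Hx)); apply is_derive_unique.
  apply is_derive_ext_loc with (fun _ => 0); [|apply @is_derive_const].
  assert (r0 : 0 < Rmin x (e - x)) by (apply Rmin_pos; lra).
  exists (mkposreal _ r0); intros t Htt; symmetry; apply H0.
  unfold Hierarchy.ball in Htt; simpl in Htt; unfold AbsRing_ball, abs, minus, plus, opp in Htt; simpl in Htt.
  pose proof (Rmin_l x (e - x)); pose proof (Rmin_r x (e - x)).
  apply Rabs_def2 in Htt; lra.
Qed.

(** After translation to 0, wp(w) = 1/w^2 + w [Su](w). The second term is bounded by [M] near 0, and
    |w| < 1/K with K = |B| + M + 1 makes the first exceed K. *)
Lemma wp_blowup tau l B : 0 < snd tau -> lattice tau l ->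
  exists d, 0 < d /\ forall z, z <> l -> Cmod (z - l) < d -> B < Cmod (wp z tau).
Proof.
  intros Ht Hl.
  destruct (punctured_ball_not_lattice tau Ht) as [r [r0 Hr]].
  pose proof (proj1 (Diff_S _ _ _) (Diff_mul _ 1 _ _ (Diff_id (offpoles tau) 1) (Diff_Su tau 1 Ht)))
    as [u' [Hu _]].
  destruct (cder_lipschitz _ _ _ (Hu 0%C (offpoles_0 tau Ht))) as (e & M & e0 & M0 & HM).
  destruct (offpoles_ball tau Ht) as [p [p0 Hp]].
  set (K := Rabs B + M + 1).
  assert (K1 : 1 <= K) by (unfold K; pose proof (Rabs_pos B); lra).
  exists (Rmin (Rmin r p) (Rmin e (/ K))); split.
  { repeat apply Rmin_pos; auto; apply Rinv_0_lt_compat; lra. }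
  intros z Hz Hd.
  pose proof (Rmin_l (Rmin r p) (Rmin e (/ K))); pose proof (Rmin_r (Rmin r p) (Rmin e (/ K))).
  pose proof (Rmin_l r p); pose proof (Rmin_r r p); pose proof (Rmin_l e (/ K)); pose proof (Rmin_r e (/ K)).
  assert (Hzl : ~ lattice tau z) by (apply (Hr z l); auto; lra).
  set (w := (z - l)%C) in *.
  assert (Ew : wp z tau = wp w tau).
  { destruct Hl as (m & n & El); replace z with (w + grid tau (IZR m) (IZR n))%C.
    - apply wp_shift; auto; unfold w; rewrite El; apply not_lattice_sub; auto; exists m, n; auto.
    - unfold w; rewrite El; ring. }
  assert (w0 : w <> 0%C).
  { intros E; apply Hz; replace z with (w + l)%C by (unfold w; ring); rewrite E; ring. }
  assert (wm : 0 < Cmod w) by (apply Cmod_gt_0; auto).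
  rewrite Ew, wp_Su by (auto; apply Hp; lra).
  eapply Rlt_le_trans; [|apply Cmod_rev_triangle].
  rewrite Cmod_inv, Cmod_mult by (apply Cmult_neq_0; auto).
  assert (Hu' : Cmod (w * Su tau w) <= M).
  { specialize (HM w ltac:(lra)).
    replace (0 + w)%C with w in HM by ring; replace (w * Su tau w - 0 * Su tau 0)%C with (w * Su tau w)%C in HM by ring.
    assert (/ K <= 1) by (rewrite <- Rinv_1; apply Rinv_le_contravar; lra).
    nra. }
  assert (K < / (Cmod w * Cmod w)).
  { assert (H5 : Cmod w < / K) by lra.
    apply Rmult_lt_compat_l with (r := K) in H5; [|lra]; rewrite Rinv_r in H5 by lra.
    apply Rmult_lt_reg_r with (Cmod w * Cmod w); [apply Rmult_lt_0_compat; auto|].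
    rewrite Rinv_l by (apply Rgt_not_eq, Rmult_lt_0_compat; auto).
    assert (/ K <= 1) by (rewrite <- Rinv_1; apply Rinv_le_contravar; lra).
    nra. }
  pose proof (Rle_abs B); unfold K in *; lra.
Qed.

Lemma wp_locally_bounded tau z : 0 < snd tau -> ~ lattice tau z ->
  exists d B, 0 < d /\ forall h, Cmod h < d -> Cmod (wp (z + h)%C tau) <= B.
Proof.
  intros Ht Hz; destruct (cder_lipschitz _ _ _ (cder_wp tau Ht z Hz)) as (d & M & d0 & M0 & HM).
  exists d, (Cmod (wp z tau) + M * d); split; auto; intros h Hh; specialize (HM h Hh).
  replace (wp (z + h)%C tau) with (wp z tau + (wp (z + h)%C tau - wp z tau))%C by (apply Csub_eq0; ring).
  eapply Rle_trans; [apply Cmod_triangle|]; pose proof (Cmod_ge_0 h); nra.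
Qed.

(** Approaching X v, wp is unbounded, hence so is wp along w. If X w were off the lattice, wp would
    be bounded near it; the point X - s is close enough to the end for both statements to contradict
    each other. *)
Lemma pole_transfer tau (v w : C) X : 0 < snd tau -> 0 < X -> v <> 0%C ->
  (forall x : R, 0 < x < X -> Cmod (wp (x * v)%C tau) = Cmod (wp (x * w)%C tau)) ->
  lattice tau (X * v)%C -> lattice tau (X * w)%C.
Proof.
  intros Ht X0 v0 HE Hv; apply NNPP; intros Hw.
  destruct (wp_locally_bounded tau _ Ht Hw) as (d & B & d0 & HB).
  destruct (wp_blowup tau _ B Ht Hv) as (e & e0 & He).
  assert (vm : 0 < Cmod v) by (apply Cmod_gt_0; auto).
  pose proof (Cmod_ge_0 w) as wm.
  set (s := Rmin (X / 2) (Rmin (d / (2 * (Cmod w + 1))) (e / (2 * (Cmod v + 1))))).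
  assert (s0 : 0 < s).
  { unfold s; repeat apply Rmin_pos; try lra; apply Rdiv_lt_0_compat; lra. }
  assert (s1 : s <= X / 2) by apply Rmin_l.
  assert (s2 : s <= d / (2 * (Cmod w + 1))) by (eapply Rle_trans; [apply Rmin_r|apply Rmin_l]).
  assert (s3 : s <= e / (2 * (Cmod v + 1))) by (eapply Rle_trans; [apply Rmin_r|apply Rmin_r]).
  apply Rmult_le_compat_r with (r := 2 * (Cmod w + 1)) in s2; [|lra].
  replace (d / (2 * (Cmod w + 1)) * (2 * (Cmod w + 1))) with d in s2 by (field; lra).
  apply Rmult_le_compat_r with (r := 2 * (Cmod v + 1)) in s3; [|lra].
  replace (e / (2 * (Cmod v + 1)) * (2 * (Cmod v + 1))) with e in s3 by (field; lra).
  specialize (HE (X - s) ltac:(lra)).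
  assert (H1 : B < Cmod (wp ((X - s)%R * v)%C tau)).
  { apply He.
    - intros E.
      assert (E' : (s * v)%C = 0%C).
      { replace (s * v)%C with (X * v - (X - s)%R * v)%C by (rewrite RtoC_minus; ring); rewrite E; ring. }
      apply (f_equal Cmod) in E'; rewrite Cmod_mult, Cmod_R, Cmod_0, Rabs_pos_eq in E' by lra.
      apply Rmult_integral in E'; lra.
    - replace ((X - s)%R * v - X * v)%C with (- (s * v))%C by (rewrite RtoC_minus; ring).
      rewrite Cmod_opp, Cmod_mult, Cmod_R, Rabs_pos_eq by lra; nra. }
  assert (H2 : Cmod (wp ((X - s)%R * w)%C tau) <= B).
  { replace ((X - s)%R * w)%C with (X * w + - (s * w))%C by (rewrite RtoC_minus; ring).
    apply HB; rewrite Cmod_opp, Cmod_mult, Cmod_R, Rabs_pos_eq by lra; nra. }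
  lra.
Qed.

(** Values of the elliptic functions are generalised first, so that [simpl] and [ring] meet only
    variables. *)
Ltac rparts :=
  cbv beta;
  repeat match goal with
  | |- context [wp ?a ?b] => generalize (wp a b)
  | |- context [wp' ?a ?b] => generalize (wp' a b)
  | |- context [wp'' ?a ?b] => generalize (wp'' a b)
  end;
  intros; unfold minus, plus, opp; simpl;
  match goal with |- @eq _ ?a ?b => change (@eq R a b) end; ring.

(** * Comparison of wp along a segment and along its mirror image *)

Section Reflection.

Context (tau mu w : C).
Hypothesis Ht : 0 < snd tau.
Hypothesis Hmu : Cmod mu = 1.
Hypothesis Ha : Cconj (Sa tau) = (mu * mu * mu * mu * Sa tau)%C.
Hypothesis Hb : Cconj (Sb tau 0) = (mu * mu * mu * mu * mu * mu * Sb tau 0)%C.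
Hypothesis Hw : lattice tau w.
Hypothesis w0 : w <> 0%C.
Hypothesis Hprim : forall x : R, 0 < x < 1 -> ~ lattice tau (x * w)%C.

Let cw := Cconj w.
Let J := (mu * cw)%C.

(** The defect of the reflection symmetry at t w, where J = mu conj w is the mirror image of w. [D1]
    and [D2] are its derivatives along the segment, and [q] is the coefficient of the linear
    equation that it satisfies. *)
Let D (t : R) : C := (Cconj (wp (t * w)%C tau) - mu * mu * wp (t * J)%C tau)%C.
Let D1 (t : R) : C := (Cconj (w * wp' (t * w)%C tau) - mu * mu * (J * wp' (t * J)%C tau))%C.
Let D2 (t : R) : C := (Cconj (w * (w * wp'' tau (t * w)%C)) - mu * mu * (J * (J * wp'' tau (t * J)%C)))%C.
Let q (t : R) : C := (6 * cw * cw * (Cconj (wp (t * w)%C tau) + mu * mu * wp (t * J)%C tau))%C.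

Lemma mu_neq_0 : mu <> 0%C.
Proof. apply Cmod_gt_0; rewrite Hmu; lra. Qed.

Lemma J_neq_0 : J <> 0%C.
Proof.
  apply Cmult_neq_0; [apply mu_neq_0|]; unfold cw; apply Cmod_gt_0; rewrite Cmod_conj.
  apply Cmod_gt_0; auto.
Qed.

Lemma Cmod_J : Cmod J = Cmod w.
Proof. unfold J, cw; rewrite Cmod_mult, Cmod_conj, Hmu; ring. Qed.

Lemma cw_neq_0 : cw <> 0%C.
Proof. intros E; apply J_neq_0; unfold J; rewrite E; ring. Qed.

Lemma reflection_derivatives (t : R) : ~ lattice tau (t * w)%C -> ~ lattice tau (t * J)%C ->
  is_derive (fun t => fst (D t)) t (fst (D1 t)) /\ is_derive (fun t => fst (D1 t)) t (fst (D2 t)) /\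
  is_derive (fun t => snd (D t)) t (snd (D1 t)) /\ is_derive (fun t => snd (D1 t)) t (snd (D2 t)).
Proof.
  intros H1 H2.
  pose proof (cder_wp tau Ht _ H1) as A1; pose proof (cder_wp' tau Ht _ H1) as A2.
  pose proof (cder_scal (mu * mu)%C _ _ _ (cder_wp tau Ht _ H2)) as B1.
  pose proof (cder_scal (mu * mu * J)%C _ _ _ (cder_wp' tau Ht _ H2)) as B2.
  apply (cder_scal w) in A2.
  split; [|split; [|split]].
  - pose proof (is_derive_minus _ _ _ _ _ (line_fst _ _ _ _ A1) (line_fst _ _ _ _ B1)) as H.
    replace (fst (D1 t)) with (minus (fst (w * wp' (t * w)%C tau)%C) (fst (J * (mu * mu * wp' (t * J)%C tau))%C)).
    + eapply (is_derive_ext _ (fun s : R => fst (D s))); [|exact H]; intros s; unfold D; rparts.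
    + unfold D1; rparts.
  - pose proof (is_derive_minus _ _ _ _ _ (line_fst _ _ _ _ A2) (line_fst _ _ _ _ B2)) as H.
    replace (fst (D2 t)) with (minus (fst (w * (w * wp'' tau (t * w)%C))%C)
      (fst (J * (mu * mu * J * wp'' tau (t * J)%C))%C)) by (unfold D2; rparts).
    eapply (is_derive_ext _ (fun s : R => fst (D1 s))); [|exact H]; intros s; unfold D1; rparts.
  - pose proof (is_derive_minus _ _ _ _ _ (is_derive_opp _ _ _ (line_snd _ _ _ _ A1)) (line_snd _ _ _ _ B1)) as H.
    replace (snd (D1 t)) with (minus (opp (snd (w * wp' (t * w)%C tau)%C)) (snd (J * (mu * mu * wp' (t * J)%C tau))%C)).
    + eapply (is_derive_ext _ (fun s : R => snd (D s))); [|exact H]; intros s; unfold D; rparts.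
    + unfold D1; rparts.
  - pose proof (is_derive_minus _ _ _ _ _ (is_derive_opp _ _ _ (line_snd _ _ _ _ A2)) (line_snd _ _ _ _ B2)) as H.
    replace (snd (D2 t)) with (minus (opp (snd (w * (w * wp'' tau (t * w)%C))%C))
      (snd (J * (mu * mu * J * wp'' tau (t * J)%C))%C)) by (unfold D2; rparts).
    eapply (is_derive_ext _ (fun s : R => snd (D1 s))); [|exact H]; intros s; unfold D1; rparts.
Qed.

(** In the difference of the two equations for wp'' the constants cancel by [Ha], and the difference
    of the squares of the two wp terms factors as their sum times [D]. *)
Lemma reflection_ode (t : R) : ~ lattice tau (t * w)%C -> ~ lattice tau (t * J)%C -> D2 t = (q t * D t)%C.
Proof.
  intros H1 H2; unfold D2, q, D; rewrite !wp_ode2 by auto.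
  rewrite !Cmult_conj, !Cminus_conj, !Cmult_conj, Ha.
  assert (Ec : forall x : R, Cconj x = x) by (intros; apply injective_projections; simpl; ring).
  rewrite !Ec; unfold J; fold cw; ring.
Qed.

Lemma Cconj_R (x : R) : Cconj x = x.
Proof. apply injective_projections; simpl; ring. Qed.

(** The principal parts match by the choice of J, the t^2 terms by [Ha] and the t^4 terms by [Hb];
    what remains is t^4 times increments of [Sb], hence O(t^5). The derivative is O(t) since [S3]
    vanishes at 0. *)
Lemma reflection_near_0 : exists e M, 0 < e <= 1 /\ 0 <= M /\ forall t : R, 0 < t < e ->
  ~ lattice tau (t * w)%C /\ ~ lattice tau (t * J)%C /\
  Cmod (D t) <= M * t ^ 5 /\ Cmod (D1 t) <= M * t /\ Cmod (q t) <= 13 / t ^ 2.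
Proof.
  destruct (offpoles_ball tau Ht) as [p [p0 Hp]].
  destruct (punctured_ball_not_lattice tau Ht) as [r [r0 Hr]].
  pose proof (proj1 (Diff_S _ _ _) (Diff_mul _ 1 _ _ (Diff_id (offpoles tau) 1) (Diff_Su tau 1 Ht)))
    as [u' [Hu _]].
  destruct (cder_lipschitz _ _ _ (Hu 0%C (offpoles_0 tau Ht))) as (e1 & U & e10 & U0 & HU).
  pose proof (proj1 (Diff_S _ _ _) (Diff_Sb tau 1 Ht)) as [sb' [Hsb _]].
  destruct (cder_lipschitz _ _ _ (Hsb 0%C (offpoles_0 tau Ht))) as (e2 & V & e20 & V0 & HV).
  destruct (cder_lipschitz _ _ _ (cder_S3 tau 0%C Ht (offpoles_0 tau Ht))) as (e3 & T & e30 & T0 & HT).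
  assert (S30 : S3 tau 0%C = 0%C).
  { pose proof (S3_odd tau 0%C Ht (offpoles_0 tau Ht)) as E.
    replace (- 0)%C with (RtoC 0) in E by ring.
    replace (S3 tau 0) with ((S3 tau 0 + S3 tau 0) / 2)%C by field; rewrite E at 1; field. }
  set (n := Cmod w).
  assert (n0 : 0 < n) by (apply Cmod_gt_0; auto).
  set (rr := Rmin (Rmin p r) (Rmin e1 (Rmin e2 e3))).
  assert (rr0 : 0 < rr) by (unfold rr; repeat apply Rmin_pos; auto).
  assert (Hrr : rr <= p /\ rr <= r /\ rr <= e1 /\ rr <= e2 /\ rr <= e3).
  { unfold rr; pose proof (Rmin_l (Rmin p r) (Rmin e1 (Rmin e2 e3)));
    pose proof (Rmin_r (Rmin p r) (Rmin e1 (Rmin e2 e3))); pose proof (Rmin_l p r); pose proof (Rmin_r p r);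
    pose proof (Rmin_l e1 (Rmin e2 e3)); pose proof (Rmin_r e1 (Rmin e2 e3));
    pose proof (Rmin_l e2 e3); pose proof (Rmin_r e2 e3); lra. }
  destruct Hrr as (h1 & h2 & h3 & h4 & h5).
  set (e := Rmin (Rmin 1 (rr / (n + 1))) (/ (12 * n ^ 3 * U + 1))).
  assert (n3 : 0 < n ^ 3) by (apply pow_lt; auto).
  assert (nU : 0 <= 12 * n ^ 3 * U) by (apply Rmult_le_pos; lra).
  exists e, (n ^ 4 * (2 * V * n) + 2 * n * (2 * T * n)).
  split; [split|split].
  - unfold e; repeat apply Rmin_pos; try lra; [apply Rdiv_lt_0_compat; lra|apply Rinv_0_lt_compat; lra].
  - eapply Rle_trans; [apply Rmin_l|apply Rmin_l].
  - assert (0 < n ^ 4) by (apply pow_lt; auto).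
    assert (0 <= V * n) by (apply Rmult_le_pos; lra); assert (0 <= T * n) by (apply Rmult_le_pos; lra).
    assert (0 <= n ^ 4 * (2 * V * n)) by (apply Rmult_le_pos; lra).
    assert (0 <= 2 * n * (2 * T * n)) by (apply Rmult_le_pos; lra).
    lra.
  - intros t [t0 te].
    assert (t1 : t < 1) by (eapply Rlt_le_trans; [apply te|]; eapply Rle_trans; [apply Rmin_l|apply Rmin_l]).
    assert (t2 : t < rr / (n + 1)) by (eapply Rlt_le_trans; [apply te|]; eapply Rle_trans; [apply Rmin_l|apply Rmin_r]).
    assert (t3 : t < / (12 * n ^ 3 * U + 1)) by (eapply Rlt_le_trans; [apply te|apply Rmin_r]).
    assert (tn : t * n < rr).
    { apply Rmult_lt_compat_r with (r := n + 1) in t2; [|lra].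
      replace (rr / (n + 1) * (n + 1)) with rr in t2 by (field; lra); lra. }
    assert (z1m : Cmod (t * w) = t * n) by (rewrite Cmod_mult, Cmod_R, Rabs_pos_eq; auto; lra).
    assert (z2m : Cmod (t * J) = t * n) by (rewrite Cmod_mult, Cmod_J, Cmod_R, Rabs_pos_eq; auto; lra).
    assert (tC : RtoC t <> 0%C) by (intros E; apply RtoC_inj in E; lra).
    pose proof mu_neq_0 as mu0; pose proof J_neq_0 as J0; pose proof cw_neq_0 as cw0.
    assert (z10 : (t * w)%C <> 0%C) by (apply Cmult_neq_0; auto).
    assert (z20 : (t * J)%C <> 0%C) by (apply Cmult_neq_0; auto).
    assert (O1 : offpoles tau (t * w)%C) by (apply Hp; lra).
    assert (O2 : offpoles tau (t * J)%C) by (apply Hp; lra).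
    assert (L1 : ~ lattice tau (t * w)%C).
    { apply (Hr _ 0%C); auto using lattice_0; replace (t * w - 0)%C with (t * w)%C by ring; lra. }
    assert (L2 : ~ lattice tau (t * J)%C).
    { apply (Hr _ 0%C); auto using lattice_0; replace (t * J - 0)%C with (t * J)%C by ring; lra. }
    specialize (HU (t * w)%C ltac:(lra)) as U1; specialize (HU (t * J)%C ltac:(lra)) as U2.
    specialize (HV (t * w)%C ltac:(lra)) as V1; specialize (HV (t * J)%C ltac:(lra)) as V2.
    specialize (HT (t * w)%C ltac:(lra)) as T1; specialize (HT (t * J)%C ltac:(lra)) as T2.
    rewrite !Cplus_0_l in U1, U2, V1, V2, T1, T2; rewrite z1m in U1, V1, T1; rewrite z2m in U2, V2, T2.
    replace (0 * Su tau 0)%C with (RtoC 0) in U1, U2 by ring.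
    rewrite S30 in T1, T2.
    set (x1 := (t * w * Su tau (t * w) - 0)%C) in *; set (x2 := (t * J * Su tau (t * J) - 0)%C) in *.
    set (y1 := (Sb tau (t * w) - Sb tau 0)%C) in *; set (y2 := (Sb tau (t * J) - Sb tau 0)%C) in *.
    assert (conj_inv : Cconj (/ (t * w * (t * w))) = (/ (t * cw * (t * cw)))%C).
    { rewrite Cinv_conj by (apply Cmult_neq_0; auto); rewrite !Cmult_conj, Cconj_R; auto. }
    assert (conj_inv3 : Cconj (/ (t * w * (t * w) * (t * w))) = (/ (t * cw * (t * cw) * (t * cw)))%C).
    { rewrite Cinv_conj by (repeat apply Cmult_neq_0; auto); rewrite !Cmult_conj, Cconj_R; auto. }
    assert (Dq : D t = (t * t * t * t * (cw * cw * cw * cw) * (Cconj y1 - mu * mu * mu * mu * mu * mu * y2))%C).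
    { unfold D; rewrite !wp_Su by auto; rewrite !zSu_expansion by auto.
      replace (Sb tau (t * w)) with (y1 + Sb tau 0)%C by (unfold y1; ring).
      replace (Sb tau (t * J)) with (y2 + Sb tau 0)%C by (unfold y2; ring).
      rewrite !Cplus_conj, conj_inv, !Cmult_conj, !Cplus_conj, Ha, Hb, Cconj_R; fold cw.
      unfold J; field; repeat split; auto. }
    assert (D1q : D1 t = (- (2) * (cw * Cconj (S3 tau (t * w) - 0) - mu * mu * J * (S3 tau (t * J) - 0)))%C).
    { unfold D1; rewrite !wp'_S3 by auto.
      rewrite !Cmult_conj, !Cminus_conj, !Cplus_conj, conj_inv3, Copp_conj, !Cconj_R; fold cw.
      unfold J; field; repeat split; auto. }
    assert (qq : q t = (12 / (t * t) + 6 * (cw * cw) * (Cconj x1 + mu * mu * x2))%C).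
    { unfold q; rewrite !wp_Su by auto; unfold x1, x2.
      rewrite !Cplus_conj, !Cminus_conj, conj_inv, Cconj_R.
      unfold J; field; repeat split; auto. }
    assert (cwm : Cmod cw = n) by apply Cmod_conj.
    split; [auto|split; [auto|split; [|split]]].
    + rewrite Dq, !Cmod_mult, cwm, Cmod_R, Rabs_pos_eq by lra.
      assert (Hy : Cmod (Cconj y1 - mu * mu * mu * mu * mu * mu * y2) <= 2 * V * n * t).
      { eapply Rle_trans; [apply Cmod_triangle|]; rewrite Cmod_opp, !Cmod_mult, Cmod_conj, Hmu; lra. }
      assert (0 <= 2 * n * (2 * T * n)).
      { apply Rmult_le_pos; [lra|]; apply Rmult_le_pos; lra. }
      assert (0 < t ^ 4) by (apply pow_lt; auto); assert (0 < n ^ 4) by (apply pow_lt; auto).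
      replace (t * t * t * t * (n * n * n * n)) with (t ^ 4 * n ^ 4) by ring.
      apply Rle_trans with (t ^ 4 * n ^ 4 * (2 * V * n * t)).
      * apply Rmult_le_compat_l; auto; apply Rmult_le_pos; lra.
      * replace ((n ^ 4 * (2 * V * n) + 2 * n * (2 * T * n)) * t ^ 5)
          with (t ^ 4 * n ^ 4 * (2 * V * n * t) + 2 * n * (2 * T * n) * t ^ 5) by ring.
        assert (0 < t ^ 5) by (apply pow_lt; auto).
        assert (0 <= 2 * n * (2 * T * n) * t ^ 5) by (apply Rmult_le_pos; lra); lra.
    + rewrite D1q, Cmod_mult, Cmod_opp, Cmod_R, (Rabs_pos_eq 2) by lra.
      assert (Cmod (cw * Cconj (S3 tau (t * w) - 0) - mu * mu * J * (S3 tau (t * J) - 0)) <= n * (T * (t * n)) + n * (T * (t * n))).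
      { eapply Rle_trans; [apply Cmod_triangle|]; rewrite Cmod_opp, !Cmod_mult, Cmod_conj, Hmu, Cmod_J, cwm.
        fold n; assert (n * Cmod (S3 tau (t * w) - 0) <= n * (T * (t * n))) by (apply Rmult_le_compat_l; lra).
        assert (n * Cmod (S3 tau (t * J) - 0) <= n * (T * (t * n))) by (apply Rmult_le_compat_l; lra).
        lra. }
      assert (0 <= n ^ 4 * (2 * V * n) * t).
      { assert (0 < n ^ 4) by (apply pow_lt; auto).
        apply Rmult_le_pos; [|lra]; apply Rmult_le_pos; [lra|]; apply Rmult_le_pos; lra. }
      replace ((n ^ 4 * (2 * V * n) + 2 * n * (2 * T * n)) * t) with
        (n ^ 4 * (2 * V * n) * t + 2 * (n * (T * (t * n)) + n * (T * (t * n)))) by ring.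
      lra.
    + rewrite qq; eapply Rle_trans; [apply Cmod_triangle|].
      rewrite Cmod_div, !Cmod_mult, !Cmod_R, (Rabs_pos_eq 12), (Rabs_pos_eq 6), (Rabs_pos_eq t), cwm
        by (lra || (apply Cmult_neq_0; auto)).
      assert (Cmod (Cconj x1 + mu * mu * x2) <= 2 * (U * (t * n))).
      { eapply Rle_trans; [apply Cmod_triangle|]; rewrite !Cmod_mult, Cmod_conj, Hmu; lra. }
      assert (6 * (n * n) * Cmod (Cconj x1 + mu * mu * x2) <= 6 * (n * n) * (2 * (U * (t * n)))).
      { apply Rmult_le_compat_l; auto; nra. }
      assert (tt : 12 * n ^ 3 * U * t <= 1).
      { apply Rmult_lt_compat_l with (r := 12 * n ^ 3 * U + 1) in t3; [|lra].
        rewrite Rinv_r in t3 by lra; nra. }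
      assert (1 <= 1 / t ^ 2).
      { unfold Rdiv; rewrite Rmult_1_l, <- Rinv_1; apply Rinv_le_contravar; [apply pow_lt; auto|nra]. }
      replace (13 / t ^ 2) with (12 / (t * t) + 1 / t ^ 2) by (field; lra).
      nra.
Qed.

(** The singular uniqueness argument covers an initial interval, including the first derivative;
    from e/2 onwards the coefficient [q] is bounded and Gronwall's argument takes over. *)
Lemma reflection_zero X : X <= 1 -> (forall x : R, 0 < x < X -> ~ lattice tau (x * J)%C) ->
  forall x, 0 < x < X -> D x = 0%C.
Proof.
  intros X1 HX.
  destruct reflection_near_0 as (e & M & [e0 e1] & M0 & He).
  assert (Hnear : forall x, 0 < x < e -> fst (D x) = 0 /\ snd (D x) = 0).
  { apply (singular_ode_zero _ (fun t => fst (D1 t)) (fun t => fst (D2 t))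
      _ (fun t => snd (D1 t)) (fun t => snd (D2 t)) e M M); auto.
    - intros x Hx; destruct (He x Hx) as (L1 & L2 & _); apply reflection_derivatives; auto.
    - intros x Hx; destruct (He x Hx) as (L1 & L2 & _ & _ & Hq).
      rewrite !Cmod2_parts, reflection_ode, Cmod_mult, Rpow_mult_distr by auto.
      apply Rmult_le_compat_r; [apply pow2_ge_0|]; apply pow_incr; split; auto; apply Cmod_ge_0.
    - intros x Hx; destruct (He x Hx) as (_ & _ & HD & _).
      rewrite Cmod2_parts; apply pow_incr; split; auto; apply Cmod_ge_0.
    - intros x Hx; destruct (He x Hx) as (_ & _ & _ & HD1 & _); split;
        (eapply Rle_trans; [|apply HD1]); [apply Rabs_fst_le|apply Rabs_snd_le]. }
  assert (Hnear1 : forall x, 0 < x < e -> fst (D1 x) = 0 /\ snd (D1 x) = 0).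
  { intros x Hx; split.
    - apply (is_derive_zero_on (fun t => fst (D t)) (fun t => fst (D1 t)) e); auto.
      + intros y Hy; destruct (He y Hy) as (L1 & L2 & _); apply reflection_derivatives; auto.
      + intros y Hy; apply Hnear; auto.
    - apply (is_derive_zero_on (fun t => snd (D t)) (fun t => snd (D1 t)) e); auto.
      + intros y Hy; destruct (He y Hy) as (L1 & L2 & _).
        destruct (reflection_derivatives y L1 L2) as (_ & _ & ? & _); auto.
      + intros y Hy; apply Hnear; auto. }
  intros x Hx.
  destruct (Rlt_dec x e) as [Hxe|Hxe].
  { destruct (Hnear x ltac:(lra)); apply injective_projections; auto. }
  set (a := e / 2).
  assert (Hax : a < x) by (unfold a; lra).
  assert (La : forall t, a <= t <= x -> ~ lattice tau (t * w)%C /\ ~ lattice tau (t * J)%C).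
  { intros t Htt; unfold a in Htt; split; [apply Hprim|apply HX]; lra. }
  destruct (line_bounded (fun z => wp z tau) w a x ltac:(lra)) as [B1 HB1].
  { intros t Htt; eexists; apply cder_wp; auto; apply La; auto. }
  destruct (line_bounded (fun z => wp z tau) J a x ltac:(lra)) as [B2 HB2].
  { intros t Htt; eexists; apply cder_wp; auto; apply La; auto. }
  set (n := Cmod w).
  assert (Kb : forall t, a <= t <= x -> Cmod (q t) <= 6 * n * n * (B1 + B2)).
  { intros t Htt; unfold q; rewrite !Cmod_mult, Cmod_R, (Rabs_pos_eq 6) by lra.
    replace (Cmod cw) with n by (symmetry; apply Cmod_conj).
    assert (0 <= n) by apply Cmod_ge_0.
    apply Rmult_le_compat_l; [apply Rmult_le_pos; nra|].
    eapply Rle_trans; [apply Cmod_triangle|]; rewrite !Cmod_mult, Cmod_conj, Hmu.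
    specialize (HB1 t Htt); specialize (HB2 t Htt); lra. }
  destruct (gronwall_zero (fun t => fst (D t)) (fun t => fst (D1 t)) (fun t => fst (D2 t))
      (fun t => snd (D t)) (fun t => snd (D1 t)) (fun t => snd (D2 t)) a x (6 * n * n * (B1 + B2)))
    as [Z1 Z2]; auto.
  - eapply Rle_trans; [apply Cmod_ge_0|apply (Kb a); lra].
  - intros t Htt; apply reflection_derivatives; apply La; auto.
  - intros t Htt; destruct (La t Htt) as [L1 L2].
    rewrite !Cmod2_parts, reflection_ode, Cmod_mult, Rpow_mult_distr by auto.
    apply Rmult_le_compat_r; [apply pow2_ge_0|]; apply pow_incr; split; auto; apply Cmod_ge_0.
  - apply Hnear; unfold a; lra.
  - apply Hnear; unfold a; lra.
  - apply Hnear1; unfold a; lra.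
  - apply Hnear1; unfold a; lra.
  - apply injective_projections; auto.
Qed.

Lemma D_zero_Cmod (x : R) : D x = 0%C -> Cmod (wp (x * J)%C tau) = Cmod (wp (x * w)%C tau).
Proof.
  intros H; assert (E : Cconj (wp (x * w)%C tau) = (mu * mu * wp (x * J)%C tau)%C).
  { apply Csub_eq0; exact H. }
  apply (f_equal Cmod) in E; rewrite Cmod_conj, !Cmod_mult, Hmu in E; lra.
Qed.

(** Continuation to the supremum X of the admissible lengths. A lattice point at X J would be
    transferred to X w, contradicting [Hprim] if X < 1; otherwise openness lets the interval grow
    past X. *)
Lemma reflection_free : forall x : R, 0 < x < 1 -> ~ lattice tau (x * J)%C.
Proof.
  set (good := fun X => 0 < X <= 1 /\ forall x : R, 0 < x < X -> ~ lattice tau (x * J)%C).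
  destruct reflection_near_0 as (e & M & [e0 e1] & _ & He).
  assert (G0 : good e).
  { split; [lra|]; intros x Hx; apply He; auto. }
  destruct (completeness good) as [X [HX1 HX2]].
  { exists 1; intros X [HX _]; lra. }
  { exists e; auto. }
  assert (X0 : 0 < X) by (specialize (HX1 e G0); lra).
  assert (X1 : X <= 1) by (apply HX2; intros Y [HY _]; lra).
  assert (GX : forall x : R, 0 < x < X -> ~ lattice tau (x * J)%C).
  { intros x Hx Hl.
    assert (X <= x); [|lra].
    apply HX2; intros Y [HY1 HY2]; apply Rnot_lt_le; intros Hlt; apply (HY2 x); auto; lra. }
  destruct (Req_dec X 1) as [->|Xne]; auto; exfalso.
  assert (HXJ : ~ lattice tau (X * J)%C).
  { intros Hl; apply (Hprim X ltac:(lra)).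
    apply (pole_transfer tau J w X Ht X0 J_neq_0); auto.
    intros x Hx; apply D_zero_Cmod, (reflection_zero X); auto. }
  destruct (not_lattice_open tau Ht _ HXJ) as [d [d0 Hd]].
  assert (jm : 0 < Cmod J) by (apply Cmod_gt_0, J_neq_0).
  set (s := Rmin (1 - X) (d / (2 * Cmod J))).
  assert (s0 : 0 < s) by (apply Rmin_pos; [lra|apply Rdiv_lt_0_compat; lra]).
  assert (sd : s * Cmod J <= d / 2).
  { assert (s <= d / (2 * Cmod J)) by apply Rmin_r.
    apply Rmult_le_compat_r with (r := Cmod J) in H; [|lra].
    replace (d / (2 * Cmod J) * Cmod J) with (d / 2) in H by (field; lra); auto. }
  assert (s1 : s <= 1 - X) by apply Rmin_l.
  assert (GS : good (X + s)).
  { split; [lra|]; intros x Hx.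
    destruct (Rlt_dec x X) as [Hlt|Hge]; [apply GX; lra|].
    replace (x * J)%C with (X * J + (x - X)%R * J)%C by (rewrite RtoC_minus; ring).
    apply Hd; rewrite Cmod_mult, Cmod_R, Rabs_pos_eq by lra; nra. }
  specialize (HX1 _ GS); lra.
Qed.

(** With the symmetry valid on the open segment, the pole at w forces one at its mirror image J. *)
Lemma reflection_lattice : lattice tau J /\
  forall x : R, 0 < x < 1 -> ~ lattice tau (x * J)%C /\ Cconj (wp (x * w)%C tau) = (mu * mu * wp (x * J)%C tau)%C.
Proof.
  pose proof reflection_free as HF.
  pose proof (reflection_zero 1 (Rle_refl 1) HF) as HZ.
  split.
  - replace J with (1%R * J)%C by ring.
    apply (pole_transfer tau w J 1 Ht Rlt_0_1 w0).
    + intros x Hx; symmetry; apply D_zero_Cmod; auto.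
    + replace (1%R * w)%C with w by ring; auto.
  - intros x Hx; split; auto; apply Csub_eq0, HZ; auto.
Qed.

End Reflection.

(** An integral 2 by 2 matrix of trace 1 and determinant 0 is a rank-one projection; over Z it
    factors as a column (x, y) times a row (u, v). The column is the primitive vector obtained by
    dividing the first column by its gcd. *)
Lemma Z_idempotent_factor (A B Cc D : Z) : (A + D = 1)%Z -> (A * D = B * Cc)%Z ->
  exists x y u v : Z, (A = x * u /\ Cc = y * u /\ B = x * v /\ D = y * v)%Z.
Proof.
  intros H1 H2.
  destruct (Z.eq_dec Cc 0) as [->|C0].
  - assert (HA : (A = 0 \/ D = 0)%Z) by (apply Z.mul_eq_0; lia).
    destruct HA as [->| ->].
    + exists B, 1%Z, 0%Z, 1%Z; lia.
    + exists 1%Z, 0%Z, 1%Z, B; lia.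
  - destruct (Z.gcd_divide_l A Cc) as [x Hx]; destruct (Z.gcd_divide_r A Cc) as [y Hy].
    pose proof (Z.gcd_nonneg A Cc) as g0; set (g := Z.gcd A Cc) in *.
    assert (G : g <> 0%Z) by (intros E; rewrite E in Hy; lia).
    assert (Y0 : y <> 0%Z) by (intros E; rewrite E in Hy; lia).
    assert (Hc : Z.gcd x y = 1%Z).
    { assert (E : (Z.gcd (x * g) (y * g) = Z.gcd x y * g)%Z) by (apply Z.gcd_mul_mono_r_nonneg; auto).
      rewrite <- Hx, <- Hy in E; fold g in E.
      apply Z.mul_reg_r with g; auto; lia. }
    assert (Hd : (x * D = B * y)%Z).
    { apply Z.mul_reg_r with g; auto; rewrite Hx, Hy in H2; lia. }
    assert (Hyd : (y | D)%Z).
    { apply Z.gauss with x; [exists B; auto|rewrite Z.gcd_comm; auto]. }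
    destruct Hyd as [v Hv].
    exists x, y, g, v; repeat split; auto; [|lia].
    apply Z.mul_reg_r with y; auto; rewrite <- Hd, Hv; ring.
Qed.

Lemma Cmult_cancel (a x y : C) : a <> 0%C -> (a * x)%C = (a * y)%C -> x = y.
Proof.
  intros Ha E; replace x with (a * x / a)%C by (field; auto); rewrite E; field; auto.
Qed.

Lemma segment_not_lattice tau : 0 < snd tau ->
  (forall x : R, 0 < x < 1 -> ~ lattice tau (x * 1)%C) /\
  (forall x : R, 0 < x < 1 -> ~ lattice tau (x * tau)%C).
Proof.
  intros Ht.
  assert (NI : forall (x : R) (m : Z), 0 < x < 1 -> x <> IZR m).
  { intros x m Hx E; rewrite E in Hx; destruct Hx as [H1 H2].
    apply lt_IZR in H1; apply lt_IZR in H2; lia. }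
  split; intros x Hx (m & n & E).
  - replace (x * 1)%C with (grid tau x 0) in E by (unfold grid; ring).
    apply grid_inj in E; auto; apply (NI x m Hx), E.
  - replace (x * tau)%C with (grid tau 0 x) in E by (unfold grid; ring).
    apply grid_inj in E; auto; apply (NI x n Hx), E.
Qed.

Lemma Z_parity_cases (p : Z) : (exists i, p = 2 * i)%Z \/ (exists i, p = 1 + 2 * i)%Z.
Proof.
  destruct (Z.Even_or_Odd p) as [[i H]|[i H]]; [left|right]; exists i; lia.
Qed.

(** A half period is determined modulo the lattice by its parities. Since wp takes distinct values
    on the three nonzero classes, the value identifies the class. *)
Lemma half_period_value tau (p r : Z) (e : C) : 0 < snd tau ->
  ~ lattice tau (grid tau (IZR p / 2) (IZR r / 2)) ->
  wp (grid tau (IZR p / 2) (IZR r / 2)) tau = e ->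
  e1 tau <> e2 tau -> e1 tau <> e3 tau -> e2 tau <> e3 tau ->
  (e = e1 tau -> (exists i, p = 1 + 2 * i)%Z /\ (exists i, r = 2 * i)%Z) /\
  (e = e2 tau -> (exists i, p = 2 * i)%Z /\ (exists i, r = 1 + 2 * i)%Z).
Proof.
  intros Ht Hl He N12 N13 N23; rewrite e1_grid, e2_grid, e3_grid in *.
  destruct (Z_parity_cases p) as [[i Hi]|[i Hi]], (Z_parity_cases r) as [[j Hj]|[j Hj]].
  - exfalso; apply Hl; exists i, j; rewrite Hi, Hj, !mult_IZR; f_equal; field.
  - assert (E : wp (grid tau (IZR p / 2) (IZR r / 2)) tau = wp (grid tau (IZR 0 / 2) (IZR 1 / 2)) tau).
    { apply (wp_half_mod2 tau Ht); auto; [exists i|exists j]; lia. }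
    rewrite E in He; split; intros H; [exfalso; apply N12; congruence|].
    split; [exists i|exists j]; auto.
  - assert (E : wp (grid tau (IZR p / 2) (IZR r / 2)) tau = wp (grid tau (IZR 1 / 2) (IZR 0 / 2)) tau).
    { apply (wp_half_mod2 tau Ht); auto; [exists i|exists j]; lia. }
    rewrite E in He; split; intros H; [|exfalso; apply N12; congruence].
    split; [exists i|exists j]; auto.
  - assert (E : wp (grid tau (IZR p / 2) (IZR r / 2)) tau = wp (grid tau (IZR 1 / 2) (IZR 1 / 2)) tau).
    { apply (wp_half_mod2 tau Ht); auto; [exists i|exists j]; lia. }
    rewrite E in He; split; intros H; exfalso; [apply N13|apply N23]; congruence.
Qed.

(* [mu = p + r tau] and [mu conj tau = q + d tau] with [p] odd, [r] and [q] even encode that the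
   reflection [z |-> mu conj z] preserves the lattice and fixes the half periods. *)
Lemma reflection_matrix tau : 0 < snd tau ->
  Cim (t_of tau) = 0 -> t_of tau <> Czero -> t_of tau <> Cone ->
  exists (mu : C) (p r q d : Z), Cmod mu = 1 /\
    mu = grid tau (IZR p) (IZR r) /\ (mu * Cconj tau)%C = grid tau (IZR q) (IZR d) /\
    (exists i, p = 1 + 2 * i)%Z /\ (exists i, r = 2 * i)%Z /\ (exists i, q = 2 * i)%Z.
Proof.
  intros Ht Him H0 H1.
  assert (K1 := half_cubic tau Ht 1 0 _ (or_introl eq_refl) (e1_grid tau)).
  assert (K2 := half_cubic tau Ht 0 1 _ (or_intror eq_refl) (e2_grid tau)).
  assert (K3 := half_cubic tau Ht 1 1 _ (or_introl eq_refl) (e3_grid tau)).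
  set (E1 := e1 tau : C) in *; set (E2 := e2 tau : C) in *; set (E3 := e3 tau : C) in *.
  set (c := (E2 - E1)%C).
  assert (Et : t_of tau = ((E3 - E1) / c)%C) by reflexivity.
  (* Division by 0 returns 0, so a vanishing denominator would give t = 0, which is excluded. *)
  assert (c0 : c <> 0%C).
  { intros E; apply H0; rewrite Et, E.
    change Czero with (RtoC 0); unfold Cdiv; replace (/ 0)%C with (RtoC 0); [apply Csub_eq0; ring|].
    apply injective_projections; simpl; unfold Rdiv; ring. }
  set (x := fst (t_of tau)).
  assert (Etx : t_of tau = RtoC x) by (apply injective_projections; auto).
  assert (E3x : (E3 - E1)%C = (x * c)%C).
  { rewrite <- Etx, Et; field; auto. }
  assert (x0 : RtoC x <> 0%C) by (intros E; apply H0; rewrite Etx; auto).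
  assert (x1 : (RtoC x - 1)%C <> 0%C).
  { intros E; apply H1; rewrite Etx; apply Csub_eq0; auto. }
  assert (N12 : E1 <> E2) by (intros E; apply c0; unfold c; rewrite E; ring).
  assert (N13 : E1 <> E3).
  { intros E; apply (Cmult_neq_0 _ _ x0 c0); rewrite <- E3x, E; ring. }
  assert (N23 : E2 <> E3).
  { intros E; apply (Cmult_neq_0 _ _ x1 c0).
    transitivity ((x * c) - c)%C; [ring|]; rewrite <- E3x; unfold c; rewrite E; ring. }
  set (a := Sa tau) in *; set (b := Sb tau 0) in *.
  (* Differences of the cubic equations at two distinct roots give the symmetric relations, from
     which the vanishing of the sum of the roots is extracted by eliminating [a]. *)
  assert (A12 : (5 * a)%C = (E1 * E1 + E1 * E2 + E2 * E2)%C).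
  { apply Cmult_cancel with (4 * c)%C.
    - apply Cmult_neq_0; auto; intros E; apply RtoC_inj in E; lra.
    - apply Csub_eq0.
      transitivity ((4 * E1 * E1 * E1 - 20 * a * E1 - 28 * b) - (4 * E2 * E2 * E2 - 20 * a * E2 - 28 * b))%C;
        [unfold c; ring|]; rewrite K1, K2; ring. }
  assert (A13 : (5 * a)%C = (E1 * E1 + E1 * E3 + E3 * E3)%C).
  { apply Cmult_cancel with (4 * (E3 - E1))%C.
    - rewrite E3x; repeat apply Cmult_neq_0; auto; intros E; apply RtoC_inj in E; lra.
    - apply Csub_eq0.
      transitivity ((4 * E1 * E1 * E1 - 20 * a * E1 - 28 * b) - (4 * E3 * E3 * E3 - 20 * a * E3 - 28 * b))%C;
        [ring|]; rewrite K1, K3; ring. }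
  assert (S0 : (E1 + E2 + E3)%C = 0%C).
  { apply Cmult_cancel with (E2 - E3)%C.
    - intros E; apply N23, Csub_eq0; auto.
    - transitivity ((E1 * E1 + E1 * E2 + E2 * E2) - (E1 * E1 + E1 * E3 + E3 * E3))%C; [ring|].
      rewrite <- A12, <- A13; ring. }
  (* Zero sum and E3 - E1 = x c with x real express the half-period values as real multiples of
     c. *)
  assert (Y1 : E1 = (RtoC (- (1 + x) / 3) * c)%C).
  { replace (RtoC (- (1 + x) / 3)) with (- (1 + x) / 3)%C by (apply injective_projections; simpl; field).
    transitivity ((E1 + E2 + E3) / 3 - (c + (E3 - E1)) / 3)%C; [unfold c; field|].
    rewrite S0, E3x; field. }
  assert (Y2 : E2 = (RtoC ((2 - x) / 3) * c)%C).
  { replace (RtoC ((2 - x) / 3)) with ((2 - x) / 3)%C by (apply injective_projections; simpl; field).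
    transitivity (c + E1)%C; [unfold c; ring|]; rewrite Y1.
    replace (RtoC (- (1 + x) / 3)) with (- (1 + x) / 3)%C by (apply injective_projections; simpl; field).
    field. }
  set (n := Cmod c).
  assert (n0 : 0 < n) by (apply Cmod_gt_0; auto).
  assert (nC : RtoC n <> 0%C) by (intros E; apply RtoC_inj in E; lra).
  (* The unit number with mu^2 c = conj c. It conjugates the half-period values, and then g2 and g3,
     by the powers of mu required for the reflection. *)
  set (mu := (Cconj c / n)%C).
  assert (Hm : Cmod mu = 1).
  { unfold mu; rewrite Cmod_div, Cmod_conj, Cmod_R, Rabs_pos_eq by (auto; lra); fold n; field; lra. }
  assert (mu0 : mu <> 0%C) by (apply Cmod_gt_0; rewrite Hm; lra).
  assert (Hc : (mu * mu * c)%C = Cconj c).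
  { pose proof (Cmod2_conj c) as E; fold n in E.
    unfold mu; transitivity (Cconj c * (c * Cconj c) / (n * n))%C; [field; auto|].
    rewrite <- E, RtoC_pow; field; auto. }
  assert (CE1 : Cconj E1 = (mu * mu * E1)%C).
  { rewrite Y1, Cmult_conj, Cconj_R, <- Hc; ring. }
  assert (CE2 : Cconj E2 = (mu * mu * E2)%C).
  { rewrite Y2, Cmult_conj, Cconj_R, <- Hc; ring. }
  assert (Ea : a = ((E1 * E1 + E1 * E2 + E2 * E2) / 5)%C) by (rewrite <- A12; field).
  assert (Eb : b = ((4 * E1 * E1 * E1 - 20 * a * E1) / 28)%C).
  { transitivity ((4 * E1 * E1 * E1 - 20 * a * E1 - (4 * E1 * E1 * E1 - 20 * a * E1 - 28 * b)) / 28)%C; [field|].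
    rewrite K1; field. }
  assert (F5 : RtoC 5 <> 0%C) by (intros E; apply RtoC_inj in E; lra).
  assert (F28 : RtoC 28 <> 0%C) by (intros E; apply RtoC_inj in E; lra).
  assert (Ha : Cconj a = (mu * mu * mu * mu * a)%C).
  { rewrite Ea, Cdiv_conj, !Cplus_conj, !Cmult_conj, CE1, CE2, Cconj_R by auto; field. }
  assert (Hb : Cconj b = (mu * mu * mu * mu * mu * mu * b)%C).
  { rewrite Eb, Cdiv_conj, !Cminus_conj, !Cmult_conj, Ha, CE1, !Cconj_R by auto; field. }
  destruct (segment_not_lattice tau Ht) as [P1 Pt].
  assert (one0 : RtoC 1 <> 0%C) by (intros E; apply RtoC_inj in E; lra).
  assert (tau0 : tau <> RtoC 0) by (intros E; rewrite E in Ht; simpl in Ht; lra).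
  destruct (reflection_lattice tau mu 1%C Ht Hm Ha Hb (lattice_1 tau) one0 P1) as [L1 V1].
  destruct (reflection_lattice tau mu tau Ht Hm Ha Hb (lattice_tau tau) tau0 Pt) as [L2 V2].
  destruct L1 as (p & r & Lp); destruct L2 as (q & d & Lq).
  assert (Emu : mu = grid tau (IZR p) (IZR r)).
  { rewrite <- Lp, Cconj_R; ring. }
  assert (Hh : forall m n : Z, (RtoC (1 / 2) * grid tau (IZR m) (IZR n))%C = grid tau (IZR m / 2) (IZR n / 2)).
  { intros; unfold grid; apply injective_projections; simpl; field. }
  (* At the midpoints the symmetry says that the images of 1/2 and tau/2 have the values e1 and e2
     of wp; this fixes the parities of their coordinates. *)
  destruct (V1 (1 / 2) ltac:(lra)) as [W1 W2]; rewrite Lp, Hh in W1, W2.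
  destruct (V2 (1 / 2) ltac:(lra)) as [W3 W4]; rewrite Lq, Hh in W3, W4.
  assert (Q1 : wp (RtoC (1 / 2) * 1)%C tau = E1).
  { unfold E1, e1; f_equal; apply injective_projections; simpl; ring. }
  assert (Q2 : wp (RtoC (1 / 2) * tau)%C tau = E2) by reflexivity.
  rewrite Q1, CE1 in W2; rewrite Q2, CE2 in W4.
  apply Cmult_cancel in W2; [|apply Cmult_neq_0; auto].
  apply Cmult_cancel in W4; [|apply Cmult_neq_0; auto].
  destruct (proj1 (half_period_value tau p r E1 Ht W1 (eq_sym W2) N12 N13 N23) eq_refl) as [Hp Hr].
  destruct (proj2 (half_period_value tau q d E2 Ht W3 (eq_sym W4) N12 N13 N23) eq_refl) as [Hq _].
  exists mu, p, r, q, d; auto 10.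
Qed.

(** The reflection R has integral entries with p odd and q, r even, so (1 + R)/2 is an integral
    projection. Its image and kernel are the eigenlines for 1 and -1; they are spanned by [o1] and
    [o2], of determinant 1, and are orthogonal. *)
Lemma orthogonal_basis tau : 0 < snd tau ->
  Cim (t_of tau) = 0 -> t_of tau <> Czero -> t_of tau <> Cone ->
  exists (a1 b1 a2 b2 : Z) (b : R), 0 < b /\ (a1 * b2 - b1 * a2 = 1)%Z /\
    grid tau (IZR a2) (IZR b2) = (qtau b * grid tau (IZR a1) (IZR b1))%C.
Proof.
  intros Ht Him H0 H1.
  destruct (reflection_matrix tau Ht Him H0 H1) as (mu & p & r & q & d & Hm & Emu & Et & [i Hi] & [j Hj] & [k Hk]).
  (* Imaginary parts of mu conj tau: the reflection has trace 0. *)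
  assert (Hd : (d = - p)%Z).
  { apply eq_IZR; rewrite opp_IZR; apply Rmult_eq_reg_r with (snd tau); [|lra].
    rewrite Emu in Et; apply (f_equal snd) in Et; unfold grid in Et; simpl in Et; lra. }
  (* The real part of mu conj tau expresses q through p, r and tau; together with |mu| = 1 this says
     that the reflection has determinant -1. *)
  assert (Hdet : (p * p + q * r = 1)%Z).
  { apply eq_IZR; rewrite plus_IZR, !mult_IZR.
    assert (N : (fst mu) ^ 2 + (snd mu) ^ 2 = 1) by (rewrite Cmod2_parts, Hm; ring).
    assert (Q : fst (mu * Cconj tau)%C = IZR q + IZR d * fst tau) by (rewrite Et; unfold grid; simpl; ring).
    rewrite Hd, opp_IZR in Q.
    assert (m1 : fst mu = IZR p + IZR r * fst tau) by (rewrite Emu; unfold grid; simpl; ring).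
    assert (m2 : snd mu = IZR r * snd tau) by (rewrite Emu; unfold grid; simpl; ring).
    assert (Q' : fst (mu * Cconj tau)%C = fst mu * fst tau + snd mu * snd tau) by (simpl; ring).
    rewrite Q', m1, m2 in Q; rewrite m1, m2 in N.
    assert (q_eq : IZR q = IZR r * (fst tau * fst tau + snd tau * snd tau) + 2 * IZR p * fst tau) by lra.
    rewrite q_eq; lra. }
  destruct (Z_idempotent_factor (1 + i) k j (- i)) as (x & y & u & v & F1 & F2 & F3 & F4); [lia|nia|].
  assert (Huv : (x * u + y * v = 1)%Z) by lia.
  (* The column (x, y) of the projection spans its image, and (-v, u) is annihilated by the row (u,
     v). *)
  set (o1 := grid tau (IZR x) (IZR y)); set (o2 := grid tau (IZR (- v)) (IZR u)).
  assert (RF : forall m n m' n' : Z, (m * p + n * q = m')%Z -> (m * r + n * d = n')%Z ->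
    (mu * Cconj (grid tau (IZR m) (IZR n)))%C = grid tau (IZR m') (IZR n')).
  { intros m n m' n' <- <-.
    transitivity (IZR m * mu + IZR n * (mu * Cconj tau))%C.
    - unfold grid; rewrite Cplus_conj, Cmult_conj, !Cconj_R; ring.
    - rewrite Et, Emu; unfold grid; rewrite !plus_IZR, !mult_IZR, !RtoC_plus, !RtoC_mult; ring. }
  assert (J1 : (mu * Cconj o1)%C = o1).
  { apply RF; rewrite ?Hd, ?Hi, ?Hj, ?Hk, ?F3, ?F2.
    - transitivity (x * (1 + 2 * i) + 2 * x * (y * v))%Z; [ring|]; rewrite <- F4; ring.
    - transitivity (2 * y * (x * u) - y * (1 + 2 * i))%Z; [ring|]; rewrite <- F1; ring. }
  assert (J2 : (mu * Cconj o2)%C = (- o2)%C).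
  { unfold o2; rewrite <- grid_opp, <- !opp_IZR, Z.opp_involutive; apply RF; rewrite ?Hd, ?Hi, ?Hj, ?Hk, ?F3, ?F2.
    - transitivity (- v * (1 + 2 * i) + 2 * v * (x * u))%Z; [ring|]; rewrite <- F1; ring.
    - transitivity (- 2 * u * (y * v) - u * (1 + 2 * i))%Z; [ring|]; rewrite <- F4; ring. }
  assert (o1n : o1 <> 0%C).
  { intros E; unfold o1 in E; replace (RtoC 0) with (grid tau 0 0) in E by (unfold grid; ring).
    apply grid_inj in E; auto; destruct E as [Ex Ey]; apply eq_IZR in Ex, Ey; lia. }
  assert (mu0 : mu <> 0%C) by (apply Cmod_gt_0; rewrite Hm; lra).
  assert (co1 : Cconj o1 <> 0%C) by (apply Cmod_gt_0; rewrite Cmod_conj; apply Cmod_gt_0; auto).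
  set (w := (o2 / o1)%C).
  assert (Ew : Cconj w = (- w)%C).
  { unfold w; rewrite Cdiv_conj by auto.
    replace (Cconj o2 / Cconj o1)%C with ((mu * Cconj o2) / (mu * Cconj o1))%C by (field; auto).
    rewrite J1, J2; field; auto. }
  assert (fw : fst w = 0) by (apply (f_equal fst) in Ew; change (fst w = - fst w) in Ew; lra).
  assert (Eo : o2 = (qtau (snd w) * o1)%C).
  { transitivity (w * o1)%C; [unfold w; field; auto|]; f_equal.
    unfold qtau; rewrite <- fw; destruct w; auto. }
  exists x, y, (- v)%Z, u, (snd w); split; [|split; [lia|exact Eo]].
  assert (N : 0 < fst o1 ^ 2 + snd o1 ^ 2).
  { rewrite Cmod2_parts; apply pow_lt, Cmod_gt_0; auto. }
  (* The oriented area of the basis is Im tau because the determinant is 1; it is also the imaginary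
     part of [o2]/[o1] times |o1|^2, so this ratio has positive imaginary part. *)
  assert (Dt : fst o1 * snd o2 - snd o1 * fst o2 = snd tau).
  { apply (f_equal IZR) in Huv; rewrite plus_IZR, !mult_IZR in Huv.
    unfold o1, o2, grid; rewrite opp_IZR; simpl.
    transitivity (snd tau * (IZR x * IZR u + IZR y * IZR v)); [ring|rewrite Huv; ring]. }
  assert (G : forall (t : R) (z : C), fst (qtau t * z)%C = - t * snd z /\ snd (qtau t * z)%C = t * fst z)
    by (intros; unfold qtau; simpl; split; ring).
  destruct (G (snd w) o1) as [G1 G2]; rewrite Eo, G1, G2 in Dt.
  apply Rmult_lt_reg_r with (fst o1 ^ 2 + snd o1 ^ 2); auto.
  rewrite Rmult_0_l; replace (snd w * (fst o1 ^ 2 + snd o1 ^ 2)) with (snd tau); auto.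
  rewrite <- Dt; ring.
Qed.

(** * Dependence on the modulus and the theorem *)

Definition upper (tau : C) : Prop := 0 < snd tau.

Lemma upper_open : Copen upper.
Proof.
  intros tau Ht; exists (snd tau); split; [exact Ht|]; intros h Hh; unfold upper; simpl.
  pose proof (Rabs_snd_le h); pose proof (Rle_abs (- snd h)); rewrite Rabs_Ropp in H0; lra.
Qed.

Section VariableModulus.

Context (x y : R).
Hypothesis Hxy : forall tau, upper tau -> offpoles tau (grid tau x y).

Lemma ZZ_wt_coord k j : ZZ_wt (k, j) * Rabs (IZR k) <= 1 /\ ZZ_wt (k, j) * Rabs (IZR j) <= 1.
Proof.
  unfold ZZ_wt; simpl; pose proof (Rabs_pos (IZR k)); pose proof (Rabs_pos (IZR j)).
  set (s := 1 + Rabs (IZR k) + Rabs (IZR j)).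
  assert (s0 : 0 < s) by (unfold s; lra).
  split; apply Rmult_le_reg_l with s; auto;
    rewrite <- Rmult_assoc, Rinv_r, Rmult_1_l by lra; unfold s; lra.
Qed.

(** With the real coordinates (x, y) fixed, the denominators (x - m) + (y - n) tau are affine in
    tau, and the estimates used for the dependence on z apply with tau as the variable. *)
Lemma FD_lr_tau n : FD ZZ_wt upper 1 n (fun p tau => lr tau p (grid tau x y)).
Proof.
  set (a := fun p => if origin p then RtoC 0 else RtoC (ZZ_wt p)).
  set (a' := fun p => if origin p then RtoC 0 else RtoC (ZZ_wt p * (y - IZR (snd p)))).
  set (b' := fun p => if origin p then RtoC 1 else RtoC (ZZ_wt p * (x - IZR (fst p)))).
  assert (E : forall p tau, origin p = false ->
    (a' p * tau + b' p)%C = (ZZ_wt p * (grid tau x y - lp tau p))%C).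
  { intros p tau Hp; unfold a', b'; rewrite Hp; unfold lp, grid.
    rewrite !RtoC_mult, !RtoC_minus; ring. }
  apply FD_ext with (fun p tau => a p * / (a' p * tau + b' p))%C; [apply upper_open| |].
  - intros p tau Htau; unfold lr, guard; destruct (origin p) eqn:Hp.
    + unfold a; rewrite Hp; ring.
    + rewrite E by auto; unfold a; rewrite Hp.
      assert (RtoC (ZZ_wt p) <> 0%C).
      { intros E'; apply RtoC_inj in E'; pose proof (ZZ_wt_pos p); lra. }
      assert ((grid tau x y - lp tau p)%C <> 0%C).
      { intros E'; apply (Hxy tau Htau p Hp), Csub_eq0; auto. }
      field; auto.
  - apply (FD_mul ZZ_wt ZZ_wt01 _ 1 0 n (fun p _ => a p)).
    + apply FD_const; exists 1; split; [lra|]; intros p; unfold a; destruct (origin p).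
      * rewrite Cmod_0; pose proof (ZZ_wt_pos p); lra.
      * rewrite Cmod_R, Rabs_pos_eq; pose proof (ZZ_wt_pos p); lra.
    + apply FD_affine_inv with (1 + Rabs y) (1 + Rabs x); auto using ZZ_wt01.
      * intros [k j]; unfold a'; pose proof (Rabs_pos y); destruct (origin _); [rewrite Cmod_0; lra|].
        rewrite Cmod_R, Rabs_mult, Rabs_pos_eq by (left; apply ZZ_wt_pos); simpl snd.
        pose proof (proj2 (ZZ_wt_coord k j)); pose proof (ZZ_wt01 (k, j)).
        assert (Rabs (y - IZR j) <= Rabs y + Rabs (IZR j)).
        { eapply Rle_trans; [apply Rabs_triang|]; rewrite Rabs_Ropp; lra. }
        pose proof (ZZ_wt_pos (k, j)); nra.
      * intros [k j]; unfold b'; pose proof (Rabs_pos x); destruct (origin _); [rewrite Cmod_1; lra|].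
        rewrite Cmod_R, Rabs_mult, Rabs_pos_eq by (left; apply ZZ_wt_pos); simpl fst.
        pose proof (proj1 (ZZ_wt_coord k j)); pose proof (ZZ_wt01 (k, j)).
        assert (Rabs (x - IZR k) <= Rabs x + Rabs (IZR k)).
        { eapply Rle_trans; [apply Rabs_triang|]; rewrite Rabs_Ropp; lra. }
        pose proof (ZZ_wt_pos (k, j)); nra.
      * intros tau Htau; destruct (offpoles_lower tau _ Htau (Hxy tau Htau)) as [c [c0 Hc]].
        exists (Rmin c 1); split; [apply Rmin_pos; lra|]; intros p.
        destruct (origin p) eqn:Hp.
        -- unfold a', b'; rewrite Hp; replace (0 * tau + 1)%C with (RtoC 1) by ring.
           rewrite Cmod_1; apply Rmin_r.
        -- rewrite E by auto; eapply Rle_trans; [apply Rmin_l|auto].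
Qed.

End VariableModulus.

(** The case of coordinates (0, 0), admissible because the origin is removed from the sum. *)
Lemma FD_li_tau n : FD ZZ_wt upper 1 n (fun p tau => li tau p).
Proof.
  replace (fun p tau => li tau p) with (fun p tau => - lr tau p (grid tau 0 0))%C.
  - apply FD_opp; [apply ZZ_wt01|]; apply FD_lr_tau; intros tau Htau.
    replace (grid tau 0 0) with (RtoC 0) by (unfold grid; ring); apply offpoles_0; auto.
  - do 2 (apply functional_extensionality; intros).
    replace (grid x0 0 0) with (RtoC 0) by (unfold grid; ring); rewrite lr_0; ring.
Qed.

Definition nonint (x y : R) : Prop := ~ exists m n : Z, x = IZR m /\ y = IZR n.

Section NonIntegral.

Context (x y : R).
Hypothesis Hxy : nonint x y.

Lemma nonint_not_lattice tau : upper tau -> ~ lattice tau (grid tau x y).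
Proof.
  intros Ht (m & n & E); apply Hxy; apply grid_inj in E; auto; exists m, n; auto.
Qed.

Lemma nonint_offpoles tau : upper tau -> offpoles tau (grid tau x y).
Proof. intros; apply not_lattice_offpoles, nonint_not_lattice; auto. Qed.

Lemma nonint_ne_0 tau : upper tau -> grid tau x y <> 0%C.
Proof. intros Ht E; apply (nonint_not_lattice tau Ht); rewrite E; apply lattice_0. Qed.

Lemma Diff_grid D n : Diff D n (fun tau => grid tau x y).
Proof. unfold grid; solve_Diff. Qed.

Lemma Diff_fsum_upper n F : FD ZZ_wt upper 3 n F -> Diff upper n (fun tau => fsum ZZ_sq (fun p => F p tau)).
Proof. apply (Diff_fsum ZZ_sq ZZ_wt 25 exhausting_ZZ). Qed.

Lemma Diff_wzeta_tau n : Diff upper n (fun tau => wzeta (grid tau x y) tau).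
Proof.
  apply Diff_ext with (fun tau => / grid tau x y + grid tau x y * grid tau x y * Sv tau (grid tau x y))%C;
    [apply upper_open| |].
  - intros tau Htau; rewrite wzeta_Sv; auto using nonint_offpoles.
  - pose proof (Diff_grid upper n) as G.
    apply Diff_add; [apply Diff_inv; auto using nonint_ne_0|].
    apply Diff_mul; [apply Diff_mul; auto|].
    apply (Diff_fsum_upper n (fun p tau => li tau p * li tau p * lr tau p (grid tau x y))%C).
    FDmul 2%nat 1%nat; [FDmul 1%nat 1%nat|]; auto using FD_li_tau, FD_lr_tau, nonint_offpoles.
Qed.

Lemma Diff_wp_tau n : Diff upper n (fun tau => wp (grid tau x y) tau).
Proof.
  apply Diff_ext with (fun tau => / (grid tau x y * grid tau x y) + grid tau x y * Su tau (grid tau x y))%C;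
    [apply upper_open| |].
  - intros tau Htau; rewrite wp_Su; auto using nonint_offpoles.
  - pose proof (Diff_grid upper n) as G.
    apply Diff_add; [apply Diff_inv; [|apply Diff_mul; auto]|].
    + intros tau Htau; pose proof (nonint_ne_0 tau Htau); apply Cmult_neq_0; auto.
    + apply Diff_mul; auto.
      apply (Diff_fsum_upper n (fun p tau => li tau p * lr tau p (grid tau x y)
        * (lr tau p (grid tau x y) - li tau p))%C).
      FDmul 2%nat 1%nat; [FDmul 1%nat 1%nat|apply FD_minus; [apply ZZ_wt01| |]];
        auto using FD_li_tau, FD_lr_tau, nonint_offpoles.
Qed.

Lemma Diff_wp'_tau n : Diff upper n (fun tau => wp' (grid tau x y) tau).
Proof.
  apply Diff_ext with (fun tau => - (2) * (/ (grid tau x y * grid tau x y * grid tau x y)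
    + S3 tau (grid tau x y)))%C; [apply upper_open| |].
  - intros tau Htau; rewrite wp'_S3; auto using nonint_offpoles.
  - pose proof (Diff_grid upper n) as G.
    apply Diff_mul; [apply Diff_const|]; apply Diff_add; [apply Diff_inv; [|repeat apply Diff_mul; auto]|].
    + intros tau Htau; pose proof (nonint_ne_0 tau Htau); repeat apply Cmult_neq_0; auto.
    + apply (Diff_fsum_upper n (fun p tau => lr tau p (grid tau x y) * lr tau p (grid tau x y)
        * lr tau p (grid tau x y))%C).
      FDmul 2%nat 1%nat; [FDmul 1%nat 1%nat|]; auto using FD_li_tau, FD_lr_tau, nonint_offpoles.
Qed.

End NonIntegral.

Lemma nonint_half1 : nonint (1 / 2) 0.
Proof.
  intros (m & n & E & _).
  assert (2 * m = 1)%Z by (apply eq_IZR; rewrite mult_IZR; lra); lia.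
Qed.

Lemma nonint_half2 : nonint 0 (1 / 2).
Proof.
  intros (m & n & _ & E).
  assert (2 * n = 1)%Z by (apply eq_IZR; rewrite mult_IZR; lra); lia.
Qed.

Lemma Diff_eta1 n : Diff upper n eta1.
Proof.
  apply Diff_ext with (fun tau => 2 * wzeta (grid tau (1 / 2) 0) tau)%C; [apply upper_open| |].
  - intros tau _; unfold eta1; change (Cscal 2) with (Cmult (RtoC 2)).
    replace (grid tau (1 / 2) 0) with (Defs.RtoC (1 / 2)); auto.
    unfold grid; apply injective_projections; simpl; ring.
  - apply Diff_mul; [apply Diff_const|apply Diff_wzeta_tau, nonint_half1].
Qed.

Lemma Diff_eta2 n : Diff upper n eta2.
Proof.
  apply Diff_ext with (fun tau => 2 * wzeta (grid tau 0 (1 / 2)) tau)%C; [apply upper_open| |].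
  - intros tau _; unfold eta2; change (Cscal 2) with (Cmult (RtoC 2)).
    replace (grid tau 0 (1 / 2)) with (Cscal (1 / 2) tau); auto.
    unfold grid; apply injective_projections; simpl; ring.
  - apply Diff_mul; [apply Diff_const|apply Diff_wzeta_tau, nonint_half2].
Qed.

Lemma Diff_g2 n : Diff upper n g2.
Proof.
  apply Diff_ext with (fun tau => 60 * fsum ZZ_sq (fun p => li tau p * li tau p * li tau p * li tau p))%C;
    [apply upper_open| |].
  - intros tau Htau; unfold g2; change (Cscal 60) with (Cmult (RtoC 60)).
    rewrite lat_sum_guard; f_equal; apply fsum_ext; intros p.
    unfold li, guard; destruct (origin p) eqn:Hp; [ring|].
    change Defs.Cinv with Cinv.
    change (Defs.Cpow (lp tau p) 4) with (lp tau p * (lp tau p * (lp tau p * (lp tau p * 1))))%C.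
    assert (lp tau p <> 0%C) by (intros E; apply (offpoles_0 tau Htau p Hp); auto).
    field; auto.
  - apply Diff_mul; [apply Diff_const|].
    apply (Diff_fsum_upper n (fun p tau => li tau p * li tau p * li tau p * li tau p)%C).
    apply FD_weaken with 4%nat; auto using ZZ_wt01.
    FDmul 3%nat 1%nat; [FDmul 2%nat 1%nat; [FDmul 1%nat 1%nat|]|]; apply FD_li_tau.
Qed.

Lemma Z_rs_grid r s tau :
  Z_rs r s tau = (wzeta (grid tau r s) tau - r * eta1 tau - s * eta2 tau)%C.
Proof. reflexivity. Qed.

Lemma den_rs_E3 r s tau : den_rs r s tau = (2 * E3 tau (Z_rs r s tau) (grid tau r s))%C.
Proof.
  unfold den_rs, E3; apply Csub_eq0.
  change (alpha_rs r s tau) with (grid tau r s).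
  generalize (Z_rs r s tau) (wp (grid tau r s) tau) (wp' (grid tau r s) tau); intros Z P P'.
  apply injective_projections; simpl; ring.
Qed.

Lemma num_rs_expr r s tau : num_rs r s tau =
  (3 * wp' (grid tau r s) tau * Z_rs r s tau * Z_rs r s tau
   + (12 * wp (grid tau r s) tau * wp (grid tau r s) tau - g2 tau) * Z_rs r s tau
   + 3 * wp (grid tau r s) tau * wp' (grid tau r s) tau)%C.
Proof.
  unfold num_rs; apply Csub_eq0.
  change (alpha_rs r s tau) with (grid tau r s).
  generalize (Z_rs r s tau) (wp (grid tau r s) tau) (wp' (grid tau r s) tau) (g2 tau); intros Z P P' g.
  apply injective_projections; simpl; ring.
Qed.

Lemma cder_finite_limit (f : C -> C) tau0 l : cder f tau0 l ->
  forall eps, eps > 0 -> exists delta, delta > 0 /\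
    forall tau : C, Cmod (tau - tau0) < delta -> Cmod (f tau - f tau0) < eps.
Proof.
  intros H eps He; destruct (cder_lipschitz _ _ _ H) as (d & M & d0 & M0 & HM).
  exists (Rmin d (eps / (M + 1))); split; [apply Rmin_pos; auto; apply Rdiv_lt_0_compat; lra|].
  intros tau Hd.
  assert (H1 : Cmod (tau - tau0) < d) by (eapply Rlt_le_trans; [apply Hd|apply Rmin_l]).
  assert (H2 : Cmod (tau - tau0) < eps / (M + 1)) by (eapply Rlt_le_trans; [apply Hd|apply Rmin_r]).
  specialize (HM _ H1); replace (tau0 + (tau - tau0))%C with tau in HM by ring.
  eapply Rle_lt_trans; [apply HM|].
  apply Rmult_lt_compat_l with (r := M + 1) in H2; [|lra].
  replace ((M + 1) * (eps / (M + 1))) with eps in H2 by (field; lra).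
  pose proof (Cmod_ge_0 (tau - tau0)); nra.
Qed.

Theorem theorem1p1 :
  forall r s : R,
    ~ (exists m n : Z, r = IZR m / 2 /\ s = IZR n / 2) ->
    forall tau0 : Cpx,
      Cim tau0 > 0 ->
      Cim (t_of tau0) = 0 -> t_of tau0 <> Czero -> t_of tau0 <> Cone ->
      wp_p_finite_at r s tau0.
Proof.
  intros r s Hrs tau0 Ht Him H0 H1.
  assert (Ht' : 0 < snd tau0) by exact Ht.
  destruct (orthogonal_basis tau0 Ht' Him H0 H1) as (a1 & b1 & a2 & b2 & b & b0 & Hdet & Ho).
  pose proof (E3_rs_neq_0 tau0 a1 b1 a2 b2 b r s Ht' b0 Hdet Ho Hrs) as HE.
  rewrite <- Z_rs_grid in HE.
  assert (Hden : den_rs r s tau0 <> RtoC 0).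
  { rewrite den_rs_E3; apply Cmult_neq_0; auto; intros E; apply RtoC_inj in E; lra. }
  assert (Hni : nonint r s).
  { intros (m & n & -> & ->); apply Hrs; exists (2 * m)%Z, (2 * n)%Z; rewrite !mult_IZR; split; field. }
  pose proof (Diff_wp_tau r s Hni 1) as DP; pose proof (Diff_wp'_tau r s Hni 1) as DP'.
  pose proof (Diff_wzeta_tau r s Hni 1) as DZ0; pose proof (Diff_eta1 1) as D1;
    pose proof (Diff_eta2 1) as D2; pose proof (Diff_g2 1) as Dg.
  assert (DZ : Diff upper 1 (Z_rs r s)).
  { apply Diff_ext with (fun tau => wzeta (grid tau r s) tau - r * eta1 tau - s * eta2 tau)%C;
      [apply upper_open|reflexivity|]; solve_Diff. }
  assert (DD : Diff upper 1 (den_rs r s)).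
  { apply Diff_ext with (fun tau => 2 * E3 tau (Z_rs r s tau) (grid tau r s))%C;
      [apply upper_open|intros; rewrite den_rs_E3; auto|]; unfold E3; solve_Diff. }
  assert (DN : Diff upper 1 (num_rs r s)).
  { eapply Diff_ext; [apply upper_open|intros tau _; symmetry; apply num_rs_expr|]; solve_Diff. }
  apply Diff_S in DP; destruct DP as [P1 [HP _]]; specialize (HP tau0 Ht').
  apply Diff_S in DD; destruct DD as [Dd [HD _]]; specialize (HD tau0 Ht').
  apply Diff_S in DN; destruct DN as [N1 [HN _]]; specialize (HN tau0 Ht').
  (* Since the denominator is nonzero at [tau0], the defining formula is differentiable there, and
     its own value is the required limit. *)
  pose proof (cder_add _ _ _ _ _ HP (cder_mul _ _ _ _ _ HN (cder_inv _ _ _ Hden HD))) as HW.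
  exists (wp_p r s tau0); intros eps He.
  destruct (cder_finite_limit _ _ _ HW eps He) as [delta [d0 Hd]].
  exists delta; split; auto; intros tau _ _ Hdist _.
  exact (Hd tau Hdist).
Qed.
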